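(* Let $n \ge 1$, let $\Omega \subset \mathbb{R}^n$ be an open set, let $\sigma \in (0,1]$, $p \in [1,\infty]$ and $\alpha > 0$. Let $f \in W^{\sigma,p}(\Omega)$ satisfy $$\int_\Omega |f|^{-\alpha} < \infty ,$$ and let $$\Sigma := \Big\{x \in \Omega : \ \lim_{r \to 0} \frac{1}{|B_r(x)|}\int_{B_r(x)} |f| = 0\Big\}.$$ Then $\mathcal{H}^s(\Sigma) = 0$, where $s = \max\big\{0,\ n-\sigma\frac{p\alpha}{p+\alpha}\big\}$ (for $p=\infty$ the quotient $\frac{p\alpha}{p+\alpha}$ is read as $\alpha$).
   Context: $\mathcal{H}^s$ is the $s$-dimensional Hausdorff measure on $\mathbb{R}^n$ ($\mathcal{H}^0$ is counting measure), $B_r(x)$ is the ball of radius $r$ centered at $x$, and $|A|$ is the Lebesgue measure of $A$. The function $|f|^{-\alpha}$ is taken to be $+\infty$ where $f=0$. For an open set $\Omega\subset\mathbb{R}^n$, the homogeneous seminorms are: for $\sigma = 1$, $[f]_{\dot W^{1,p}(\Omega)} := \|\nabla f\|_{L^p(\Omega)}$ (weak gradient); for $\sigma\in(0,1)$ and $p \in [1,\infty)$, $$[f]_{\dot W^{\sigma,p}(\Omega)} := \left(\int_\Omega\int_\Omega \left(\frac{|f(x)-f(y)|}{|x-y|^\sigma}\right)^p \frac{dx\,dy}{|x-y|^n}\right)^{1/p};$$ for $\sigma \in (0,1)$ and $p=\infty$, $[f]_{\dot W^{\sigma,\infty}(\Omega)} := \sup_{x\ne y}\frac{|f(x)-f(y)|}{|x-y|^\sigma}$.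 The space $W^{\sigma,p}(\Omega)$, $\sigma\in(0,1]$, $p\in[1,\infty]$, consists of all functions $f:\Omega\to\mathbb{R}$ with finite norm $\|f\|_{W^{\sigma,p}(\Omega)} := \|f\|_{L^p(\Omega)} + [f]_{\dot W^{\sigma,p}(\Omega)}$. *)

(* Defs.v *)
From HB Require Import structures.
From mathcomp Require Import all_boot all_order all_algebra.
From mathcomp Require Import all_classical all_reals all_analysis.
From mathcomp Require Import measurable_realfun.

Set Implicit Arguments.
Unset Strict Implicit.
Unset Printing Implicit Defensive.

Import Order.TTheory GRing.Theory Num.Def Num.Theory.
Import numFieldNormedType.Exports.

Local Open Scope classical_set_scope.
Local Open Scope ring_scope.

(* R^n is 'rV[R]_n.  Its library norm is the max norm; this gives the usual
   topology, but distances, balls and diameters below are Euclidean. *)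
Section euclidean.
Context {R : realType} {n : nat}.
Implicit Types (x y : 'rV[R]_n) (A : set 'rV[R]_n).

Definition enorm x : R := Num.sqrt (\sum_(i < n) x ord0 i ^+ 2).

Definition eball x (r : R) : set 'rV[R]_n := [set y | enorm (y - x) < r].

(* equal to -oo on set0, and >= 0 on every other set *)
Definition ediam A : \bar R :=
  ereal_sup [set (enorm (z.1 - z.2))%:E | z in A `*` A].

End euclidean.

Definition rV_display : measure_display.
Proof. exact. Qed.

Section measurable_rV.
Context {R : realType} {n : nat}.

Definition rV_coord (i : 'I_n) (x : 'rV[R]_n) : measurableTypeR R := x ord0 i.

Let rV_set0 : g_sigma_preimage rV_coord set0.
Proof. exact: sigma_algebra0. Qed.

Let rV_setC A : g_sigma_preimage rV_coord A -> g_sigma_preimage rV_coord (~` A).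
Proof. exact: sigma_algebraC. Qed.

Let rV_bigcup (F : (set 'rV[R]_n)^nat) :
  (forall i, g_sigma_preimage rV_coord (F i)) ->
  g_sigma_preimage rV_coord (\bigcup_i F i).
Proof. exact: sigma_algebra_bigcup. Qed.

(* the Borel sigma-algebra of R^n, as the n-fold product of that of R *)
HB.instance Definition _ := @isMeasurable.Build rV_display 'rV[R]_n
  (g_sigma_preimage rV_coord) rV_set0 rV_setC rV_bigcup.

End measurable_rV.

Section rV_cons.
Context {R : realType}.

Definition rV_cons n (z : measurableTypeR R * 'rV[R]_n) : 'rV[R]_n.+1 :=
  row_mx (const_mx z.1 : 'rV[R]_1) z.2.

Lemma measurable_rV_coord n (i : 'I_n) :
  measurable_fun [set: 'rV[R]_n] (@rV_coord R n i).
Proof.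
move=> _ Y mY; rewrite setTI; apply: sub_sigma_algebra => /=.
rewrite -bigcup_seq/=; exists i => /=; first by rewrite mem_index_enum.
by exists Y => //; rewrite setTI.
Qed.

Lemma measurable_to_rV d (T : measurableType d) n (f : T -> 'rV[R]_n) :
  (forall i, measurable_fun [set: T] (rV_coord i \o f)) ->
  measurable_fun [set: T] f.
Proof.
move=> mf _ A mA; rewrite setTI.
suff H : g_sigma_preimage (@rV_coord R n) `<=` [set B | measurable (f @^-1` B)].
  exact: H.
apply: smallest_sub.
  split=> [|B mB|F mF] /=; first by rewrite preimage_set0.
  - by rewrite setTD -preimage_setC; exact: measurableC.
  - by rewrite preimage_bigcup; apply: bigcupT_measurable => k; exact: mF.
rewrite -bigcup_seq => B [i _ [Y mY <-]] /=.
rewrite setTI -comp_preimage -[X in measurable X]setTI.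
exact: (mf i measurableT Y mY).
Qed.

Lemma measurable_rV_cons n : measurable_fun setT (@rV_cons n).
Proof.
apply: measurable_to_rV => i.
rewrite (_ : _ \o _ = if fintype.split (i : 'I_(1 + n)) is inr j then
    rV_coord j \o snd else fst); last first.
  apply/funext => z /=; rewrite /rV_coord /rV_cons mxE.
  by case: fintype.split => j; rewrite ?mxE.
case: fintype.split => j; first exact: measurable_fst.
exact: measurableT_comp (measurable_rV_coord j) measurable_snd.
Qed.

Definition rV_uncons n (x : 'rV[R]_n.+1) : measurableTypeR R * 'rV[R]_n :=
  (rV_coord ord0 x, rsubmx (x : 'rV[R]_(1 + n))).

Lemma rV_consK n : cancel (@rV_cons n) (@rV_uncons n).
Proof.
case=> x y; rewrite /rV_uncons /rV_cons /= row_mxKr; congr pair.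
by rewrite /rV_coord /rV_cons mxE; case: splitP => j //; rewrite mxE.
Qed.

Lemma measurable_rV_uncons n : measurable_fun setT (@rV_uncons n).
Proof.
apply/measurable_fun_pairP; split; first exact: measurable_rV_coord.
apply: measurable_to_rV => i.
rewrite (_ : _ \o _ = rV_coord (rshift 1 i)); first exact: measurable_rV_coord.
by apply/funext => x; rewrite /rV_coord /= mxE.
Qed.


Lemma product_measure_sigma_finite d1 d2 (T1 : measurableType d1)
    (T2 : measurableType d2) (m1 : {sigma_finite_measure set T1 -> \bar R})
    (m2 : {sigma_finite_measure set T2 -> \bar R}) :
  sigma_finite setT (m1 \x m2)%E.
Proof.
have /sigma_finiteP[F [TF ndF Foo]] := sigma_finiteT m1.
have /sigma_finiteP[G [TG ndG Goo]] := sigma_finiteT m2.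
exists (fun n => F n `*` G n).
  rewrite -setXTT TF TG predeqE => -[x y]; split.
    move=> [/= [n _ Fnx] [k _ Gky]]; exists (maxn n k) => //; split.
    - by move: x Fnx; exact/subsetPset/ndF/leq_maxl.
    - by move: y Gky; exact/subsetPset/ndG/leq_maxr.
  by move=> [n _ []/= ? ?]; split; exists n.
move=> k; have [? ?] := Foo k; have [? ?] := Goo k.
split; first exact: measurableX.
by rewrite product_measure1E// lte_mul_pinfty// ge0_fin_numE.
Qed.

End rV_cons.

Section lebesgue_cons.
Context {R : realType} {n : nat}.
Variable m : {sigma_finite_measure set 'rV[R]_n -> \bar R}.

Definition lebesgue_cons : set 'rV[R]_n.+1 -> \bar R :=
  pushforward (@lebesgue_measure R \x m)%E (@rV_cons R n).

HB.instance Definition _ := Measure.copy lebesgue_cons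
  (measure_function_pushforward__canonical__measure_function_Measure
    (@lebesgue_measure R \x m)%E (@measurable_rV_cons R n)).

Let lebesgue_cons_sigma_finite : sigma_finite setT lebesgue_cons.
Proof.
pose l : {sigma_finite_measure set (measurableTypeR R) -> \bar R} :=
  @lebesgue_measure R.
have [F TF mF] := product_measure_sigma_finite l m.
exists (fun k => @rV_uncons R n @^-1` F k).
  by rewrite -preimage_bigcup -TF preimage_setT.
move=> k; have [mFk Fkoo] := mF k; split.
  by rewrite -[X in measurable X]setTI; exact: measurable_rV_uncons.
rewrite /lebesgue_cons /pushforward -comp_preimage.
by rewrite (_ : _ \o _ = id)//; apply/funext => z; exact: rV_consK.
Qed.

HB.instance Definition _ := Measure_isSigmaFinite.Build _ _ _ lebesgue_cons
  lebesgue_cons_sigma_finite.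

End lebesgue_cons.

(* the Lebesgue measure of R^n on Borel sets, as an n-fold product measure *)
Fixpoint lebesgue_rV {R : realType} (n : nat) :
    {sigma_finite_measure set 'rV[R]_n -> \bar R} :=
  match n with
  | 0%N => \d_(0 : 'rV[R]_0)
  | m.+1 => lebesgue_cons (lebesgue_rV m)
  end.

Section hausdorff.
Context {R : realType} {n : nat}.
Implicit Types (s delta : R) (A : set 'rV[R]_n).
Local Open Scope ereal_scope.

(* diam(A)^s, with value 0 on the empty set and, since x `^ 0 = 1 for every x,
   value 1 on nonempty sets when s = 0 *)
Definition diam_pow s A : \bar R :=
  if `[< A = set0 >] then 0 else ediam A `^ s.

Definition hausdorff_delta s delta A : \bar R :=
  ereal_inf [set \sum_(0 <= k <oo) diam_pow s (F k) |
    F in [set F : (set 'rV[R]_n)^nat |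
      A `<=` \bigcup_k F k /\ forall k, ediam (F k) <= delta%:E]].

(* without the normalizing constant, which equals 1 for s = 0, so that
   hausdorff 0 is the counting measure *)
Definition hausdorff s A : \bar R :=
  ereal_sup [set hausdorff_delta s delta A | delta in [set d : R | (0 < d)%R]].

End hausdorff.

Section sobolev.
Context {R : realType} {n : nat}.
Implicit Types (Omega : set 'rV[R]_n) (f phi : 'rV[R]_n -> R)
  (G : 'rV[R]_n -> 'rV[R]_n) (sigma : R) (p : \bar R).
Local Notation mu := (@lebesgue_rV R n).

(* A function on Omega is represented by a total function, whose values outside
   Omega do not matter. *)

(* Measurability with respect to the completion of mu.  The library integral of
   a nonnegative function is a supremum over Borel simple functions below it,
   hence it is the Lebesgue integral for such functions as well. *)
Definition lebesgue_measurable_fun Omega f :=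
  forall B : set (measurableTypeR R), measurable B ->
    completed_algebra_gen mu (Omega `&` f @^-1` B).

Definition locally_integrable_on Omega f :=
  lebesgue_measurable_fun Omega f /\
  forall K, compact K -> K `<=` Omega ->
    (\int[mu]_(x in K) `|f x|%:E < +oo)%E.

Definition Lnorm_on Omega p f : \bar R := 'N[mu]_p[EFin \o (f \_ Omega)]%E.

Definition partial (i : 'I_n) phi : 'rV[R]_n -> R :=
  fun x => 'D_(delta_mx ord0 i) phi x.

Fixpoint class_C k phi : Prop :=
  match k with
  | 0%N => continuous phi
  | k'.+1 => continuous phi /\
      forall i, (forall x, derivable phi x (delta_mx ord0 i)) /\
                class_C k' (partial i phi)
  end.

(* phi \in C_c^\infty(Omega) *)
Definition test_function Omega phi :=
  [/\ forall k, class_C k phi,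
      compact (closure [set x | phi x != 0]) &
      closure [set x | phi x != 0] `<=` Omega].

Definition weak_gradient Omega f G :=
  [/\ locally_integrable_on Omega f,
      forall i, locally_integrable_on Omega (fun x => G x ord0 i) &
      forall i phi, test_function Omega phi ->
        (\int[mu]_(x in Omega) (f x * partial i phi x)%:E =
         - \int[mu]_(x in Omega) (G x ord0 i * phi x)%:E)%E].

(* The weak gradient is unique almost everywhere, so the infimum is over at most
   one value; it is +oo when f has no weak gradient. *)
Definition gradient_seminorm Omega p f : \bar R :=
  ereal_inf [set Lnorm_on Omega p (fun x => enorm (G x)) |
    G in weak_gradient Omega f].

Definition gagliardo_seminorm Omega sigma (q : R) f : \bar R :=
  ((\int[mu]_(x in Omega) \int[mu]_(y in Omega)
     (((`|f x - f y| / enorm (x - y) `^ sigma) `^ q)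
        / enorm (x - y) ^+ n)%:E) `^ q^-1)%E.

(* maxe only matters for Omega = set0, where the supremum is -oo *)
Definition holder_seminorm Omega sigma f : \bar R :=
  maxe 0%E (ereal_sup
    [set (`|f z.1 - f z.2| / enorm (z.1 - z.2) `^ sigma)%:E |
      z in [set z | [/\ Omega z.1, Omega z.2 & z.1 != z.2]]]).

Definition sobolev_seminorm Omega sigma p f : \bar R :=
  if sigma == 1 then gradient_seminorm Omega p f
  else match p with
       | q%:E => gagliardo_seminorm Omega sigma q f
       | _ => holder_seminorm Omega sigma f
       end.

Definition sobolev_norm Omega sigma p f : \bar R :=
  (Lnorm_on Omega p f + sobolev_seminorm Omega sigma p f)%E.

Definition sobolev_space Omega sigma p : set ('rV[R]_n -> R) :=
  [set f | lebesgue_measurable_fun Omega f /\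
           (sobolev_norm Omega sigma p f < +oo)%E].

(* |f|^-alpha; note that 0 `^ (- alpha) = 0 in the library *)
Definition neg_pow alpha f x : \bar R :=
  if f x == 0 then +oo%E else (`|f x| `^ (- alpha))%:E.

Definition avg_abs f (A : set 'rV[R]_n) : \bar R :=
  ((mu A)^-1 * \int[mu]_(y in A) `|f y|%:E)%E.

Definition lebesgue_zero_set Omega f : set 'rV[R]_n :=
  [set x | Omega x /\ avg_abs f (eball x r) @[r --> 0^'+] --> 0%E].

(* p * alpha / (p + alpha) *)
Definition harmonic_exponent p alpha : R :=
  match p with
  | q%:E => q * alpha / (q + alpha)
  | _ => alpha
  end.

End sobolev.

(* Main.v *)
(** Let [Q_j(x)] be the half-open dyadic cell of side [2^-j] containing [x] and
    let [nu] be the measure whose density is [|f|^-alpha] plus the local energy of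
    [f].  If [nu(Q_j(x)) < eta 2^(-js)] for all large [j], then a Poincare
    inequality on the cells shows that the averages [A_j] of [|f|] over [Q_j(x)]
    satisfy [A_j <= A_(j+1) + C eta^theta 2^(-j gamma)] with [theta = 1/p] and
    [gamma = sigma - (n - s) theta > 0].  If moreover [A_j -> 0], summation gives
    [A_j <= C' eta^theta 2^(-j gamma)], whereas the smallness of the integral of
    [|f|^-alpha] gives [A_j >= c eta^(-1/alpha) 2^(-j gamma)]: a contradiction when
    [eta] is small.  So every point of the zero set lies in arbitrarily small cells
    with [nu(Q) >= eta 2^(-js)].  The maximal cells of this kind of side at most
    [2^-j0] are disjoint; the sum of the [2^(-js)] is at most [nu(S) / eta], where
    [S] is their union, and the measure of [S] is [O(2^(-j0 (n - s)))], so [nu(S)]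
    tends to [0] by absolute continuity.

    For [sigma = 1] the Poincare inequality is derived from the weak gradient
    without mollification.  A cell is cut into [2^(l n)] subcells; testing with a
    product of smooth cutoffs, one of which is replaced by the primitive of a
    difference of two translated cutoffs, compares the integrals of [f] over two
    subcells that differ in one coordinate.  Changing one coordinate at a time
    bounds the sum over all subcells of [|int (f - c)|], and as [l] grows this sum
    reaches the integral of [|f - c|] because unions of subcells approximate the
    set where [f >= c]. *)

Require Import Defs.
From HB Require Import structures.
From mathcomp Require Import all_boot all_order all_algebra.
From mathcomp Require Import all_classical all_reals all_analysis.
From mathcomp Require Import measurable_realfun.
From mathcomp Require Import ess_sup_inf.
From mathcomp Require Import ring lra zify.

Set Implicit Arguments.
Unset Strict Implicit.
Unset Printing Implicit Defensive.

Import Order.TTheory GRing.Theory Num.Def Num.Theory.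
Import numFieldNormedType.Exports.

Local Open Scope classical_set_scope.
Local Open Scope ring_scope.

(** * Dyadic cells *)

Section boxes.
Context {R : realType}.

(** All four cases pass through [hausdorff_lebesgue_zero_set], whose parameter [theta] is 0 for
    infinite [p]; there the oscillation bound holds without any energy and the density [g] is zero.
    With beta = sigma alpha / (1 + alpha theta), which is the number subtracted from n in the
    dimension, one has sigma - beta theta = beta / alpha. So s = n - beta, when nonnegative, is
    exactly the dimension for which gamma alpha + s = n: the upper and lower bounds for A_j then
    scale alike, and only the size of eta decides between them. Two obstacles shape the rest. First,
    [f] is measurable only for the completion, while measurability and Tonelli are available for
    Borel functions; hence [f] is replaced by its zero extension from [Omega] minus a Borel null set
    [N], which is Borel and has the same cell averages. Secondly, test functions must be smooth in
    all variables; products of one-variable functions reduce this to calculus on the line. The zero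
    set is defined with Euclidean balls, but these are needed only to bound cell averages by ball
    averages; nestedness of the cells takes the place of a covering theorem. *)

Definition box n (a b : 'I_n -> R) : set 'rV[R]_n :=
  [set y | forall i, a i <= y ord0 i < b i].

Lemma measurable_box n (a b : 'I_n -> R) : measurable (box a b).
Proof.
rewrite (_ : box a b = \big[setI/setT]_(i < n) (rV_coord i @^-1` `[a i, b i[)).
  apply: bigsetI_measurable => i _; rewrite -[X in measurable X]setTI.
  exact: measurable_rV_coord.
rewrite -bigcap_seq; apply/seteqP; split => [y yab i _|y yab i].
  by rewrite /= in_itv/=; exact: yab.
by have := yab i (mem_index_enum i); rewrite /= in_itv.
Qed.

Lemma rV_cons_ord0 n (z : measurableTypeR R * 'rV[R]_n) :
  rV_cons z ord0 ord0 = z.1.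
Proof.
by rewrite /rV_cons mxE; case: splitP => // j; rewrite mxE.
Qed.

Lemma rV_cons_lift n (z : measurableTypeR R * 'rV[R]_n) i :
  rV_cons z ord0 (lift ord0 i) = z.2 ord0 i.
Proof.
rewrite /rV_cons mxE; case: splitP => [[[]]//|j ij].
by congr (z.2 _ _); apply: val_inj; case: ij.
Qed.

Lemma lebesgue_box n (a b : 'I_n -> R) : (forall i, a i <= b i) ->
  lebesgue_rV n (box a b) = (\prod_(i < n) (b i - a i))%:E.
Proof.
elim: n a b => [|n IH] a b ab.
  rewrite big_ord0 /= diracE mem_set//; by case.
transitivity ((@lebesgue_measure R \x lebesgue_rV n)%E
    (`[a ord0, b ord0[%classic `*`
     @box n (fun i => a (lift ord0 i)) (fun i => b (lift ord0 i)))).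
  congr ((_ \x _)%E _); apply/seteqP; split => -[t y] /= H.
    split; first by have := H ord0; rewrite rV_cons_ord0/= in_itv.
    by move=> i; have := H (lift ord0 i); rewrite rV_cons_lift.
  move=> i; case: (unliftP ord0 i) => [j|] ->.
    by rewrite rV_cons_lift; exact: (H.2 j).
  by rewrite rV_cons_ord0; have := H.1; rewrite in_itv.
rewrite product_measure1E//; last exact: measurable_box.
rewrite IH; last by move=> i; exact: ab.
rewrite big_ord_recl [X in (X * _)%E](lebesgue_measure_itv) /= lte_fin.
case: ltP => [_|ba]; first by rewrite -EFinB -EFinM.
have -> : a ord0 = b ord0 by apply/eqP; rewrite eq_le ab ba.
by rewrite subrr mul0r mul0e.
Qed.

End boxes.

Section dyadic.
Context {R : realType} {n : nat}.
Implicit Types (j : nat) (x y : 'rV[R]_n) (k : {ffun 'I_n -> int}).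

Definition dyadic_index j x : {ffun 'I_n -> int} :=
  [ffun i => Num.floor (2 ^+ j * x ord0 i)].

Definition cell j k : set 'rV[R]_n := [set y | dyadic_index j y = k].

Lemma cellP j k y : cell j k y <->
  forall i, (k i)%:~R / 2 ^+ j <= y ord0 i < (k i + 1)%:~R / 2 ^+ j.
Proof.
have P : (0 : R) < 2 ^+ j by rewrite exprn_gt0.
split=> [<- i|H]; last first.
  apply/ffunP => i; rewrite ffunE; apply/floor_def.
  have /andP[h1 h2] := H i; apply/andP; split.
    by rewrite mulrC -ler_pdivrMr.
  by rewrite mulrC -ltr_pdivlMr.
by rewrite ffunE ler_pdivrMr// ltr_pdivlMr// ![_ * 2 ^+ j]mulrC floor_itv.
Qed.

Lemma cell_box j k :
  cell j k = box (fun i => (k i)%:~R / 2 ^+ j) (fun i => (k i + 1)%:~R / 2 ^+ j).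
Proof. by apply/seteqP; split => y /cellP. Qed.

Lemma measurable_cell j k : measurable (cell j k).
Proof. by rewrite cell_box; exact: measurable_box. Qed.

Lemma lebesgue_cell j k : lebesgue_rV n (cell j k) = (2 ^- (j * n))%:E.
Proof.
rewrite cell_box lebesgue_box; last first.
  by move=> i; rewrite ler_pM2r ?invr_gt0 ?exprn_gt0// ler_int lerDl.
congr EFin; under eq_bigr do rewrite -mulrBl rmorphD/= addrC addKr mul1r.
by rewrite prodr_const card_ord exprM exprVn.
Qed.

(** Halving: the index at one level is the floor of half the index at the next finer level, so
    equality passes to coarser levels one step at a time. *)
Lemma dyadic_index_le j j' x y : (j' <= j)%N ->
  dyadic_index j x = dyadic_index j y -> dyadic_index j' x = dyadic_index j' y.
Proof.
move=> /subnK <-; elim: (j - j')%N => // d IH.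
rewrite addSn => H; apply: IH; move: (d + j')%N H => {j d}j H.
apply/ffunP => i; have /ffunP/(_ i) := H; rewrite !ffunE => {}H.
suff P z : Num.floor (2 ^+ j * z : R) = (Num.floor (2 ^+ j.+1 * z : R) %/ 2)%Z.
  by rewrite !P H.
apply/floor_def; set F := Num.floor _.
have /andP[h1 h2] : F%:~R <= 2 ^+ j.+1 * z < (F + 1)%:~R by exact: floor_itv.
have := divz_eq F 2; have := ltz_pmod F (_ : (0 < 2)%R) => /(_ isT) h3.
have := modz_ge0 F (_ : (2 != 0)%R) => /(_ isT) h4 h5.
move: h1 h2; rewrite exprS; set G := (F %/ 2)%Z.
have h6 : (2 * G <= F)%R by rewrite h5 /G; lia.
have h7 : (F + 1 <= 2 * (G + 1))%R by rewrite [X in X + 1]h5 /G; lia.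
move: h6 h7; rewrite -!(ler_int R) !rmorphM/= => h6 h7 h8 h9.
by apply/andP; split; lra.
Qed.

Lemma cell_dyadic_index j x : cell j (dyadic_index j x) x.
Proof. by []. Qed.

Lemma cell_disjoint j k k' y : cell j k y -> cell j k' y -> k = k'.
Proof. by rewrite /cell/= => <-. Qed.

Lemma cell_subset j j' x : (j' <= j)%N ->
  cell j (dyadic_index j x) `<=` cell j' (dyadic_index j' x).
Proof. by move=> jj' y; apply: dyadic_index_le. Qed.

Lemma cell_dist j k x y i : cell j k x -> cell j k y ->
  `|x ord0 i - y ord0 i| <= 2 ^- j.
Proof.
move=> /cellP/(_ i)/andP[x1 x2] /cellP/(_ i)/andP[y1 y2].
have e : (k i + 1)%:~R / 2 ^+ j = (k i)%:~R / 2 ^+ j + 2 ^- j :> R.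
  by rewrite rmorphD/= mulrDl mul1r.
by move: x2 y2; rewrite e => x2 y2; rewrite ler_norml; apply/andP; split; lra.
Qed.

End dyadic.

(** * Integrals of functions measurable for the completion *)

Section integral_nonmeasurable.
Context d (T : measurableType d) (R : realType).
Variable mu : {measure set T -> \bar R}.
Local Open Scope ereal_scope.
Import HBNNSimple.

Lemma ge0_le_integral_nonmeas (D : set T) (f g : T -> \bar R) :
  (forall x, D x -> 0 <= f x) -> (forall x, D x -> f x <= g x) ->
  \int[mu]_(x in D) f x <= \int[mu]_(x in D) g x.
Proof.
move=> f0 fg; rewrite !ge0_integralE//; last first.
  by move=> x Dx; exact: le_trans (f0 _ Dx) (fg _ Dx).
apply: le_ereal_sup => _ [h /= hf <-]; exists h => //= x.
apply: (le_trans (hf x)); rewrite !patchE; case: ifPn => // xD.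
by apply: fg; rewrite inE in xD.
Qed.

Lemma ge0_subset_integral_nonmeas (A B : set T) (f : T -> \bar R) :
  A `<=` B -> (forall x, B x -> 0 <= f x) ->
  \int[mu]_(x in A) f x <= \int[mu]_(x in B) f x.
Proof.
move=> AB f0; rewrite integral_mkcond [leRHS]integral_mkcond.
apply: ge0_le_integral_nonmeas => x _; rewrite !patchE.
  by case: ifPn => //; rewrite inE => /AB; exact: f0.
case: ifPn; first by rewrite inE => /AB/mem_set ->.
by move=> _; case: ifPn => //; rewrite inE; exact: f0.
Qed.

(** The function [f] is arbitrary: its integral is a supremum over simple functions below it, and
    the null set is removed from each of these, where measurability is available. *)
Lemma ge0_integral_setD_null (D N : set T) (f : T -> \bar R) :
  measurable N -> mu N = 0 -> (forall x, D x -> 0 <= f x) ->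
  \int[mu]_(x in D) f x = \int[mu]_(x in D `\` N) f x.
Proof.
move=> mN N0 f0; apply/eqP; rewrite eq_le; apply/andP; split; last first.
  by apply: ge0_subset_integral_nonmeas => // x [].
rewrite ge0_integralE//; apply: ge_ereal_sup => _ [h /= hf <-].
rewrite -integralT_nnsfun (ge0_negligible_integral mN)//=; last 2 first.
- exact/measurable_EFinP.
- by move=> x _; rewrite lee_fin; exact: fun_ge0.
rewrite integral_mkcond [leRHS]integral_mkcond.
apply: ge0_le_integral_nonmeas => x _.
  by apply: erestrict_ge0 => y _; rewrite lee_fin; exact: fun_ge0.
rewrite !patchE; case: ifPn => [|_].
  rewrite inE => -[_ /= Nx]; have := hf x; rewrite patchE.
  case: ifPn => [|xD]; first by rewrite inE => Dx; rewrite mem_set.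
  by rewrite memNset// => -[/mem_set]; rewrite (negbTE xD).
by case: ifPn => //; rewrite inE => -[Dx _]; exact: f0.
Qed.

(** The bridge between a Lebesgue measurable function and its Borel version; only the zero
    extensions are compared, so the domains may differ as well. *)
Lemma integral_off_null (D D' N : set T) (f g : T -> \bar R) :
  measurable N -> mu N = 0 -> (forall x, ~ N x -> (f \_ D) x = (g \_ D') x) ->
  \int[mu]_(x in D) f x = \int[mu]_(x in D') g x.
Proof.
move=> mN N0 fg; rewrite integral_mkcond [RHS]integral_mkcond.
rewrite integralE [RHS]integralE; congr (_ - _);
  rewrite (ge0_integral_setD_null mN N0)// [RHS](ge0_integral_setD_null mN N0)//;
  apply: eq_integral => x; rewrite inE => -[_ /= Nx].
- by rewrite !funeposE fg.
- by rewrite !funenegE fg.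
Qed.

(** Rational thresholds make the condition countable, so that in [completed_Borel_core] one null set
    can collect all exceptional sets. *)
Lemma measurable_fun_rat (f : T -> R) :
  (forall q : rat, measurable (f @^-1` `]-oo, ratr q[)) ->
  measurable_fun setT f.
Proof.
move=> mf; apply: (measurability _ (RGenInftyO.measurableE R)) => //.
move=> _ [_ [x ->] <-]; rewrite setTI.
rewrite (_ : _ @^-1` _ =
    \bigcup_(q in [set q : rat | (ratr q <= x)%R]) (f @^-1` `]-oo, ratr q[)).
  by rewrite bigcup_mkcond; apply: bigcupT_measurable_rat => q; case: ifP.
apply/seteqP; split => [y|y [q /= qx]]; rewrite /= !in_itv/=.
  by move=> /rat_in_itvoo[q]; rewrite in_itv/= => /andP[yq qx]; exists q => /=;
    [exact: ltW|rewrite in_itv].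
by move=> /lt_le_trans; exact.
Qed.

(* Stated for every larger [N'], so that one null set serves several functions. *)
Lemma completed_Borel_core (D : set T) (f : T -> R) :
  (forall B : set (measurableTypeR R), measurable B ->
    completed_algebra_gen mu (D `&` f @^-1` B)) ->
  exists2 N, measurable N /\ mu N = 0 &
    forall N', N `<=` N' -> measurable N' ->
      measurable (D `\` N') /\ measurable_fun setT (f \_ (D `\` N')).
Proof.
move=> mf.
(* A set of the completion is a Borel set together with part of a null set [N]; deleting a Borel set
   that contains [N] leaves a Borel set. *)
have H (B : set (measurableTypeR R)) : measurable B ->
    exists N, (measurable N /\ mu N = 0) /\
      forall N', N `<=` N' -> measurable N' -> measurable ((D `&` f @^-1` B) `\` N').
  move=> /mf[A mA [M [N [mN N0 MN]] <-]]; exists N; split => // N' NN' mN'.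
  rewrite setDUl (_ : M `\` N' = set0) ?setU0; first exact: measurableD.
  by apply/seteqP; split => // x [/MN/NN'].
have {}H (B : set (measurableTypeR R)) :
    {N | measurable B -> (measurable N /\ mu N = 0) /\
      forall N', N `<=` N' -> measurable N' -> measurable ((D `&` f @^-1` B) `\` N')}.
  apply: cid; have [/H[N]|nB] := pselect (measurable B); first by exists N.
  by exists set0.
(* Codes of rationals give their rays and all other codes give [setT], so that the family is indexed
   by [nat]. *)
pose B k : set (measurableTypeR R) :=
  if @unpickle rat k is Some q then `]-oo, ratr q[%classic else setT.
have mB k : measurable (B k) by rewrite /B; case: unpickle.
pose F k := projT1 (H (B k)).
have FP k := projT2 (H (B k)) (mB k).
exists (projT1 (H setT) `|` \bigcup_k F k).
  have [[mT T0] _] := projT2 (H setT) measurableT.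
  have mF : measurable (\bigcup_k F k).
    by apply: bigcup_measurable => k _; have [[]] := FP k.
  have F0 : mu (\bigcup_k F k) = 0.
    apply/negligibleP => //; apply: negligible_bigcup => k.
    by have [[? ?] _] := FP k; exact/negligibleP.
  split; first exact: measurableU.
  by apply/negligibleP; [exact: measurableU|apply: negligibleU; exact/negligibleP].
move=> N'; rewrite subUset => -[TN' FN'] mN'.
have mD : measurable (D `\` N').
  have [_ /(_ _ TN' mN')] := projT2 (H setT) measurableT.
  by rewrite preimage_setT setIT.
split=> //; apply: measurable_fun_rat => q.
rewrite (_ : _ @^-1` _ = ((D `&` f @^-1` `]-oo, ratr q[) `\` N') `|`
   (if (0 < ratr q :> R)%R then ~` (D `\` N') else set0)); last first.
  apply/seteqP; split => x /=; rewrite !in_itv/= patchE.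
    case: ifPn => [|xD]; first by rewrite inE => -[Dx Nx] fq; left.
    by move=> q0; right; rewrite q0 => /mem_set; rewrite (negbTE xD).
  by case=> [[[Dx fq] Nx]|]; [rewrite mem_set|case: ifPn => //= q0 nD; rewrite memNset].
apply: measurableU; last by case: ifP => // _; exact: measurableC.
have FN : F (pickle q) `<=` N'.
  by apply: subset_trans FN' => y Fy; exists (pickle q).
have [_ /(_ _ FN mN')] := FP (pickle q).
by rewrite {1}/B pickleK.
Qed.

End integral_nonmeasurable.

(** * Hausdorff measure *)

Section enorm_lemmas.
Context {R : realType} {n : nat}.
Implicit Type x : 'rV[R]_n.

Lemma enorm_ge0 x : 0 <= enorm x.
Proof. exact: sqrtr_ge0. Qed.

Lemma enorm_le x c : 0 <= c -> (forall i, `|x ord0 i| <= c) ->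
  enorm x <= n%:R * c.
Proof.
move=> c0 xc; rewrite -[leRHS]ger0_norm ?mulr_ge0// -sqrtr_sqr ler_wsqrtr//.
apply: (@le_trans _ _ (\sum_(i < n) c ^+ 2)).
  by apply: ler_sum => i _; rewrite -real_normK ?num_real// lerXn2r ?nnegrE.
rewrite sumr_const card_ord exprMn -[leLHS]mulr_natl ler_wpM2r ?sqr_ge0//.
by rewrite -natrX ler_nat expnS expn1; case: n => // m; rewrite leq_pmulr.
Qed.

Lemma le_coord_enorm x i : `|x ord0 i| <= enorm x.
Proof.
rewrite -sqrtr_sqr ler_wsqrtr// (bigD1 i)//= lerDl.
by apply: sumr_ge0 => j _; exact: sqr_ge0.
Qed.

End enorm_lemmas.

(** Here [w] is extended-valued; the statement for real functions is applied to [fine \o w], which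
    agrees with [w] almost everywhere because an integrable function is almost everywhere finite. *)
Lemma integral_abs_continuous d (T : measurableType d) (R : realType)
    (mu : {measure set T -> \bar R}) (w : T -> \bar R) :
  mu.-integrable setT w -> (forall x, 0 <= w x)%E ->
  forall e : R, 0 < e -> exists2 d : R, 0 < d &
    forall A, measurable A -> (mu A < d%:E)%E -> (\int[mu]_(x in A) w x < e%:E)%E.
Proof.
move=> iw w0 e e0.
have aw : ae_eq mu setT w (EFin \o (fine \o w)).
  have := integrable_ae measurableT iw; apply: filterS => x /(_ Logic.I) wx _ /=.
  by rewrite fineK.
have mw : measurable_fun setT (EFin \o (fine \o w)).
  apply/measurable_EFinP/measurableT_comp => //.
  exact: measurable_int iw.
have iw' : mu.-integrable setT (EFin \o (fine \o w)).
  apply/integrableP; split => //.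
  have /integrableP[mw1 iwoo] := iw.
  apply: le_lt_trans iwoo; rewrite le_eqVlt; apply/orP; left; apply/eqP.
  apply: ae_eq_integral => //.
  - exact: measurableT_comp.
  - exact: measurableT_comp.
  - by apply: filterS aw => x /= /(_ Logic.I) -> _.
have [d1 [d0 H]] := integral_normr_continuous iw' e0.
exists d1 => // A mA mAd; have {H} := H A mA mAd.
rewrite -lte_fin /Rintegral.
have E : (\int[mu]_(x in A) (`|fine (w x)|)%:E = \int[mu]_(x in A) w x)%E.
  apply: ae_eq_integral => //.
  - apply: measurable_funTS; apply/measurable_EFinP/measurableT_comp => //.
    exact/measurable_EFinP.
  - by apply: measurable_funTS; exact: measurable_int iw.
  - apply: filterS aw => x /= /(_ Logic.I) wx _.
    by rewrite ger0_norm ?fine_ge0// -wx.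
rewrite E fineK// ge0_fin_numE; last by apply: integral_ge0 => x _.
have /integrableP[_] := iw; apply: le_lt_trans.
under [leRHS]eq_integral do rewrite gee0_abs//.
exact: ge0_subset_integral_nonmeas.
Qed.

Lemma geometric_eventually_lt (R : realType) (K q e : R) :
  0 <= q < 1 -> 0 < e -> exists N, forall j, (N <= j)%N -> K * q ^+ j < e.
Proof.
move=> /andP[q0 q1] e0.
have q1' : `|q| < 1 by rewrite ger0_norm.
have /cvgr0_norm_lt/(_ e e0) := cvg_geometric K q1'.
by move=> [N _ H]; exists N => j /H /=; apply: le_lt_trans; exact: ler_norm.
Qed.

Section powers_of_half.
Context {R : realType}.
Implicit Types (j : nat) (t : R).

Lemma half_gt0 j : 0 < 2 ^- j :> R.
Proof. by rewrite invr_gt0 exprn_gt0. Qed.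

Lemma half_lt1 : 0 <= (2^-1 : R) < 1.
Proof. by apply/andP; split; lra. Qed.

Lemma powR_half_expr j t : (2 ^- j) `^ t = (2^-1 `^ t) ^+ j.
Proof.
by rewrite -exprVn -powR_mulrn ?invr_ge0// -powRrM mulrC powRrM powR_mulrn ?powR_ge0.
Qed.

Lemma powR_half_lt1 t : 0 < t -> 0 <= (2^-1 : R) `^ t < 1.
Proof.
move=> t0; rewrite powR_ge0/= -[ltRHS](congr1 (fun f => f t) (@powR1 R)).
by rewrite gt0_ltr_powR ?nnegrE ?invr_ge0// invf_lt1// ltr1n.
Qed.

Lemma half_le i j : (i <= j)%N -> 2 ^- j <= 2 ^- i :> R.
Proof. by move=> ij; rewrite lef_pV2 ?posrE ?exprn_gt0// ler_weXn2l// ler1n. Qed.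

End powers_of_half.

Section hausdorff_null.
Context {R : realType} {n : nat}.
Local Notation mu := (@lebesgue_rV R n).
Local Open Scope ereal_scope.

Lemma ediam_cell j k : ediam (@cell R n j k) <= (n%:R * 2 ^- j)%:E.
Proof.
apply: ge_ereal_sup => _ [[x y] [/= kx ky] <-]; rewrite lee_fin.
apply: enorm_le => [|i]; first by rewrite invr_ge0 exprn_ge0.
by rewrite !mxE; exact: cell_dist kx ky.
Qed.

Lemma diam_pow_cell s j k : (0 <= s)%R ->
  diam_pow s (@cell R n j k) <= (n%:R `^ s * (2 ^- j) `^ s)%:E.
Proof.
move=> s0; rewrite /diam_pow; case: asboolP => [_|k0].
  by rewrite lee_fin mulr_ge0 ?powR_ge0.
have j0 : (0 <= 2 ^- j :> R)%R by rewrite invr_ge0 exprn_ge0.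
rewrite -powRM//; have := @ediam_cell j k.
have : 0 <= ediam (@cell R n j k).
  have [x kx] : @cell R n j k !=set0 by apply/set0P/eqP.
  apply: ereal_sup_ubound; exists (x, x) => //=.
  rewrite subrr /enorm big1 ?sqrtr0// => i _; by rewrite mxE expr0n.
case: (ediam _) => // r; rewrite !lee_fin => r0 rj.
rewrite ge0_ler_powR ?nnegrE ?mulr_ge0//.
Qed.

Lemma diam_pow_ge0 s (A : set 'rV[R]_n) : 0 <= diam_pow s A.
Proof. by rewrite /diam_pow; case: ifP => // _; exact: poweR_ge0. Qed.

Lemma hausdorff_eq0 s (E : set 'rV[R]_n) :
  (forall delta eps : R, (0 < delta)%R -> (0 < eps)%R ->
    exists F : (set 'rV[R]_n)^nat, [/\ E `<=` \bigcup_k F k,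
      forall k, ediam (F k) <= delta%:E &
      \sum_(0 <= k <oo) diam_pow s (F k) <= eps%:E]) ->
  hausdorff s E = 0.
Proof.
move=> H.
have D0 delta : (0 < delta)%R -> hausdorff_delta s delta E = 0.
  move=> delta0; apply/eqP; rewrite eq_le; apply/andP; split.
    apply/lee_addgt0Pr => eps eps0; rewrite add0e.
    have [F [EF dF sF]] := H _ _ delta0 eps0.
    by apply: le_trans sF; apply: ereal_inf_lbound; exists F.
  by apply: le_ereal_inf_tmp => _ [F _ <-]; apply: nneseries_ge0 => k _ _; exact: diam_pow_ge0.
apply/eqP; rewrite eq_le; apply/andP; split.
  by apply: ge_ereal_sup => _ [delta /D0 d0 <-]; rewrite d0.
by apply: ereal_sup_ubound; exists 1%R => //=; exact: D0.
Qed.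

Lemma hausdorff_heavy_cells (w : 'rV[R]_n -> \bar R) (s eta : R)
    (E : set 'rV[R]_n) :
  (0 <= s < n%:R)%R -> (0 < eta)%R ->
  mu.-integrable setT w -> (forall x, 0 <= w x) ->
  (forall x, E x -> forall j0, exists2 j, (j0 <= j)%N &
     (eta * (2 ^- j) `^ s)%:E <= \int[mu]_(y in cell j (dyadic_index j x)) w y) ->
  hausdorff s E = 0.
Proof.
move=> /andP[s0 sn] eta0 iw w0 EH; apply: hausdorff_eq0 => delta eps delta0 eps0.
pose nu A := \int[mu]_(y in A) w y.
have nu0 A : 0 <= nu A by exact: integral_ge0.
have nuT : nu setT \is a fin_num by exact: integrable_fin_num.
pose c : R := (n%:R `^ s)%R.
have c0 : (0 <= c)%R by exact: powR_ge0.
(* The final bound is [c / eta] times an integral of [w], hence the tolerance [eps * eta / (c + 1)];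
   the [+ 1] keeps the denominator positive. *)
have [d d0 Hd] := integral_abs_continuous iw w0
  (divr_gt0 (mulr_gt0 eps0 eta0) (ltr_wpDl c0 ltr01)).
(* The first condition will keep the measure of the selected cells below [d], the second their
   diameters below [delta]. *)
have [j0 [j0d j0delta]] : exists j0,
    (((2 ^- j0) `^ (n%:R - s) / eta) * fine (nu setT) < d)%R /\
    (n%:R * 2 ^- j0 <= delta)%R.
  have ns0 : (0 < n%:R - s)%R by rewrite subr_gt0.
  have [N1 H1] := geometric_eventually_lt (eta^-1 * fine (nu setT))
    (powR_half_lt1 ns0) d0.
  have [N2 H2] := geometric_eventually_lt n%:R half_lt1 delta0.
  exists (maxn N1 N2); rewrite powR_half_expr -exprVn; split.
    by rewrite -mulrA mulrC H1// leq_maxl.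
  by rewrite ltW// H2// leq_maxr.
pose heavy j k := (eta * (2 ^- j) `^ s)%:E <= nu (cell j k).
(* Maximality: no coarser cell of level at least [j0] that contains this one is heavy. *)
pose M (jk : nat * {ffun 'I_n -> int}) := [/\ (j0 <= jk.1)%N, heavy jk.1 jk.2 &
  forall i (y : 'rV[R]_n), (j0 <= i < jk.1)%N -> cell jk.1 jk.2 y -> ~ heavy i (dyadic_index i y)].
(* Cells are enumerated by their codes. Codes that select nothing give the empty set, which
   [diam_pow] counts as 0 even when [s = 0]. *)
pose C m : set 'rV[R]_n := if pickle_inv m is Some jk then
   if `[< M jk >] then cell jk.1 jk.2 else set0 else set0.
have CP m : C m = set0 \/ exists j k, [/\ C m = cell j k, (j0 <= j)%N & heavy j k].
  rewrite /C; case: pickle_inv => [[j k]|]; last by left.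
  by case: asboolP => [[]|]; [right; exists j, k|left].
have mC m : measurable (C m).
  by case: (CP m) => [->|[j [k [-> _ _]]]] //; exact: measurable_cell.
have tC : trivIset setT C.
  move=> m m' _ _ [y []]; rewrite /C.
  case E1 : (pickle_inv m) => [[j k]|]//; case E2 : (pickle_inv m') => [[j' k']|]//.
  case: asboolP => // -[/= j0j hv mx]; case: asboolP => // -[/= j0j' hv' mx'] jky jky'.
  have [jj'|jj'|jj'] := ltngtP j j'.
  - by case: (mx' j y) => //; [rewrite j0j|rewrite jky].
  - by case: (mx j' y) => //; [rewrite j0j'|rewrite jky'].
  - subst j'; rewrite (cell_disjoint jky jky') in E1.
    have := @pickle_invK (nat * {ffun 'I_n -> int})%type m.
    by have := @pickle_invK (nat * {ffun 'I_n -> int})%type m'; rewrite E1 E2 /= => -> ->.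
have EC : E `<=` \bigcup_m C m.
  move=> x Ex; have [j j0j hj] := EH x Ex j0.
  have ex : exists i, (j0 <= i)%N && heavy i (dyadic_index i x).
    by exists j; rewrite j0j.
  case: (ex_minnP ex) => i /andP[j0i hi] imin.
  exists (pickle (i, dyadic_index i x)) => //; rewrite /C pickleK_inv asboolT//.
  split => //= i' y /andP[j0i' i'i] ciy h'.
  have iy : dyadic_index i' y = dyadic_index i' x by exact: dyadic_index_le (ltnW i'i) ciy.
  by have := imin i'; rewrite j0i' -iy h' => /(_ isT); rewrite leqNgt i'i.
have dC m : diam_pow s (C m) <= (c / eta)%:E * nu (C m).
  have [->|[j [k [-> _ hv]]]] := CP m.
    by rewrite /diam_pow asboolT// mule_ge0// lee_fin divr_ge0// ltW.
  apply: (le_trans (diam_pow_cell _ _ s0)); rewrite -/c.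
  rewrite (_ : (_ * _)%R = (c / eta * (eta * (2 ^- j) `^ s))%R).
    by rewrite EFinM lee_wpmul2l// lee_fin divr_ge0// ltW.
  by rewrite mulrA divfK// gt_eqF.
(* A heavy cell of level [j] has measure 2^(-j(n-s)) 2^(-js); the second factor is at most
   [nu / eta] of the cell, and the first is largest at [j0] since [s < n]. *)
have mC' m : mu (C m) <= ((2 ^- j0) `^ (n%:R - s) / eta)%:E * nu (C m).
  have [->|[j [k [-> j0j hv]]]] := CP m.
    by rewrite measure0 mule_ge0// lee_fin divr_ge0 ?powR_ge0// ltW.
  rewrite lebesgue_cell; apply: (@le_trans _ _
    ((2 ^- j0) `^ (n%:R - s) / eta * (eta * (2 ^- j) `^ s))%:E); last first.
    by rewrite EFinM lee_wpmul2l// lee_fin divr_ge0 ?powR_ge0// ltW.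
  rewrite lee_fin mulrA divfK ?gt_eqF//.
  apply: (@le_trans _ _ ((2 ^- j) `^ (n%:R - s) * (2 ^- j) `^ s)%R).
    rewrite -powRD; last by apply/implyP => _; rewrite gt_eqF ?half_gt0.
    rewrite subrK powR_mulrn; last exact: ltW (half_gt0 _).
    by rewrite exprVn -exprM.
  rewrite ler_wpM2r ?powR_ge0// ge0_ler_powR ?nnegrE ?subr_ge0 ?half_le//;
    apply: ltW => //; exact: half_gt0.
have nuC : nu (\bigcup_m C m) = \sum_(0 <= m <oo) nu (C m).
  by apply: ge0_integral_bigcup => //; apply: measurable_funTS; exact: measurable_int iw.
have mubigC : mu (\bigcup_m C m) < d%:E.
  rewrite measure_semi_bigcup//; last exact: bigcupT_measurable.
  apply: le_lt_trans (lee_nneseries _ (fun m _ => mC' m)) _ => //.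
  rewrite nneseriesZl; last by move=> m _.
  rewrite -nuC; apply: (@le_lt_trans _ _
    (((2 ^- j0) `^ (n%:R - s) / eta)%:E * nu setT)).
    apply: lee_wpmul2l; first by rewrite lee_fin divr_ge0 ?powR_ge0// ltW.
    exact: ge0_subset_integral_nonmeas.
  by rewrite -[X in _ * X]fineK// -EFinM lte_fin.
exists C; split => //.
  move=> m; have [->|[j [k [-> j0j _]]]] := CP m.
    rewrite /ediam set0X image_set0 ereal_sup0; exact: leNye.
  apply: (le_trans (ediam_cell _ _)); rewrite lee_fin (le_trans _ j0delta)//.
  by rewrite ler_wpM2l// half_le.
apply: (le_trans (lee_nneseries _ (fun m _ => dC m))).
  by move=> *; exact: diam_pow_ge0.
rewrite nneseriesZl; last by move=> m _.
rewrite -nuC.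
have /ltW := Hd _ (bigcupT_measurable _ mC) mubigC.
have ce : 0 <= (c / eta)%:E by rewrite lee_fin divr_ge0// ltW.
move=> /(lee_wpmul2l ce)/le_trans; apply; rewrite -EFinM lee_fin.
have c1 : (0 < c + 1)%R by exact: ltr_wpDl.
have -> : (c / eta * (eps * eta / (c + 1)) = eps * (c / (c + 1)))%R.
  by field; rewrite !gt_eqF.
apply: ler_piMr; first exact: ltW.
by rewrite ler_pdivrMr// mul1r lerDl.
Qed.

End hausdorff_null.

(** * Averages over dyadic cells *)

Section cell_averages.
Context {R : realType} {n : nat}.
Local Notation mu := (@lebesgue_rV R n).
Implicit Types (f : 'rV[R]_n -> R) (w : 'rV[R]_n -> \bar R) (x : 'rV[R]_n).

Definition cell_avg f j x : \bar R :=
  ((2 ^+ (j * n))%:E * \int[mu]_(y in cell j (dyadic_index j x)) `|f y|%:E)%E.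

Lemma integral_abs_sub_cst f c (A : set 'rV[R]_n) : measurable_fun setT f ->
  measurable A ->
  (\int[mu]_(y in A) `|f y|%:E <= \int[mu]_(y in A) `|f y - c|%:E + `|c|%:E * mu A)%E /\
  (`|c|%:E * mu A <= \int[mu]_(y in A) `|f y|%:E + \int[mu]_(y in A) `|f y - c|%:E)%E.
Proof.
move=> mf mA.
have m1 : measurable_fun A (fun y => `|f y|%:E).
  by apply: measurable_funTS; apply/measurable_EFinP/measurableT_comp.
have m2 : measurable_fun A (fun y => `|f y - c|%:E).
  apply: measurable_funTS; apply/measurable_EFinP/measurableT_comp => //.
  exact: measurable_funB.
rewrite -integral_cst//; split.
  rewrite -ge0_integralD//; try by move=> *; rewrite lee_fin.
  apply: ge0_le_integral_nonmeas => y _; rewrite ?lee_fin//.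
  by rewrite -{1}(subrK c (f y)) ler_normD.
rewrite -ge0_integralD//; try by move=> *; rewrite lee_fin.
apply: ge0_le_integral_nonmeas => y _; rewrite ?lee_fin//.
by have := ler_normB (f y) (f y - c); rewrite subKr.
Qed.

(** Both averages are compared with the modulus of [c]: the coarse average exceeds it by at most
    [e], and it exceeds the fine average by at most [2 ^+ n * e], the factor being the ratio of the
    two volumes. *)
Lemma cell_avg_step f j x (e c : R) : measurable_fun setT f ->
  (\int[mu]_(y in cell j (dyadic_index j x)) `|f y - c|%:E <=
    (2 ^- (j * n) * e)%:E)%E ->
  (cell_avg f j x <= cell_avg f j.+1 x + ((1 + 2 ^+ n) * e)%:E)%E.
Proof.
move=> mf; set Q := cell j _ => H.
pose Q' : set 'rV[R]_n := cell j.+1 (dyadic_index j.+1 x).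
rewrite /cell_avg -/Q -/Q'.
have P k : 0 < 2 ^+ (k * n) :> R by rewrite exprn_gt0.
have [h1 _] := integral_abs_sub_cst c mf (measurable_cell j (dyadic_index j x)).
have [_ h2] := integral_abs_sub_cst c mf (measurable_cell j.+1 (dyadic_index j.+1 x)).
move: h1 h2; rewrite -/Q -/Q' !lebesgue_cell => h1 h2.
have h3 : (\int[mu]_(y in Q') `|f y - c|%:E <= (2 ^- (j * n) * e)%:E)%E.
  apply: le_trans H; apply: ge0_subset_integral_nonmeas => //.
  exact: cell_subset.
have : (0 <= \int[mu]_(y in Q') `|f y|%:E)%E.
  by apply: integral_ge0 => y _; rewrite lee_fin.
have {h2} := le_trans h2 (leeD2l _ h3); have {h1 H} := le_trans h1 (leeD2r _ H).
have : (0 <= \int[mu]_(y in Q) `|f y|%:E)%E.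
  by apply: integral_ge0 => y _; rewrite lee_fin.
case: (integral mu Q' _) => // [b|]; last first.
  by move=> _ _ _ _; rewrite gt0_muley ?lte_fin ?P// addye// leey.
case: (integral mu Q _) => // a _.
rewrite -!EFinM -!EFinD !lee_fin => h1 h2 b0.
set p := 2 ^+ (j * n) in h1 h2 P *.
have p0 : 0 < p by exact: P.
have e2 : 2 ^+ (j.+1 * n) = 2 ^+ n * p :> R by rewrite mulSn exprD.
rewrite e2 in h2 *; set q := 2 ^+ n in h2 *.
have q0 : 0 < q by rewrite exprn_gt0.
have h3' : `|c| <= q * p * b + q * e.
  have -> : q * p * b + q * e = (b + p^-1 * e) * (q * p).
    by field; rewrite gt_eqF.
  by rewrite -ler_pdivrMr ?mulr_gt0.
apply: (@le_trans _ _ (p * (p^-1 * e + `|c| * p^-1))); first by rewrite ler_pM2l.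
have -> : p * (p^-1 * e + `|c| * p^-1) = e + `|c|.
  by field; rewrite gt_eqF.
by rewrite mulrDl mul1r; lra.
Qed.

Lemma neg_pow_ge0 alpha f x : (0 <= neg_pow alpha f x)%E.
Proof. by rewrite /neg_pow; case: ifP => // _; rewrite lee_fin powR_ge0. Qed.

Lemma measurable_neg_pow alpha f : measurable_fun setT f ->
  measurable_fun setT (neg_pow alpha f).
Proof.
move=> mf; rewrite /neg_pow; apply: measurable_fun_ifT => //.
  apply: measurable_fun_eqr => //.
apply/measurable_EFinP; apply: (measurableT_comp (measurable_powR _)).
exact: measurableT_comp.
Qed.

(* Pointwise, [1 <= |f| / lam] or [1 <= lam^alpha |f|^-alpha]. *)
Lemma cell_avg_lower f j x alpha lam : measurable_fun setT f ->
  0 < alpha -> 0 < lam ->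
  (\int[mu]_(y in cell j (dyadic_index j x)) neg_pow alpha f y <=
     (2 ^- (j * n) / 2 / lam `^ alpha)%:E)%E ->
  ((lam / 2)%:E <= cell_avg f j x)%E.
Proof.
move=> mf a0 l0; rewrite /cell_avg; set Q := cell j (dyadic_index j x) => H.
have mQ : measurable Q by exact: measurable_cell.
have m1 : measurable_fun Q (fun y => `|f y|%:E).
  by apply: measurable_funTS; apply/measurable_EFinP/measurableT_comp.
have m2 : measurable_fun Q (neg_pow alpha f).
  by apply: measurable_funTS; exact: measurable_neg_pow.
have la0 : 0 < lam `^ alpha by rewrite powR_gt0.
have p0 : 0 < 2 ^+ (j * n) :> R by rewrite exprn_gt0.
have h : ((2 ^- (j * n))%:E <= (lam^-1)%:E * \int[mu]_(y in Q) `|f y|%:E +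
    (lam `^ alpha)%:E * \int[mu]_(y in Q) neg_pow alpha f y)%E.
  rewrite -(lebesgue_cell j (dyadic_index j x)) -/Q.
  rewrite -[X in (X <= _)%E]mul1e -integral_cst//.
  rewrite -ge0_integralZl//; last by rewrite lee_fin invr_ge0 ltW.
  rewrite -ge0_integralZl//; last 2 first.
  - by move=> y _; exact: neg_pow_ge0.
  - by rewrite lee_fin ltW.
  rewrite -ge0_integralD//; last 4 first.
  - by move=> y _; rewrite -EFinM lee_fin mulr_ge0 ?invr_ge0// ltW.
  - exact: measurable_funeM.
  - by move=> y _; rewrite mule_ge0 ?neg_pow_ge0// lee_fin ltW.
  - exact: measurable_funeM.
  apply: ge0_le_integral_nonmeas => y _//=.
  rewrite /neg_pow; case: eqP => [->|/eqP fy0].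
    by rewrite normr0 mule0 add0e gt0_muley ?lte_fin// leey.
  rewrite -!EFinM -EFinD lee_fin.
  have fy : 0 < `|f y| by rewrite normr_gt0.
  have [lf|fl] := leP lam `|f y|.
    rewrite (le_trans (_ : 1 <= lam^-1 * `|f y|))// ?lerDl ?mulr_ge0 ?powR_ge0//.
    by rewrite ler_pdivlMl// mulr1.
  rewrite (le_trans (_ : 1 <= lam `^ alpha * `|f y| `^ (- alpha)))//.
    rewrite powRN ler_pdivlMr ?powR_gt0// mul1r ge0_ler_powR ?nnegrE ?ltW//.
  by rewrite lerDr mulr_ge0// invr_ge0 ltW.
have : (0 <= \int[mu]_(y in Q) neg_pow alpha f y)%E.
  by apply: integral_ge0 => y _; exact: neg_pow_ge0.
have : (0 <= \int[mu]_(y in Q) `|f y|%:E)%E.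
  by apply: integral_ge0 => y _; rewrite lee_fin.
move: H h; case: (integral mu Q (neg_pow _ _)) => // v.
case: (integral mu Q _) => [u||]//; last by move=> *; rewrite gt0_muley ?lte_fin// leey.
rewrite -!EFinM -!EFinD !lee_fin; set p := 2 ^+ _ in p0 *; set L := lam `^ _ in la0 *.
move=> H h u0 v0.
have {}H : L * v <= p^-1 / 2 by rewrite -ler_pdivlMl// mulrC.
have {}h : p^-1 / 2 <= lam^-1 * u by lra.
rewrite -(ler_pM2l p0) in h.
have : lam * (p * (p^-1 / 2)) <= lam * (p * (lam^-1 * u)) by rewrite ler_pM2l.
have -> : lam * (p * (p^-1 / 2)) = lam / 2 by field; lra.
by have -> : lam * (p * (lam^-1 * u)) = p * u by field; lra.
Qed.

(** The threshold [eta] precedes [f], [w] and [x], since the covering argument needs the same one at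
    all points. The lower bound on [gamma * alpha + s] makes a mass below eta 2^(-js) small enough
    for [cell_avg_lower] at a level [lam] of order 2^(-j gamma), which is the scale of the upper
    bound. *)
Lemma dense_cells_of_zero_average (sigma theta alpha s C : R) :
  let gamma := sigma - (n%:R - s) * theta in
  0 < alpha -> 0 <= theta -> 0 <= C -> 0 < gamma -> n%:R <= gamma * alpha + s ->
  exists2 eta, 0 < eta & forall f w x,
    measurable_fun setT f ->
    (\forall j \near \oo, forall M : R, 0 < M ->
      (\int[mu]_(y in cell j (dyadic_index j x)) w y < M%:E)%E ->
      (exists c : R, \int[mu]_(y in cell j (dyadic_index j x)) `|f y - c|%:E <=
        (2 ^- (j * n) * (C * (2 ^- j) `^ (sigma - n%:R * theta) * M `^ theta))%:E)%E) ->
    (\forall j \near \oo,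
      \int[mu]_(y in cell j (dyadic_index j x)) neg_pow alpha f y <=
      \int[mu]_(y in cell j (dyadic_index j x)) w y)%E ->
    cell_avg f j x @[j --> \oo] --> 0%E ->
    forall j0, exists2 j, (j0 <= j)%N &
     ((eta * (2 ^- j) `^ s)%:E <= \int[mu]_(y in cell j (dyadic_index j x)) w y)%E.
Proof.
move=> gamma a0 t0 C0 g0 ngs.
have /andP[q0 q1] := powR_half_lt1 g0.
set q := 2^-1 `^ gamma in q0 q1.
(* The sum of the geometric series of increments, with the factor [1 + 2 ^+ n] from
   [cell_avg_step]. *)
pose K := (1 + 2 ^+ n) * C / (1 - q).
have K0 : 0 <= K.
  apply: divr_ge0; last by rewrite subr_ge0 ltW.
  by rewrite mulr_ge0// addr_ge0// exprn_ge0.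
have K2 : 1 <= 2 * K + 2 by lra.
(* This choice gives (2 eta)^(-1/alpha) = 2K + 2, so half of the level [lam] below is (K + 1) 2^(-J
   gamma). It beats the upper bound K eta^theta 2^(-J gamma) because [eta <= 1]. *)
pose eta := (2 * K + 2) `^ (- alpha) / 2.
have eta0 : 0 < eta by rewrite divr_gt0// powR_gt0 ?(lt_le_trans ltr01).
have eta1 : eta <= 1.
  have : (2 * K + 2) `^ (- alpha) <= 1.
    rewrite -[leRHS](powRr0 (2 * K + 2)) ler_powR//; lra.
  by rewrite /eta; lra.
exists eta => // f w x mf H V A0 j0; apply: contrapT => /forall2NP small.
have [J [j0J HJ VJ]] : exists J, [/\ (j0 <= J)%N,
    forall j, (J <= j)%N -> forall M : R, 0 < M ->
      (\int[mu]_(y in cell j (dyadic_index j x)) w y < M%:E)%E ->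
      (exists c : R, \int[mu]_(y in cell j (dyadic_index j x)) `|f y - c|%:E <=
        (2 ^- (j * n) * (C * (2 ^- j) `^ (sigma - n%:R * theta) * M `^ theta))%:E)%E &
    (\int[mu]_(y in cell J (dyadic_index J x)) neg_pow alpha f y <=
      \int[mu]_(y in cell J (dyadic_index J x)) w y)%E].
  have [J1 _ H1] := H; have [J2 _ H2] := V.
  exists (maxn j0 (maxn J1 J2)); split; first by rewrite leq_maxl.
    by move=> j; rewrite !geq_max => /andP[_ /andP[j1 _]]; exact: H1.
  by apply: H2; rewrite /= !leq_max leqnn !orbT.
have {}small j : (J <= j)%N ->
    (\int[mu]_(y in cell j (dyadic_index j x)) w y < (eta * (2 ^- j) `^ s)%:E)%E.
  by move=> Jj; case: (small j) => [|/negP]; [rewrite (leq_trans j0J)|rewrite -ltNge].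
pose D := (1 + 2 ^+ n) * C * eta `^ theta * (2 ^- J) `^ gamma.
have D0 : 0 <= D.
  by rewrite !mulr_ge0 ?powR_ge0// addr_ge0// exprn_ge0.
have step k : (cell_avg f (J + k) x <= cell_avg f (J + k).+1 x + (D * q ^+ k)%:E)%E.
  have eh : 0 < eta * (2 ^- (J + k)) `^ s :> R by rewrite mulr_gt0// powR_gt0 half_gt0.
  have [c hc] := HJ _ (leq_addr k J) _ eh (small _ (leq_addr k J)).
  apply: (le_trans (cell_avg_step mf hc)); rewrite leeD2l// lee_fin le_eqVlt.
  apply/orP; left; apply/eqP.
  rewrite powRM ?powR_ge0 ?(ltW eta0)// -powRrM.
  rewrite /D -!mulrA; do 2 congr (_ * _).
  rewrite [LHS]mulrCA; congr (_ * _); rewrite -powRD; last first.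
    by apply/implyP => _; rewrite gt_eqF ?half_gt0.
  have -> : sigma - n%:R * theta + s * theta = gamma by rewrite /gamma; ring.
  by rewrite !powR_half_expr exprD.
(* The sum stays finite and in the extended reals: that the average at level [J] is finite is learnt
   only when the last average is made small. *)
have tele k : (cell_avg f J x <= cell_avg f (J + k) x + (D * (1 - q ^+ k) / (1 - q))%:E)%E.
  elim: k => [|k IH]; first by rewrite addn0 expr0 subrr mulr0 mul0r adde0.
  apply: (le_trans IH); rewrite addnS.
  apply: (le_trans (leeD2r _ (step k))); rewrite -addeA -EFinD leeD2l// lee_fin.
  rewrite le_eqVlt; apply/orP; left; apply/eqP; rewrite exprS; field.
  by rewrite subr_eq0 gt_eqF.
have up : (cell_avg f J x <= (D / (1 - q))%:E)%E.
  apply/lee_addgt0Pr => e e0.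
  have [N _ HN] : \forall j \near \oo, (cell_avg f j x < e%:E)%E.
    apply: (A0 [set y | (y < e%:E)%E]).
    exact: (@nbhs_open_ereal_lt _ 0 (fun=> e)).
  apply: (le_trans (tele N)); rewrite addeC leeD//.
    rewrite lee_fin ler_pM2r ?invr_gt0 ?subr_gt0// ler_piMr//.
    by rewrite lerBlDr lerDl exprn_ge0.
  by apply/ltW/HN; rewrite /= leq_addl.
(* With this [lam] the requirement of [cell_avg_lower] reduces to 2^(-J(gamma alpha + s)) <=
   2^(-Jn), which follows from [ngs]. *)
pose lam := (2 * eta) `^ (- alpha^-1) * (2 ^- J) `^ gamma.
have lam0 : 0 < lam by rewrite mulr_gt0// powR_gt0 ?half_gt0// mulr_gt0.
have low : ((lam / 2)%:E <= cell_avg f J x)%E.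
  apply: (cell_avg_lower mf a0 lam0); apply: (le_trans VJ).
  apply: (le_trans (ltW (small J (leqnn J)))); rewrite lee_fin.
  rewrite /lam powRM ?powR_ge0// -!powRrM mulNr mulVf ?gt_eqF//.
  rewrite powR_inv1; last by rewrite mulr_ge0// ltW.
  rewrite ler_pdivlMr; last first.
    apply: mulr_gt0; first by rewrite invr_gt0 mulr_gt0.
    by apply: powR_gt0; exact: half_gt0.
  have -> : eta * (2 ^- J) `^ s * ((2 * eta)^-1 * (2 ^- J) `^ (gamma * alpha)) =
     (2 ^- J) `^ (gamma * alpha + s) / 2.
    rewrite powRD; last by apply/implyP => _; rewrite gt_eqF ?half_gt0.
    by field; rewrite gt_eqF.
  have -> : 2 ^- (J * n) = (2 ^- J) `^ n%:R :> R.
    rewrite powR_mulrn; last exact: ltW (half_gt0 _).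
    by rewrite exprVn exprM.
  rewrite ler_pM2r// ger_powR// half_gt0/=.
  by have := half_le (R := R) (leq0n J); rewrite expr0 invr1.
have := le_trans low up; rewrite lee_fin; apply/negP; rewrite -ltNge.
have -> : D / (1 - q) = K * eta `^ theta * (2 ^- J) `^ gamma.
  by rewrite /K /D; field; rewrite subr_eq0 gt_eqF.
rewrite /lam [ltRHS]mulrAC ltr_pM2r ?powR_gt0 ?half_gt0//.
have -> : (2 * eta) `^ (- alpha^-1) = 2 * K + 2.
  rewrite /eta mulrC divfK// -powRrM mulrNN divff ?gt_eqF// powRr1//; lra.
apply: (@le_lt_trans _ _ K); last lra.
rewrite ler_piMr// -[leRHS](powRr0 eta) ger_powR// eta0 eta1//.
Qed.

End cell_averages.

(** * Reduction to an oscillation estimate *)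

Section reduction.
Context {R : realType} {n : nat}.
Local Notation mu := (@lebesgue_rV R n).
Implicit Types (f : 'rV[R]_n -> R) (w g : 'rV[R]_n -> \bar R) (x : 'rV[R]_n).

Lemma near_small_cube (Omega : set 'rV[R]_n) x (K : R) :
  open Omega -> Omega x ->
  \forall j \near \oo,
    [set y : 'rV[R]_n | forall i, `|y ord0 i - x ord0 i| <= K * 2 ^- j] `<=` Omega.
Proof.
move=> oO Ox.
have /nbhs_ballP[e /= e0 xe] : nbhs x Omega by exact: open_nbhs_nbhs.
have [N HN] := geometric_eventually_lt K (half_lt1 (R := R)) e0.
exists N => // j /HN Kj y /= H; apply: xe; split => // i k.
rewrite (ord1 i) /ball/= distrC (le_lt_trans (H k))//.
by rewrite -exprVn.
Qed.

Lemma near_cell_sub (Omega : set 'rV[R]_n) x : open Omega -> Omega x ->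
  \forall j \near \oo, cell j (dyadic_index j x) `<=` Omega.
Proof.
move=> oO Ox; apply: filterS (near_small_cube 1 oO Ox) => j; apply: subset_trans.
by move=> y xy i /=; rewrite mul1r; exact: cell_dist xy (cell_dyadic_index j x).
Qed.

Lemma measurable_enorm d (T : measurableType d) (h : T -> 'rV[R]_n) :
  measurable_fun setT h -> measurable_fun setT (fun t => enorm (h t)).
Proof.
move=> mh; apply: (measurableT_comp (continuous_measurable_fun (@sqrt_continuous R))).
apply: measurable_sum => i; apply: measurable_funX.
exact: measurableT_comp (measurable_rV_coord i) mh.
Qed.

Lemma measurable_rVB d (T : measurableType d) (h k : T -> 'rV[R]_n) :
  measurable_fun setT h -> measurable_fun setT k ->
  measurable_fun setT (fun t => h t - k t).
Proof.
move=> mh mk; apply: measurable_to_rV => i.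
rewrite (_ : _ \o _ = fun t => rV_coord i (h t) - rV_coord i (k t)).
  by apply: measurable_funB; apply: measurableT_comp => //; exact: measurable_rV_coord.
by apply/funext => t; rewrite /rV_coord/= !mxE.
Qed.

Lemma measurable_eball x r : measurable (eball x r).
Proof.
rewrite (_ : eball x r = (fun y => enorm (y - x)) @^-1` `]-oo, r[); last first.
  by apply/seteqP; split => y; rewrite /eball/= in_itv.
rewrite -[X in measurable X]setTI; apply: measurable_enorm => //.
exact: measurable_rVB.
Qed.

(** Points of a cell are within n 2^(-j) of each other; the ball is open, hence the factor
    [n.+1]. *)
Lemma cell_sub_eball j x :
  cell j (dyadic_index j x) `<=` eball x (n.+1%:R * 2 ^- j).
Proof.
move=> y xy; rewrite /eball/=; apply: (@le_lt_trans _ _ (n%:R * 2 ^- j)).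
  apply: enorm_le => [|i]; first by rewrite ltW// half_gt0.
  by rewrite !mxE; exact: cell_dist xy (cell_dyadic_index j x).
by rewrite ltr_pM2r ?half_gt0// ltr_nat.
Qed.

Lemma lebesgue_eball_le x r : 0 <= r -> (mu (eball x r) <= ((2 * r) ^+ n)%:E)%E.
Proof.
move=> r0.
have <- : mu (box (fun i => x ord0 i - r) (fun i => x ord0 i + r)) = ((2 * r) ^+ n)%:E.
  rewrite lebesgue_box; last by move=> i; lra.
  rewrite (eq_bigr (fun=> 2 * r)); last by move=> i _; ring.
  by rewrite prodr_const card_ord.
apply: le_measure; rewrite ?inE; [exact: measurable_eball|exact: measurable_box|].
move=> y; rewrite /eball/= => yr i.
have := le_lt_trans (le_coord_enorm (y - x) i) yr.
by rewrite !mxE ltr_norml => /andP[h1 h2]; apply/andP; split; lra.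
Qed.

(** The constant is the volume of the cube circumscribed about the ball, divided by the volume of
    the cell. *)
Lemma cell_avg_le_avg_abs f j x :
  (cell_avg f j x <=
    ((2 * n.+1%:R) ^+ n)%:E * avg_abs f (eball x (n.+1%:R * 2 ^- j)))%E.
Proof.
rewrite /cell_avg /avg_abs; set r := n.+1%:R * 2 ^- j; set B := eball x r.
have r0 : 0 <= r by rewrite mulr_ge0// ltW// half_gt0.
have := lebesgue_eball_le x r0; rewrite -/B.
have : ((2 ^- (j * n))%:E <= mu B)%E.
  rewrite -(lebesgue_cell j (dyadic_index j x)); apply: le_measure; rewrite ?inE.
  - exact: measurable_cell.
  - exact: measurable_eball.
  - exact: cell_sub_eball.
case: (mu B) => // m; rewrite !lee_fin => m1 m2.
have p0 : 0 < 2 ^+ (j * n) :> R by rewrite exprn_gt0.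
have m0 : 0 < m by apply: lt_le_trans m1; rewrite invr_gt0.
rewrite muleA; apply: lee_pmul.
- by rewrite lee_fin ltW.
- by apply: integral_ge0 => y _; rewrite lee_fin.
- rewrite inver gt_eqF// -EFinM lee_fin ler_pdivlMr//.
  rewrite -ler_pdivlMl// mulrC; apply: (le_trans m2).
  by rewrite /r mulrA exprMn exprVn -exprM.
- apply: ge0_subset_integral_nonmeas; first exact: cell_sub_eball.
  by move=> y _; rewrite lee_fin.
Qed.

Lemma cvg_cell_avg f x : avg_abs f (eball x r) @[r --> 0^'+] --> 0%E ->
  cell_avg f j x @[j --> \oo] --> 0%E.
Proof.
move=> H.
have rj : n.+1%:R * 2 ^- j @[j --> \oo] --> (0 : R)^'+.
  move=> A [e /= e0 eA].
  have [N HN] := geometric_eventually_lt n.+1%:R (half_lt1 (R := R)) e0.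
  exists N => // j /HN; rewrite exprVn => jN; apply: eA => /=.
    by rewrite sub0r normrN ger0_norm// mulr_ge0// ltW// half_gt0.
  by rewrite mulr_gt0// half_gt0.
have {}H := cvg_comp _ _ rj H.
apply: (@squeeze_cvge _ _ _ _ (fun=> 0%E) _
  (fun j => ((2 * n.+1%:R) ^+ n)%:E * avg_abs f (eball x (n.+1%:R * 2 ^- j)))%E).
- apply: nearW => j; rewrite cell_avg_le_avg_abs andbT mule_ge0//.
  by apply: integral_ge0 => y _; rewrite lee_fin.
- exact: cvg_cst.
- rewrite -(mule0 ((2 * n.+1%:R) ^+ n)%:E); apply: cvgeZl => //.
Qed.

(** The Sobolev seminorm enters only through [g] and the oscillation bound in the last hypothesis,
    whose instances are the four oscillation lemmas below. *)
Lemma hausdorff_lebesgue_zero_set (Omega N : set 'rV[R]_n) f g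
    (sigma alpha theta C s : R) :
  (1 <= n)%N -> open Omega -> 0 < sigma -> 0 < alpha -> 0 <= theta -> 0 <= C ->
  s = maxr 0 (n%:R - sigma * (alpha / (1 + alpha * theta))) ->
  measurable N -> mu N = 0%E -> measurable (Omega `\` N) ->
  measurable_fun setT (f \_ (Omega `\` N)) ->
  measurable_fun setT g -> (forall x, 0 <= g x)%E -> (\int[mu]_x g x < +oo)%E ->
  (\int[mu]_(x in Omega) neg_pow alpha f x < +oo)%E ->
  (forall x, Omega x -> \forall j \near \oo, forall M : R, 0 < M ->
      (\int[mu]_(y in cell j (dyadic_index j x)) g y < M%:E)%E ->
      (exists c : R,
        \int[mu]_(y in cell j (dyadic_index j x)) `|(f \_ (Omega `\` N)) y - c|%:E <=
        (2 ^- (j * n) * (C * (2 ^- j) `^ (sigma - n%:R * theta) * M `^ theta))%:E)%E) ->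
  hausdorff s (lebesgue_zero_set Omega f) = 0%E.
Proof.
move=> n1 oO sg0 a0 t0 C0 sE mN N0 mON mfB mg g0 goo npoo H.
have at0 : 0 < 1 + alpha * theta by rewrite ltr_pwDl// mulr_ge0// ltW.
set beta := sigma * (alpha / (1 + alpha * theta)) in sE.
have beta0 : 0 < beta by rewrite mulr_gt0// divr_gt0.
have s0 : 0 <= s by rewrite sE le_max lexx.
have nsb : n%:R - s <= beta by rewrite sE lerBlDr -lerBlDl le_max lexx orbT.
have sn : s < n%:R by rewrite sE gt_max ltr0n n1/= gtrBl.
pose gamma := sigma - (n%:R - s) * theta.
have gE : sigma - beta * theta = sigma / (1 + alpha * theta).
  by rewrite /beta; field; rewrite gt_eqF.
(* The left side is the value of [gamma] when [n - s = beta]; truncating [s] at 0 can only increase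
   [gamma]. *)
have gb : sigma / (1 + alpha * theta) <= gamma.
  by rewrite -gE /gamma lerB// ler_wpM2r.
have g0' : 0 < gamma by apply: lt_le_trans gb; rewrite divr_gt0.
have ngs : n%:R <= gamma * alpha + s.
  rewrite -lerBlDr (le_trans nsb)//.
  have -> : beta = sigma / (1 + alpha * theta) * alpha by rewrite /beta; ring.
  by rewrite ler_pM2r.
have [eta eta0 P] := @dense_cells_of_zero_average R n _ _ _ s _ a0 t0 C0 g0' ngs.
set fB := f \_ (Omega `\` N) in mfB H.
(* Outside [Omega] minus [N] the function [fB] is 0 and its [neg_pow] is infinite, so this term is
   restricted once more before it is added to the energy. *)
pose w y := (g y + (neg_pow alpha fB \_ (Omega `\` N)) y)%E.
have mnp : measurable_fun setT (neg_pow alpha fB \_ (Omega `\` N)).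
  apply/(measurable_restrictT _ mON); apply: measurable_funTS.
  exact: measurable_neg_pow.
have np0 y : (0 <= (neg_pow alpha fB \_ (Omega `\` N)) y)%E.
  by apply: erestrict_ge0 => z _; exact: neg_pow_ge0.
have w0 y : (0 <= w y)%E by rewrite /w adde_ge0.
have npE A : A `<=` Omega -> (\int[mu]_(y in A) neg_pow alpha fB y =
    \int[mu]_(y in A) (neg_pow alpha fB \_ (Omega `\` N)) y)%E.
  move=> AO; apply: (integral_off_null mN N0) => y Ny.
  rewrite !patchE; case: ifPn => //; rewrite inE => /AO Oy.
  by rewrite mem_set.
have iw : mu.-integrable setT w.
  apply/integrableP; split; first exact: emeasurable_funD.
  rewrite (eq_integral (fun y => g y + (neg_pow alpha fB \_ (Omega `\` N)) y)%E);
    last by move=> y _; rewrite gee0_abs.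
  rewrite ge0_integralD// lte_add_pinfty//; rewrite -integral_mkcond.
  rewrite -(ge0_integral_setD_null mN N0); last by move=> y _; exact: neg_pow_ge0.
  apply: le_lt_trans npoo; rewrite le_eqVlt; apply/orP; left; apply/eqP.
  apply: (integral_off_null mN N0) => y Ny.
  rewrite !patchE; case: ifPn => //; rewrite inE => Oy.
  by rewrite /neg_pow /fB patchE mem_set.
apply: (hausdorff_heavy_cells _ eta0 iw w0); first by rewrite s0.
move=> x [Ox fx]; apply: P mfB _ _ _.
- apply: filterS (H x Ox) => j Hj M M0 wM; apply: Hj => //.
  apply: le_lt_trans wM; apply: ge0_le_integral_nonmeas => // y _.
  by rewrite /w leeDl.
- apply: filterS (near_cell_sub oO Ox) => j jO; rewrite npE//.
  by apply: ge0_le_integral_nonmeas => // y _; rewrite /w leeDr.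
- apply: cvg_trans (cvg_cell_avg fx); apply: near_eq_cvg.
  apply: filterS (near_cell_sub oO Ox) => j jO; rewrite /cell_avg; congr (_ * _)%E.
  apply: (integral_off_null mN N0) => y Ny.
  rewrite !patchE; case: ifPn => //; rewrite inE => /jO Oy.
  by rewrite /fB patchE mem_set.
Qed.

End reduction.

(** * Fractional seminorms *)

Section integral_bounds.
Context d (T : measurableType d) (R : realType).
Variable mu : {measure set T -> \bar R}.

(* [t <= lam + lam^(1-q) t^q] pointwise replaces Hoelder's inequality. *)
Lemma integral_le_of_integral_powR (A : set T) (h : T -> R) (q lam a : R) :
  measurable A -> measurable_fun A h -> (forall y, 0 <= h y) -> 1 <= q ->
  0 < lam -> mu A = a%:E ->
  (\int[mu]_(y in A) (h y `^ q)%:E <= (a * lam `^ q)%:E)%E ->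
  (\int[mu]_(y in A) (h y)%:E <= (2 * a * lam)%:E)%E.
Proof.
move=> mA mh h0 q1 l0 mua H.
have m1 : measurable_fun A (fun y => (h y `^ q)%:E).
  by apply/measurable_EFinP; exact: (measurableT_comp (measurable_powR _)).
have le y : A y -> ((h y)%:E <= lam%:E + (lam `^ (1 - q))%:E * (h y `^ q)%:E)%E.
  move=> _; rewrite -EFinM -EFinD lee_fin.
  have [hl|lh] := leP (h y) lam.
    by rewrite (le_trans hl)// lerDl mulr_ge0 ?powR_ge0.
  rewrite (le_trans (_ : _ <= lam `^ (1 - q) * h y `^ q))// ?lerDr ?(ltW l0)//.
  have hy : 0 < h y by exact: lt_trans lh.
  have -> : h y `^ q = h y * h y `^ (q - 1).
    by rewrite mulr_powRB1// (ltW, lt_le_trans ltr01).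
  rewrite mulrCA ler_peMr ?(ltW hy)//.
  rewrite -(opprB q 1) powRN ler_pdivlMl ?powR_gt0// mulr1.
  by rewrite ge0_ler_powR ?nnegrE ?subr_ge0// ltW.
apply: (le_trans (ge0_le_integral_nonmeas mu _ le)).
  by move=> y _; rewrite lee_fin.
rewrite ge0_integralD//; last 3 first.
- by move=> y _; rewrite lee_fin ltW.
- by move=> y _; rewrite -EFinM lee_fin mulr_ge0// powR_ge0.
- exact: measurable_funeM.
rewrite ge0_integralZl//; last 2 first.
- by move=> y _; rewrite lee_fin powR_ge0.
- by rewrite lee_fin powR_ge0.
rewrite integral_cst// mua.
apply: (@le_trans _ _ (lam%:E * a%:E + (lam `^ (1 - q))%:E * (a * lam `^ q)%:E)%E).
  by rewrite leeD2l// lee_wpmul2l// lee_fin powR_ge0.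
rewrite -!EFinM -EFinD lee_fin le_eqVlt; apply/orP; left; apply/eqP.
rewrite mulrCA -powRD; last by rewrite subrK oner_eq0.
by rewrite subrK powRr1 ?ltW//; ring.
Qed.

End integral_bounds.

Section fractional_seminorms.
Context {R : realType} {n : nat}.
Local Notation mu := (@lebesgue_rV R n).
Implicit Types (f : 'rV[R]_n -> R) (x y z : 'rV[R]_n) (Omega N : set 'rV[R]_n).

Lemma enorm_eq0 x : enorm x = 0 -> x = 0.
Proof.
move=> x0; apply/rowP => i; rewrite mxE; apply/eqP.
by have := le_coord_enorm x i; rewrite x0 normr_le0.
Qed.

Lemma enorm_cell j k x y : cell j k x -> cell j k y ->
  enorm (x - y) <= n%:R * 2 ^- j.
Proof.
move=> kx ky; apply: enorm_le => [|i]; first by rewrite ltW// half_gt0.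
by rewrite !mxE; exact: cell_dist kx ky.
Qed.

(** The constant is the value of [f] at [x]. The zeros in the exponents are left unsimplified so
    that the bound is literally the case [theta = 0] of [hausdorff_lebesgue_zero_set]. *)
Lemma holder_oscillation Omega N f (sigma L : R) x : open Omega -> 0 < sigma ->
  measurable N -> mu N = 0%E -> 0 <= L ->
  (forall y z, Omega y -> Omega z -> `|f y - f z| <= L * enorm (y - z) `^ sigma) ->
  Omega x -> \forall j \near \oo, forall M : R, 0 < M ->
    (exists c : R,
      \int[mu]_(y in cell j (dyadic_index j x)) `|(f \_ (Omega `\` N)) y - c|%:E <=
      (2 ^- (j * n) * (L * n%:R `^ sigma * (2 ^- j) `^ (sigma - n%:R * 0) * M `^ 0))%:E)%E.
Proof.
move=> oO s0 mN N0 L0 fL Ox; apply: filterS (near_cell_sub oO Ox) => j jO M M0.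
exists (f x); rewrite powRr0 mulr1 mulr0 subr0.
have -> : (\int[mu]_(y in cell j (dyadic_index j x)) `|(f \_ (Omega `\` N)) y - f x|%:E
   = \int[mu]_(y in cell j (dyadic_index j x)) `|f y - f x|%:E)%E.
  apply: (integral_off_null mN N0) => y Ny.
  rewrite [LHS]patchE [RHS]patchE; case: ifPn => //; rewrite inE => /jO Oy.
  by rewrite patchE mem_set.
apply: (@le_trans _ _ (\int[mu]_(y in cell j (dyadic_index j x))
   (cst (L * n%:R `^ sigma * (2 ^- j) `^ sigma)%:E) y)%E).
  apply: ge0_le_integral_nonmeas => y xy; first by rewrite lee_fin.
  rewrite lee_fin (le_trans (fL _ _ (jO _ xy) Ox))// -mulrA ler_wpM2l//.
  rewrite -powRM ?(ltW (half_gt0 _))// ge0_ler_powR ?nnegrE ?enorm_ge0 ?(ltW s0)//.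
  exact: enorm_cell xy (cell_dyadic_index j x).
rewrite integral_cst; last exact: measurable_cell.
by rewrite [X in (_ * X)%E](lebesgue_cell j _) -EFinM mulrC.
Qed.

Definition gagliardo_kernel (sigma q : R) f x y : R :=
  (`|f x - f y| / enorm (x - y) `^ sigma) `^ q / enorm (x - y) ^+ n.

Lemma gagliardo_kernel_ge0 sigma q f x y : 0 <= gagliardo_kernel sigma q f x y.
Proof. by rewrite divr_ge0 ?powR_ge0// exprn_ge0// enorm_ge0. Qed.

Lemma measurable_gagliardo_kernel sigma q f : measurable_fun setT f ->
  measurable_fun setT (fun z : 'rV[R]_n * 'rV[R]_n =>
    gagliardo_kernel sigma q f z.1 z.2).
Proof.
move=> mf; rewrite /gagliardo_kernel.
have me : measurable_fun setT (fun z : 'rV[R]_n * 'rV[R]_n => enorm (z.1 - z.2)).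
  by apply: measurable_enorm; apply: measurable_rVB;
    [exact: measurable_fst|exact: measurable_snd].
under eq_fun do rewrite -powRN -powR_invn ?enorm_ge0//.
apply: measurable_funM; last exact: (measurableT_comp (measurable_powR _)).
apply: (measurableT_comp (measurable_powR _)); apply: measurable_funM.
  apply: measurableT_comp => //; apply: measurable_funB.
    exact: measurableT_comp mf measurable_fst.
  exact: measurableT_comp mf measurable_snd.
exact: (measurableT_comp (measurable_powR _)).
Qed.

Lemma diff_powR_le_kernel sigma q f x y (D : R) : 0 < sigma -> 0 < q ->
  enorm (x - y) <= D ->
  `|f x - f y| `^ q <= D `^ (sigma * q) * D ^+ n * gagliardo_kernel sigma q f x y.
Proof.
move=> s0 q0 dD; have D0 : 0 <= D := le_trans (enorm_ge0 _) dD.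
(* On the diagonal the kernel divides by zero and says nothing; the left side vanishes there because
   [q > 0]. *)
have [d0|d0] := eqVneq (enorm (x - y)) 0.
  have /subr0_eq-> : x - y = 0 by exact: enorm_eq0.
  rewrite subrr normr0 powR0 ?gt_eqF// mulr_ge0 ?gagliardo_kernel_ge0//.
  by rewrite mulr_ge0 ?powR_ge0// exprn_ge0.
have d1 : 0 < enorm (x - y) by rewrite lt_def d0 enorm_ge0.
rewrite /gagliardo_kernel; set d := enorm (x - y) in d0 d1 dD *.
have -> : `|f x - f y| `^ q = d `^ (sigma * q) * d ^+ n *
    ((`|f x - f y| / d `^ sigma) `^ q / d ^+ n).
  rewrite powRM ?invr_ge0 ?powR_ge0// -powRN -powRrM mulNr powRN.
  field; rewrite expf_neq0//= gt_eqF// powR_gt0//.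
apply: ler_wpM2r; first by rewrite divr_ge0 ?powR_ge0// exprn_ge0// enorm_ge0.
apply: ler_pM; rewrite ?powR_ge0 ?exprn_ge0 ?(ltW d1)//.
  by rewrite ge0_ler_powR ?nnegrE ?mulr_ge0// ltW.
by rewrite lerXn2r ?nnegrE// ltW.
Qed.

(** Written as a section integral of one function on the product space, the form to which the
    Tonelli measurability theorem applies; [gagliardo_densityE] recovers the iterated form. *)
Definition gagliardo_density Omega sigma q f x : \bar R :=
  (\int[mu]_y ((EFin \o (fun z : 'rV[R]_n * 'rV[R]_n =>
    gagliardo_kernel sigma q f z.1 z.2)) \_ (Omega `*` Omega)) (x, y))%E.

Lemma gagliardo_density_ge0 Omega sigma q f x :
  (0 <= gagliardo_density Omega sigma q f x)%E.
Proof.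
apply: integral_ge0 => y _; apply: erestrict_ge0 => z _.
by rewrite lee_fin gagliardo_kernel_ge0.
Qed.

Lemma gagliardo_densityE Omega sigma q f x :
  gagliardo_density Omega sigma q f x =
  (((fun x => \int[mu]_(y in Omega) (gagliardo_kernel sigma q f x y)%:E) \_ Omega) x)%E.
Proof.
rewrite /gagliardo_density patchE; case: ifPn => xO.
  rewrite [RHS]integral_mkcond; apply: eq_integral => y _.
  rewrite !patchE; case: (boolP (y \in Omega)) => yO.
    by rewrite mem_set//; split => /=; exact/set_mem.
  by rewrite memNset// => -[_ /= /mem_set]; rewrite (negbTE yO).
apply: integral0_eq => y _; rewrite patchE memNset// => -[/= /mem_set].
by rewrite (negbTE xO).
Qed.

Lemma measurable_gagliardo_density Omega sigma q f : measurable Omega ->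
  measurable_fun setT f ->
  measurable_fun setT (gagliardo_density Omega sigma q f).
Proof.
move=> mO mf; apply: measurable_fun_fubini_tonelli_F.
  apply/(measurable_restrictT _ (measurableX mO mO)); apply: measurable_funTS.
  by apply/measurable_EFinP; exact: measurable_gagliardo_kernel.
move=> z; apply: erestrict_ge0 => z' _.
by rewrite lee_fin gagliardo_kernel_ge0.
Qed.

Lemma integral_gagliardo_density Omega N sigma q f : measurable N -> mu N = 0%E ->
  (\int[mu]_x gagliardo_density (Omega `\` N) sigma q (f \_ (Omega `\` N)) x =
   \int[mu]_(x in Omega) \int[mu]_(y in Omega) (gagliardo_kernel sigma q f x y)%:E)%E.
Proof.
move=> mN N0; pose F x := (\int[mu]_(y in Omega `\` N)
  (gagliardo_kernel sigma q (f \_ (Omega `\` N)) x y)%:E)%E.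
transitivity (\int[mu]_(x in Omega `\` N) F x)%E.
  rewrite [RHS]integral_mkcond; apply: eq_integral => x _; exact: gagliardo_densityE.
rewrite -(ge0_integral_setD_null mN N0); last first.
  by move=> x _; apply: integral_ge0 => y _; rewrite lee_fin gagliardo_kernel_ge0.
apply: (integral_off_null mN N0) => x Nx; rewrite !patchE.
case: (boolP (x \in Omega)) => [|_]; last reflexivity.
rewrite inE => Ox; rewrite /F -(ge0_integral_setD_null mN N0); last first.
  by move=> y _; rewrite lee_fin gagliardo_kernel_ge0.
apply: (integral_off_null mN N0) => y Ny; rewrite [LHS]patchE [RHS]patchE.
case: (boolP (y \in Omega)) => [|_]; last reflexivity.
rewrite inE => Oy.
have E z : Omega z -> ~ N z -> (f \_ (Omega `\` N)) z = f z.
  by move=> Oz Nz; rewrite patchE mem_set.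
by rewrite /gagliardo_kernel (E x Ox Nx) (E y Oy Ny).
Qed.

(** Instead of the mean, the constant is the value of [fB] at a point [z] where the kernel integral
    is at most [M / a], with [a] the volume of the cell. The kernel based at [z] then controls the
    differences [fB y - fB z] directly. *)
Lemma gagliardo_oscillation Omega N f (sigma q : R) x :
  (1 <= n)%N -> open Omega -> 0 < sigma -> 1 <= q ->
  measurable N -> mu N = 0%E -> measurable (Omega `\` N) ->
  measurable_fun setT (f \_ (Omega `\` N)) ->
  let fB := f \_ (Omega `\` N) in
  Omega x -> \forall j \near \oo, forall M : R, 0 < M ->
    (\int[mu]_(y in cell j (dyadic_index j x))
       gagliardo_density (Omega `\` N) sigma q fB y < M%:E)%E ->
    (exists c : R, \int[mu]_(y in cell j (dyadic_index j x)) `|fB y - c|%:E <=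
      (2 ^- (j * n) * (2 * n%:R `^ (sigma + n%:R / q) *
         (2 ^- j) `^ (sigma - n%:R * q^-1) * M `^ q^-1))%:E)%E.
Proof.
move=> n1 oO s0 q1 mN N0 mON mfB fB Ox.
apply: filterS (near_cell_sub oO Ox) => j jO M M0; set Q := cell j _ => gM.
have mQ : measurable Q by exact: measurable_cell.
have q0 : 0 < q by exact: lt_le_trans q1.
have muQ : mu Q = (2 ^- (j * n))%:E by rewrite lebesgue_cell.
have p0 : 0 < 2 ^- (j * n) :> R by rewrite half_gt0.
set a := 2 ^- (j * n) in p0 muQ *.
(* Otherwise the density would exceed [M / a] at every point of the cell off [N], and its integral
   would be at least [M]. *)
have [z [Qz Nz zM]] : exists z, [/\ Q z, ~ N z &
   (\int[mu]_(y in Q) (gagliardo_kernel sigma q fB z y)%:E <= (M / a)%:E)%E].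
  apply: contrapT => nz; move: gM; apply/negP; rewrite -leNgt.
  have -> : M%:E = (\int[mu]_(y in Q) cst (M / a)%:E y)%E.
    by rewrite integral_cst// [X in (_ * X)%E]muQ -EFinM divfK// gt_eqF.
  rewrite (ge0_integral_setD_null mN N0)//; last first.
    by move=> y _; rewrite lee_fin divr_ge0// ltW.
  apply: (@le_trans _ _ (\int[mu]_(y in Q `\` N)
      gagliardo_density (Omega `\` N) sigma q fB y)%E).
    apply: ge0_le_integral_nonmeas => z [Qz /= Nz].
      by rewrite lee_fin divr_ge0// ltW.
    rewrite gagliardo_densityE patchE mem_set; last by split => //; exact: jO.
    apply: (@le_trans _ _ (\int[mu]_(y in Q)
        (gagliardo_kernel sigma q fB z y)%:E)%E).
      rewrite leNgt; apply/negP => h; apply: nz; exists z; split => //.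
      exact: ltW.
    rewrite (ge0_integral_setD_null mN N0)//; last first.
      by move=> y _; rewrite lee_fin gagliardo_kernel_ge0.
    apply: ge0_subset_integral_nonmeas; first by move=> y [/jO].
    by move=> y _; rewrite lee_fin gagliardo_kernel_ge0.
  apply: ge0_subset_integral_nonmeas; first by move=> y [].
  by move=> y _; exact: gagliardo_density_ge0.
pose D : R := n%:R * 2 ^- j.
have nr0 : 0 < n%:R :> R by rewrite ltr0n.
have D0 : 0 < D by rewrite mulr_gt0// half_gt0.
(* Chosen so that a lam^q = D^(sigma q + n) M / a, the bound that the kernel gives for the integral
   of the [q]-th power of the differences. *)
pose lam := D `^ (sigma + n%:R / q) * (M / a ^+ 2) `^ q^-1.
have Ma : 0 < M / a ^+ 2 by rewrite divr_gt0// exprn_gt0.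
have lam0 : 0 < lam by rewrite mulr_gt0// powR_gt0.
have lamq : lam `^ q = D `^ (sigma * q) * D ^+ n * (M / a ^+ 2).
  rewrite /lam powRM ?powR_ge0// -!powRrM mulVf ?gt_eqF// powRr1 ?(ltW Ma)//.
  congr (_ * _); rewrite mulrDl divfK ?gt_eqF// powRD ?powR_mulrn ?(ltW D0)//.
  by rewrite (gt_eqF D0) implybT.
exists (fB z); apply: (@le_trans _ _ (2 * a *
    (n%:R `^ (sigma + n%:R / q) * (2 ^- j) `^ (sigma - n%:R * q^-1) * M `^ q^-1))%:E);
  last first.
  by rewrite -/a lee_fin le_eqVlt; apply/orP; left; apply/eqP; ring.
have -> : n%:R `^ (sigma + n%:R / q) * (2 ^- j) `^ (sigma - n%:R * q^-1) * M `^ q^-1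
   = lam.
  have h0 := ltW (half_gt0 (R := R) j).
  have aE : a = (2 ^- j) `^ n%:R by rewrite powR_mulrn// exprVn -exprM.
  rewrite /lam; have -> : M / a ^+ 2 = M * (2 ^- j) `^ (- (2 * n%:R)).
    by rewrite aE powRN -powR_mulrn ?powR_ge0// -powRrM [n%:R * _]mulrC.
  rewrite /D (powRM _ (ltW nr0) h0) (powRM _ (ltW M0) (powR_ge0 _ _)).
  rewrite -powRrM.
  have -> : sigma - n%:R * q^-1 = sigma + n%:R / q + - (2 * n%:R) / q by ring.
  rewrite [X in _ * X * _ = _]powRD; first by ring.
  by apply/implyP => _; rewrite gt_eqF// half_gt0.
apply: (@integral_le_of_integral_powR _ _ _ _ _ _ q) => //.
  by apply: measurable_funTS; apply: measurableT_comp => //; exact: measurable_funB.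
apply: (@le_trans _ _ (\int[mu]_(y in Q)
   ((D `^ (sigma * q) * D ^+ n)%:E * (gagliardo_kernel sigma q fB z y)%:E))%E).
  apply: ge0_le_integral_nonmeas => y Qy; first by rewrite lee_fin powR_ge0.
  rewrite -EFinM lee_fin distrC; apply: diff_powR_le_kernel => //.
  exact: enorm_cell Qz Qy.
have DD : 0 <= D `^ (sigma * q) * D ^+ n.
  by rewrite mulr_ge0 ?powR_ge0// exprn_ge0// ltW.
rewrite ge0_integralZl//; last 2 first.
- apply: measurable_funTS; apply/measurable_EFinP.
  apply: (measurableT_comp (measurable_gagliardo_kernel sigma q mfB)
    (g := fun y => (z, y))).
  exact: measurable_pair1.
- by move=> y _; rewrite lee_fin gagliardo_kernel_ge0.
apply: (@le_trans _ _ ((D `^ (sigma * q) * D ^+ n)%:E * (M / a)%:E)%E).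
  by rewrite lee_wpmul2l.
rewrite -EFinM lee_fin lamq le_eqVlt; apply/orP; left; apply/eqP.
by field; rewrite gt_eqF.
Qed.

End fractional_seminorms.

(** * Smooth test functions *)

Section smooth_functions.
Context {R : realType}.
Implicit Types (h g : R -> R) (k : nat) (x : R).

(** The derivative is carried as a witness, so sums, products and affine changes of variable are
    handled by induction on [k]. *)
Fixpoint class_C1 k h : Prop :=
  match k with
  | 0%N => continuous h
  | k'.+1 => exists2 h', (forall x, is_derive x 1 h (h' x)) & class_C1 k' h'
  end.

Definition smooth h := forall k, class_C1 k h.

Lemma is_derive_continuous h h' : (forall x, is_derive x 1 h (h' x)) -> continuous h.
Proof.
move=> dh x; apply: differentiable_continuous; apply/derivable1_diffP.
by have [] := dh x.
Qed.

Lemma class_C1W k h : class_C1 k.+1 h -> class_C1 k h.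
Proof.
elim: k h => [h [h' dh _]|k IH h [h' dh h'C]]; first exact: is_derive_continuous dh.
by exists h' => //; exact: IH.
Qed.

Lemma smooth_continuous h : smooth h -> continuous h.
Proof. by move=> /(_ 0%N). Qed.

Lemma class_C1D k h g : class_C1 k h -> class_C1 k g -> class_C1 k (fun x => h x + g x).
Proof.
elim: k h g => [h g hC gC x|k IH h g [h' dh h'C] [g' dg g'C]].
  exact: cvgD (hC x) (gC x).
by exists (fun x => h' x + g' x); [move=> x; exact: is_deriveD|exact: IH].
Qed.

Lemma class_C1M k h g : class_C1 k h -> class_C1 k g -> class_C1 k (fun x => h x * g x).
Proof.
elim: k h g => [h g hC gC x|k IH h g hC gC]; first exact: cvgM (hC x) (gC x).
have hC' := class_C1W hC; have gC' := class_C1W gC.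
move: hC gC => [h' dh h'C] [g' dg g'C].
exists (fun x => h x * g' x + g x * h' x); first by move=> x; exact: is_deriveM.
by apply: class_C1D; exact: IH.
Qed.

Lemma class_C1_cst k (c : R) : class_C1 k (fun=> c).
Proof.
elim: k c => [c x|k IH c]; first exact: cvg_cst.
by exists (fun=> 0) => // x; exact: is_derive_cst.
Qed.

Lemma is_derive_affine h x (a b d : R) : is_derive (a * x + b) 1 h d ->
  is_derive x 1 (fun t => h (a * t + b)) (a * d).
Proof.
move=> dh; have df : is_derive x 1 (fun t : R => a * t + b) a.
  have -> : (fun t : R => a * t + b) = (a \*: (id : R -> R)) + cst b by apply/funext.
  by apply: is_derive_eq; rewrite addr0 /GRing.scale/= mulr1.
rewrite [a * d]mulrC.
exact: (@is_derive1_comp R h (fun t => a * t + b) x d a dh df).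
Qed.

Lemma class_C1_affine k h (a b : R) :
  class_C1 k h -> class_C1 k (fun t => h (a * t + b)).
Proof.
elim: k h => [h hC x|k IH h [h' dh h'C]].
  apply: (@continuous_comp _ _ _ (fun t => a * t + b) h x _ (hC _)).
  by apply: cvgD; [apply: cvgM; [exact: cvg_cst|exact: cvg_id]|exact: cvg_cst].
exists (fun t => a * h' (a * t + b)); first by move=> x; exact: is_derive_affine.
by apply: class_C1M; [exact: class_C1_cst|exact: IH].
Qed.

Lemma smoothM h g : smooth h -> smooth g -> smooth (fun x => h x * g x).
Proof. by move=> hC gC k; exact: class_C1M. Qed.

Lemma smooth_affine h (a b : R) : smooth h -> smooth (fun t => h (a * t + b)).
Proof. by move=> hC k; exact: class_C1_affine. Qed.

Lemma smoothB h g : smooth h -> smooth g -> smooth (fun x => h x - g x).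
Proof.
move=> hC gC k; apply: class_C1D => //.
rewrite (_ : (fun x => - g x) = (fun x => (-1) * g x)).
  by apply: class_C1M => //; exact: class_C1_cst.
by apply/funext => x; rewrite mulN1r.
Qed.

Lemma smooth_derive h h' : (forall x, is_derive x 1 h (h' x)) -> smooth h -> smooth h'.
Proof.
move=> dh hC k; have [h2 dh2] := hC k.+1; rewrite (_ : h2 = h')//.
by apply/funext => x; have [_ <-] := dh x; have [_ <-] := dh2 x.
Qed.

Lemma smooth_primitive h h' : (forall x, is_derive x 1 h (h' x)) -> smooth h' -> smooth h.
Proof. by move=> dh h'C [|k]; [exact: is_derive_continuous dh|exists h']. Qed.

(** The classical flat function exp(-1/x) is [flat 0]. The factor x^(-k) is there because the
    derivative of [flat k] is a combination of [flat k.+1] and [flat k.+2], so one induction proves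
    smoothness of the whole family. *)
Definition flat k x : R := if 0 < x then x ^- k * expR (- x^-1) else 0.

Lemma flat_le0 k x : x <= 0 -> flat k x = 0.
Proof. by rewrite /flat ltNge => ->. Qed.

Lemma flatS k x : flat k x = x * flat k.+1 x.
Proof.
rewrite /flat; case: ifP => [x0|]; last by rewrite mulr0.
by rewrite mulrA exprS invfM mulrA divff ?mul1r// gt_eqF.
Qed.

(** At 1/x the exponential dominates the term of order [k.+1] of its series, whence the factorial.
    The linear bound is what gives derivative 0 at the origin. *)
Lemma flat_bound k : exists2 C : R, 0 <= C & forall x, `|flat k x| <= C * `|x|.
Proof.
exists (k.+1`!%:R) => // x; rewrite flatS normrM mulrC ler_wpM2r//.
rewrite /flat; case: ifP => x0; last by rewrite normr0.
have xi : 0 < x^-1 by rewrite invr_gt0.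
rewrite ger0_norm ?mulr_ge0 ?invr_ge0 ?exprn_ge0 ?expR_ge0 ?(ltW x0)//.
rewrite expRN ler_pdivrMr ?expR_gt0// mulrC -ler_pdivrMr ?ltr0n ?fact_gt0//.
have := @expR_ge1Dxn _ x^-1 k (ltW xi); rewrite exprVn; apply: le_trans.
by rewrite lerDr.
Qed.

Lemma is_derive_flat k x :
  is_derive x 1 (flat k) (flat k.+2 x - k%:R * flat k.+1 x).
Proof.
have [x0|x0|->] := ltgtP x 0.
- rewrite !flat_le0 ?(ltW x0)// mulr0 subr0.
  have nx : \near x, cst 0 x = flat k x.
    by apply: filterS (lt_nbhsl x0) => y y0; rewrite flat_le0// ltW.
  exact: near_eq_is_derive nx (is_derive_cst _ _ _).
- have xn0 : x != 0 by rewrite gt_eqF.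
  have nx : \near x, (fun y : R => (y ^+ k)^-1 * expR (- y^-1)) x = flat k x.
    by apply: filterS (lt_nbhsr x0) => y y0; rewrite /flat y0.
  apply: near_eq_is_derive nx _.
  have d1 : is_derive x 1 (fun y : R => y^-1) (- x ^- 2).
    have := @is_deriveV _ id x 1 1 xn0 (is_derive_id _ _).
    by rewrite /GRing.scale/= mulr1.
  have d2 : is_derive x 1 (fun y : R => (y ^+ k)^-1) (- k%:R * x ^- k.+1).
    have dX := @is_deriveX _ _ (id : R -> R) k x 1 1 (is_derive_id _ _).
    have xk : (id ^+ k : R -> R) x != 0 by rewrite fctE expf_neq0.
    have := @is_deriveV _ _ x _ _ xk dX; rewrite /GRing.scale/= mulr1.
    rewrite (_ : (fun y => ((id ^+ k : R -> R) y)^-1) = fun y => (y ^+ k)^-1); last first.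
      by apply/funext => y; rewrite fctE.
    rewrite (_ : - _ * _ = - k%:R * x ^- k.+1)// fctE.
    case: k {dX xk} => [|j]; first by rewrite !mul0r mulr0 oppr0 mul0r.
    rewrite /= !exprS expr0.
    by field; rewrite xn0 expf_neq0.
  have d3 : is_derive x 1 (fun y : R => expR (- y^-1)) (x ^- 2 * expR (- x^-1)).
    have := @is_derive1_comp R expR (fun y => - y^-1) x _ _ (is_derive_expR _)
      (is_deriveN d1).
    by rewrite opprK mulrC.
  have := @is_deriveM _ _ _ _ x 1 _ _ d2 d3.
  rewrite (_ : _ *: _ + _ *: _ = flat k.+2 x - k%:R * flat k.+1 x)//.
  rewrite /flat x0 /GRing.scale/= !exprS.
  by field; rewrite xn0 expf_neq0.
- rewrite !flat_le0// mulr0 subr0.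
  have [C C0 HC] := flat_bound k.+1.
  (* By [flatS] the difference quotient at 0 equals [flat k.+1 h], which [flat_bound] sends to 0. *)
  have H : h^-1 *: (flat k (h *: 1 + 0) - flat k 0) @[h --> (0 : R)^'] --> (0 : R).
    have C1 : 0 < C + 1 by rewrite ltr_wpDl.
    apply/cvgr0Pnorm_lt => e e0; near=> h.
    have h0 : h != 0 by near: h; exact: nbhs_dnbhs_neq.
    rewrite /GRing.scale/= mulr1 addr0 (flat_le0 _ (lexx 0)) subr0 flatS mulrA mulVf// mul1r.
    apply: (le_lt_trans (HC h)).
    apply: (@le_lt_trans _ _ ((C + 1) * `|h|)); first by rewrite ler_wpM2r// lerDl.
    rewrite mulrC -ltr_pdivlMr//; near: h; apply: dnbhs0_lt.
    by rewrite divr_gt0.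
  by apply: DeriveDef; [apply: cvgP H|apply/cvg_lim: H].
Unshelve. all: by end_near. Qed.

Lemma class_C1_flat j k : class_C1 j (flat k).
Proof.
elim: j k => [k|j IH k]; first exact: is_derive_continuous (is_derive_flat k).
exists (fun x => flat k.+2 x - k%:R * flat k.+1 x); first exact: is_derive_flat.
apply: class_C1D => //.
rewrite (_ : (fun x => _) = (fun x => (- k%:R) * flat k.+1 x)).
  by apply: class_C1M => //; exact: class_C1_cst.
by apply/funext => x; rewrite mulNr.
Qed.

Lemma flat0_01 x : 0 <= flat 0 x <= 1.
Proof.
rewrite /flat; case: ifP => x0; last by rewrite lexx ler01.
by rewrite expr0 invr1 mul1r expR_ge0/= -expR0 ler_expR oppr_le0 invr_ge0 ltW.
Qed.

Lemma flat0_ge x : 0 < x -> 1 - x^-1 <= flat 0 x.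
Proof. by move=> x0; rewrite /flat x0 expr0 invr1 mul1r expR_ge1Dx. Qed.

End smooth_functions.

(** * Smooth cutoffs of intervals and their primitives *)

Section cutoffs.
Context {R : realType}.
Implicit Types (a b t : R) (m : nat).

(* The first argument is [(m+1)^2 (t - (a - 1/(m+1)))]: the shift of [a] makes the
   limit the indicator of the interval closed at [a]. *)
Definition cut a b m t : R :=
  flat 0 (m.+1%:R ^+ 2 * t + (m.+1%:R - m.+1%:R ^+ 2 * a)) *
  flat 0 (- m.+1%:R * t + m.+1%:R * b).

Lemma smooth_cut a b m : smooth (cut a b m).
Proof. by apply: smoothM; apply: smooth_affine => k; exact: class_C1_flat. Qed.

Lemma cut_01 a b m t : 0 <= cut a b m t <= 1.
Proof.
have /andP[h0 h1] := @flat0_01 R (m.+1%:R ^+ 2 * t + (m.+1%:R - m.+1%:R ^+ 2 * a)).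
have /andP[g0 g1] := @flat0_01 R (- m.+1%:R * t + m.+1%:R * b).
by rewrite mulr_ge0//= mulr_ile1.
Qed.

Lemma cut_eq0_le a b m t : t <= a - m.+1%:R^-1 -> cut a b m t = 0.
Proof.
move=> ta; rewrite /cut flat_le0 ?mul0r//.
have m0 : 0 < m.+1%:R :> R by [].
have -> : m.+1%:R ^+ 2 * t + (m.+1%:R - m.+1%:R ^+ 2 * a) =
   m.+1%:R ^+ 2 * (t - (a - m.+1%:R^-1)) by field; rewrite gt_eqF.
by rewrite pmulr_rle0 ?exprn_gt0// subr_le0.
Qed.

Lemma cut_eq0_ge a b m t : b <= t -> cut a b m t = 0.
Proof.
move=> bt; rewrite /cut [X in _ * X]flat_le0 ?mulr0//.
by rewrite mulNr addrC -mulrBr pmulr_rle0// subr_le0.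
Qed.

Lemma cvg_flat0 (u : nat -> R) (c : R) : 0 < c ->
  (forall m, c * m.+1%:R <= u m) -> flat 0 (u m) @[m --> \oo] --> (1 : R).
Proof.
move=> c0 cu.
have u0 m : 0 < u m by apply: lt_le_trans (cu m); rewrite mulr_gt0.
apply: (@squeeze_cvgr _ _ _ _ (fun m => 1 - c^-1 * harmonic m) (fun=> 1)).
- apply: nearW => m; have /andP[_ ->] := flat0_01 (u m); rewrite andbT.
  apply: le_trans (flat0_ge (u0 m)); rewrite lerD2l lerN2.
  by rewrite /harmonic/= -invfM lef_pV2 ?posrE ?mulr_gt0.
- rewrite -[X in _ --> X]subr0 -(mulr0 c^-1).
  apply: cvgB; first exact: cvg_cst.
  by apply: cvgM; [exact: cvg_cst|exact: cvg_harmonic].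
- exact: cvg_cst.
Qed.

Lemma cvg_cut a b t : cut a b m t @[m --> \oo] --> ((a <= t < b)%R%:R : R).
Proof.
have [ta|at_] := ltP t a.
  have [N HN] : exists N, forall m, (N <= m)%N -> m.+1%:R^-1 <= a - t.
    have at0 : 0 < a - t by rewrite subr_gt0.
    have := @cvg_harmonic R => /cvgr0_norm_lt/(_ _ at0)[N _ HN].
    exists N => m /HN; rewrite ger0_norm; first exact: ltW.
    by rewrite /harmonic/= invr_ge0.
  apply: cvg_near_cst; exists N => // m /= /HN H; by rewrite cut_eq0_le// lerBrDr -lerBrDl.
have [bt|tb] := leP b t.
  by apply: cvg_near_cst; apply: nearW => m; rewrite cut_eq0_ge.
rewrite /= -[X in _ --> X]mul1r; apply: cvgM.
  apply: (@cvg_flat0 _ 1) => // m; rewrite mul1r.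
  have -> : m.+1%:R ^+ 2 * t + (m.+1%:R - m.+1%:R ^+ 2 * a) =
     m.+1%:R + m.+1%:R ^+ 2 * (t - a) by ring.
  by rewrite lerDl mulr_ge0 ?exprn_ge0// subr_ge0.
apply: (@cvg_flat0 _ (b - t)) => [|m]; first by rewrite subr_gt0.
by rewrite le_eqVlt; apply/orP; left; apply/eqP; ring.
Qed.

Lemma is_derive_mvt (S h : R -> R) x y : (forall t, is_derive t 1 S (h t)) ->
  x < y -> exists2 c, x < c < y & S y - S x = h c * (y - x).
Proof.
move=> dS xy; have [|c] := @MVT _ S h x y xy (fun t _ => dS t).
  by apply: continuous_subspaceT; exact: is_derive_continuous dS.
by rewrite in_itv/= => cxy E; exists c.
Qed.

(** The primitive is the integral from minus infinity, and its bounds follow from the mean value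
    theorem. Since it is constant beyond [be], subtracting a translate of it leaves a compactly
    supported function. *)
Lemma bump_primitive (h : R -> R) (al be : R) : continuous h -> al <= be ->
  (forall t, 0 <= h t <= 1) -> (forall t, t <= al -> h t = 0) ->
  (forall t, be <= t -> h t = 0) ->
  exists S : R -> R, [/\ forall t, is_derive t 1 S (h t),
    forall t, t <= al -> S t = 0, forall t, be <= t -> S t = S be &
    forall t, 0 <= S t <= be - al].
Proof.
move=> ch ab h01 hl hr.
pose S t := (\int[@lebesgue_measure R]_(x in [set` Interval -oo%O (BRight t)]) h x)%R.
have ih u : (@lebesgue_measure R).-integrable [set` Interval -oo%O (BRight u)] (EFin \o h).
  apply: (@integrableS _ _ _ _ setT) => //.
  apply: (@le_integrable _ _ R lebesgue_measure setT measurableT (EFin \o h)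
    (EFin \o \1_(`[al, be]%classic))) => //.
  - by apply/measurable_EFinP; exact: continuous_measurable_fun.
  - move=> x _ /=; rewrite lee_fin indicE; have /andP[h0 h1] := h01 x.
    rewrite ger0_norm//; case: (boolP (x \in _)) => [_|]; first by rewrite normr1.
    rewrite notin_setE /= in_itv/= => /negP; rewrite negb_and -!ltNge normr0.
    by move=> /orP[/ltW/hl ->|/ltW/hr ->].
  - exact: integrable_indic_itv.
have dS t : is_derive t 1 S (h t).
  have tt1 : t < t + 1 by rewrite ltrDl.
  have [d e] := @continuous_FTC1 R h -oo%O t (t + 1) tt1
     (ih (t + 1)) (ltNyr t) (ch t).
  by apply: (DeriveDef d); rewrite -derive1E.
have Sl t : t <= al -> S t = 0.
  move=> ta; rewrite /S /Rintegral integral0_eq// => x /=; rewrite in_itv/= => xt.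
  by rewrite hl// (le_trans xt).
have Sr t : be <= t -> S t = S be.
  rewrite le_eqVlt => /predU1P[->//|bt].
  have [c /andP[bc _]] := is_derive_mvt dS bt.
  by rewrite hr ?(ltW bc)// mul0r => /eqP; rewrite subr_eq0 => /eqP.
have nd x y : x <= y -> 0 <= S y - S x <= y - x.
  rewrite le_eqVlt => /predU1P[->|xy]; first by rewrite !subrr lexx.
  have [c _ ->] := is_derive_mvt dS xy; have /andP[h0 h1] := h01 c.
  have yx : 0 <= y - x by rewrite subr_ge0 ltW.
  by rewrite mulr_ge0//= ler_piMl.
exists S; split=> // t.
have [ta|at_] := leP t al; first by rewrite Sl// lexx subr_ge0.
have [bt|tb] := leP be t.
  by rewrite Sr//; have := nd _ _ ab; rewrite (Sl al)// subr0.
have := nd _ _ (ltW at_); rewrite (Sl al)// subr0 => /andP[-> H].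
by rewrite (le_trans H)// lerB// ltW.
Qed.

End cutoffs.

(** * Products of one-variable test functions *)

Section tensor_products.
Context {R : realType} {n : nat}.
Implicit Types (phi : 'I_n -> R -> R) (y : 'rV[R]_n) (i : 'I_n).

Definition tensor phi y : R := \prod_(i < n) phi i (y ord0 i).

Definition upd {T} (phi : 'I_n -> T) i (g : T) : 'I_n -> T :=
  fun j => if j == i then g else phi j.

Lemma tensor_upd phi i g y : tensor (upd phi i g) y =
  g (y ord0 i) * \prod_(j < n | j != i) phi j (y ord0 j).
Proof.
rewrite /tensor (bigD1 i)//= /upd eqxx; congr (_ * _).
by apply: eq_bigr => j /negbTE ->.
Qed.

Lemma upd_id {T} (phi : 'I_n -> T) i : upd phi i (phi i) = phi.
Proof. by apply/funext => j; rewrite /upd; case: eqP => [->|]. Qed.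

(** Along a coordinate direction a single factor varies, so the difference quotient is a
    one-variable quotient times a constant. *)
Lemma is_derive_tensor phi i (d : R -> R) y :
  is_derive (y ord0 i) 1 (phi i) (d (y ord0 i)) ->
  is_derive y (delta_mx ord0 i) (tensor phi) (tensor (upd phi i d) y).
Proof.
move=> [dphi ephi]; rewrite tensor_upd; set P := \prod_(_ < _ | _) _.
have E : (fun h : R => h^-1 *: ((tensor phi \o shift y) (h *: delta_mx ord0 i) - tensor phi y))
   = (fun h => (h^-1 *: ((phi i \o shift (y ord0 i)) (h *: (1 : R)) - phi i (y ord0 i))) * P).
  apply/funext => h /=; rewrite -{1 2}(upd_id phi i) !tensor_upd /GRing.scale/=.
  rewrite -mulrA; congr (_ * _); rewrite mulrBl; congr (_ - _).
  rewrite !mxE !eqxx /= mulr1; congr (_ * _).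
  by apply: eq_bigr => j ji; rewrite !mxE eqxx (negbTE ji) mulr0 add0r.
have L : (h^-1 *: ((tensor phi \o shift y) (h *: delta_mx ord0 i) - tensor phi y))
    @[h --> (0 : R)^'] --> d (y ord0 i) * P.
  rewrite E; apply: cvgM; last exact: cvg_cst.
  by rewrite -ephi; exact: dphi.
by apply: DeriveDef; [apply: cvgP L|apply/cvg_lim: L].
Qed.

Lemma continuous_tensor phi : (forall i, continuous (phi i)) -> continuous (tensor phi).
Proof.
move=> cphi; rewrite /tensor.
suff H s : continuous (fun z : 'rV[R]_n => \prod_(i <- s) phi i (z ord0 i)) by exact: H.
elim: s => [|i s IH] y.
  have -> : (fun z : 'rV[R]_n => \prod_(i <- [::]) phi i (z ord0 i)) = cst 1.
    by apply/funext => z; rewrite big_nil.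
  exact: cst_continuous.
have -> : (fun z : 'rV[R]_n => \prod_(j <- i :: s) phi j (z ord0 j)) =
    (fun z => phi i (z ord0 i) * \prod_(j <- s) phi j (z ord0 j)).
  by apply/funext => z; rewrite big_cons.
apply: cvgM; [exact: nbhs_filter| |exact: IH].
have cz : continuous_at y (fun z : 'rV[R]_n => z ord0 i) by exact: coord_continuous.
exact: (continuous_comp cz (cphi i _)).
Qed.

(** The induction runs over all families at once, since a partial derivative replaces one factor by
    its derivative and is again a tensor. *)
Lemma class_C_tensor k phi : (forall i, smooth (phi i)) -> class_C k (tensor phi).
Proof.
elim: k phi => [|k IH] phi sphi /=.
  by apply: continuous_tensor => i; exact: smooth_continuous.
split; first by apply: continuous_tensor => i; exact: smooth_continuous.
move=> i; have [d dd _] := sphi i 1%N.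
have dt y := is_derive_tensor (dd (y ord0 i)).
split=> [y|]; first by have [] := dt y.
have -> : partial i (tensor phi) = tensor (upd phi i d).
  by apply/funext => y; have [_] := dt y.
apply: IH => j; rewrite /upd; case: eqP => // _; exact: smooth_derive dd (sphi i).
Qed.

Definition cbox (a b : 'I_n -> R) : set 'rV[R]_n :=
  [set y | forall i, a i <= y ord0 i <= b i].

Lemma compact_cbox a b : compact (cbox a b).
Proof.
have -> : cbox a b = [set y : 'rV[R]_n | forall i, `[a i, b i]%classic (y ord0 i)].
  by apply/seteqP; split => y H i; have := H i; rewrite /= in_itv.
by apply: (@rV_compact R n (fun i => `[a i, b i]%classic)) => i; exact: segment_compact.
Qed.

Lemma closed_cbox a b : closed (cbox a b).
Proof.
by apply: compact_closed; [exact: norm_hausdorff|exact: compact_cbox].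
Qed.

Lemma tensor_eq0 phi a b y : (forall i t, ~~ (a i <= t <= b i) -> phi i t = 0) ->
  ~ cbox a b y -> tensor phi y = 0.
Proof.
move=> phi0 ny; apply: contra_notP ny => /eqP; rewrite /tensor => /prodf_neq0 y0 i.
by apply: contraT => /phi0 yi; have := y0 i isT; rewrite yi eqxx.
Qed.

Lemma partial_tensor_eq0 phi a b i y :
  (forall i t, ~~ (a i <= t <= b i) -> phi i t = 0) ->
  ~ cbox a b y -> partial i (tensor phi) y = 0.
Proof.
move=> phi0 ny; rewrite /partial -[RHS](derive_cst (0 : R) y (delta_mx ord0 i)).
apply: near_eq_derive; have : nbhs y (~` cbox a b).
  by apply: open_nbhs_nbhs; split => //; apply: closed_openC; exact: closed_cbox.
by apply: filterS => z; exact: tensor_eq0.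
Qed.

Lemma test_function_tensor (Omega : set 'rV[R]_n) phi (a b : 'I_n -> R) :
  (forall i, smooth (phi i)) ->
  (forall i t, ~~ (a i <= t <= b i) -> phi i t = 0) ->
  cbox a b `<=` Omega -> test_function Omega (tensor phi).
Proof.
move=> sphi phi0 KO.
have sub : closure [set y | tensor phi y != 0] `<=` cbox a b.
  rewrite closureE => y; apply; split; first exact: closed_cbox.
  by move=> z /eqP; apply: contra_notP; exact: tensor_eq0.
split; first by move=> k; exact: class_C_tensor.
  by apply: subclosed_compact sub; [exact: closed_closure|exact: compact_cbox].
exact: subset_trans sub KO.
Qed.

End tensor_products.

(** * Comparison of neighbouring subcells *)

Lemma cvg_integral_weights d (T : measurableType d) (R : realType)
    (mu : {measure set T -> \bar R}) (D : set T) (F : T -> R)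
    (wt : (T -> R)^nat) (w : T -> R) (C : R) : measurable D -> 0 <= C ->
  mu.-integrable D (EFin \o F) ->
  (forall m, measurable_fun D (wt m)) -> measurable_fun D w ->
  (forall m x, D x -> `|wt m x| <= C) ->
  (forall x, D x -> wt ^~ x @ \oo --> w x) ->
  (\int[mu]_(x in D) (F x * wt m x)%:E)%E @[m --> \oo] -->
  (\int[mu]_(x in D) (F x * w x)%:E)%E.
Proof.
move=> mD C0 iF mwt mw wtC wtw.
have mF : measurable_fun D F by apply/measurable_EFinP; exact: measurable_int iF.
have [|||||_ _ //] := @dominated_convergence _ _ _ mu D mD
    (fun m x => (F x * wt m x)%:E) (fun x => (F x * w x)%:E)
    (fun x => C%:E * `|F x|%:E)%E.
- by move=> m; apply/measurable_EFinP/measurable_funM.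
- by apply/measurable_EFinP/measurable_funM.
- apply: aeW => x Dx; apply: cvg_EFin; first exact: nearW.
  by apply: cvgM; [exact: cvg_cst|exact: wtw].
- apply: integrableZl => //; exact: integrable_abse iF.
- apply: aeW => x m Dx; rewrite /= -EFinM lee_fin normrM mulrC ler_wpM2r//.
  exact: wtC.
Qed.

Section strip_inequality.
Context {R : realType} {n : nat}.
Local Notation mu := (@lebesgue_rV R n).

Lemma measurable_cbox (A B : 'I_n -> R) : measurable (cbox A B).
Proof.
rewrite (_ : cbox A B = \big[setI/setT]_(i < n) (rV_coord i @^-1` `[A i, B i])).
  apply: bigsetI_measurable => i _; rewrite -[X in measurable X]setTI.
  exact: measurable_rV_coord.
rewrite -bigcap_seq; apply/seteqP; split => [y yab i _|y yab i].
  by rewrite /= in_itv/=; exact: yab.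
by have := yab i (mem_index_enum i); rewrite /= in_itv.
Qed.

Lemma measurable_coord_comp (h : R -> R) i : measurable_fun setT h ->
  measurable_fun [set: 'rV[R]_n] (fun y => h (y ord0 i)).
Proof. by move=> mh; exact: measurableT_comp mh (measurable_rV_coord i). Qed.

Lemma measurable_tensor (phi : 'I_n -> R -> R) :
  (forall i, measurable_fun setT (phi i)) -> measurable_fun [set: 'rV[R]_n] (tensor phi).
Proof.
by move=> mphi; apply: measurable_prod => i _; exact: measurable_coord_comp.
Qed.

Lemma cvg_tensor (phi : nat -> 'I_n -> R -> R) (psi : 'I_n -> R -> R) (y : 'rV[R]_n) :
  (forall i t, phi m i t @[m --> \oo] --> psi i t) ->
  tensor (phi m) y @[m --> \oo] --> tensor psi y.
Proof.
move=> H; rewrite /tensor; elim: (index_enum _) => [|i s IH].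
  rewrite big_nil (_ : (fun _ => _) = fun=> 1); first exact: cvg_cst.
  by apply/funext => m; rewrite big_nil.
rewrite big_cons (_ : (fun m => _) =
    (fun m => phi m i (y ord0 i) * \prod_(j <- s) phi m j (y ord0 j))).
  by apply: cvgM.
by apply/funext => m; rewrite big_cons.
Qed.

Lemma tensor_norm_le (phi : 'I_n -> R -> R) (C : 'I_n -> R) y :
  (forall i t, `|phi i t| <= C i) -> `|tensor phi y| <= \prod_(i < n) C i.
Proof.
by move=> H; rewrite normr_prod; apply: ler_prod => i _; rewrite normr_ge0 H.
Qed.

Lemma prod_upd1 i (x : R) : \prod_(j < n) upd (fun=> 1) i x j = x.
Proof.
rewrite (bigD1 i)//= /upd eqxx big1 ?mulr1// => j /negbTE ->//.
Qed.

Lemma indic_box (a b : 'I_n -> R) y :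
  \1_(box a b) y = tensor (fun j t => ((a j <= t < b j)%R%:R : R)) y.
Proof.
rewrite indicE; case: (boolP (y \in _)) => [|yab].
  by rewrite inE => yab; rewrite /tensor big1// => i _; rewrite yab.
have /existsNP[i /negP ni] : ~ (forall i, a i <= y ord0 i < b i).
  by move: yab; rewrite notin_setE.
by rewrite /tensor (bigD1 i)//= (negbTE ni) mul0r.
Qed.

(** In the limit the test function is bounded by [l] and lives on the strip from [lo] to [hi], while
    its [i]-th derivative becomes the difference of the two indicators. The strict inequalities at
    [A] leave room for the cutoffs, which protrude on the left only. The identity is assumed only
    for tensors supported in the box, so that it can be stated for Borel versions. *)
Lemma strip_inequality (A B c : 'I_n -> R) i (l d lo hi : R) (f g : 'rV[R]_n -> R) :
  0 < l -> measurable_fun setT f -> measurable_fun setT g ->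
  mu.-integrable (cbox A B) (EFin \o f) -> mu.-integrable (cbox A B) (EFin \o g) ->
  (forall phi, (forall j, smooth (phi j)) ->
    (forall j t, ~~ (A j <= t <= B j) -> phi j t = 0) ->
    (\int[mu]_(y in cbox A B) (f y * partial i (tensor phi) y)%:E =
    - \int[mu]_(y in cbox A B) (g y * tensor phi y)%:E)%E) ->
  (forall j, A j < c j) -> (forall j, c j + l <= B j) ->
  A i < lo -> hi <= B i -> lo <= c i -> lo <= c i + d ->
  c i + l <= hi -> c i + d + l <= hi ->
  (`|\int[mu]_(y in cbox A B) (f y * (\1_(box c (fun j => c j + l)) y -
       \1_(box (upd c i (c i + d)) (fun j => upd c i (c i + d) j + l)) y))%:E| <=
   l%:E * \int[mu]_(y in cbox A B)
     (`|g y| * \1_(box (upd c i lo) (upd (fun j => c j + l) i hi)) y)%:E)%E.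
Proof.
move=> l0 mf mg intf intg W Ac cB Alo hiB loc locd chi cdhi.
set K := cbox A B in intf intg W *.
have mK : measurable K by exact: measurable_cbox.
(* The width by which a cutoff protrudes to the left of its interval. *)
pose M m : R := m.+1%:R^-1.
have M0 m : 0 < M m by rewrite invr_gt0.
have M1 m : M m <= 1 by rewrite invf_le1// ler1n.
pose ct m (j : 'I_n) := cut (c j) (c j + l) m.
have Sex (m : nat) : {S : R -> R | [/\ forall t : R, is_derive t 1 S (ct m i t),
    forall t, t <= c i - M m -> S t = 0, forall t, c i + l <= t -> S t = S (c i + l) &
    forall t, 0 <= S t <= (c i + l) - (c i - M m)]}.
  apply/cid/bump_primitive.
  - exact/smooth_continuous/smooth_cut.
  - by have := M0 m; lra.
  - by move=> t; exact: cut_01.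
  - by move=> t; exact: cut_eq0_le.
  - by move=> t; exact: cut_eq0_ge.
pose S m := projT1 (Sex m).
pose u m (t : R) := S m t - S m (1 * t + - d).
pose v m (t : R) := ct m i t - ct m i (1 * t + - d).
have du m (t : R) : is_derive t 1 (u m) (v m t).
  have [dS _ _ _] := projT2 (Sex m).
  apply: is_deriveB; rewrite -[X in is_derive _ _ _ X]mul1r.
  exact: is_derive_affine (dS _).
have sct m j : smooth (ct m j) by exact: smooth_cut.
have sv m : smooth (v m) by apply: smoothB => //; exact: smooth_affine.
have su m : smooth (u m) by exact: smooth_primitive (du m) (sv m).
(* Left of [lo - M m] both primitives are 0, right of [hi] both equal the same constant, and in
   between both lie between 0 and [l + M m]. *)
have u_le m t : `|u m t| <= (l + M m) * ((lo - M m <= t < hi)%R)%:R.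
  have [_ Sl Sr S01] := projT2 (Sex m); rewrite -/(S m) in Sl Sr S01.
  have [tlo|tlo] := ltP t (lo - M m).
    by rewrite mulr0 /u !Sl ?subrr ?normr0//; lra.
  have [thi|thi] := leP hi t.
    by rewrite mulr0 /u !Sr ?subrr ?normr0//; lra.
  rewrite mulr1 /u; have /andP[a0 a1] := S01 t; have /andP[b0 b1] := S01 (1 * t + - d).
  by rewrite ler_norml; apply/andP; split; lra.
pose Phi m := tensor (upd (ct m) i (u m)).
(* A majorant of [Phi m] whose limit is [l] times the indicator of the strip. *)
pose Psi m (y : 'rV[R]_n) := (l + M m) *
  tensor (upd (ct m) i (fun t => ((lo - M m <= t < hi)%R)%:R)) y.
have ct01 m j t : `|ct m j t| <= 1.
  by have /andP[h0 h1] := cut_01 (c j) (c j + l) m t; rewrite ger0_norm.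
have mcont (h : R -> R) : smooth h -> measurable_fun setT h.
  by move=> sh; apply: continuous_measurable_fun; exact: smooth_continuous.
have mind (a b : R) : measurable_fun setT (fun t : R => ((a <= t < b)%R)%:R : R).
  rewrite (_ : (fun t : R => _) = \1_(`[a, b[%classic)); first exact: measurable_indic.
  apply/funext => t; rewrite indicE.
  suff -> : (t \in `[a, b[%classic) = (a <= t < b) by [].
  by apply/idP/idP; rewrite inE /= in_itv.
have PhiPsi m y : `|Phi m y| <= Psi m y.
  rewrite /Phi /Psi !tensor_upd normrM mulrA; apply: ler_pM => //.
  rewrite ger0_norm//; apply: prodr_ge0 => j _.
  by have /andP[] := cut_01 (c j) (c j + l) m (y ord0 j).
have dPhi m : partial i (Phi m) = tensor (upd (ct m) i (v m)).
  apply/funext => y; have dui : is_derive (y ord0 i) 1 (upd (ct m) i (u m) i) (v m (y ord0 i)).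
    by rewrite /upd eqxx.
  have [_ E] := is_derive_tensor dui; rewrite /partial E !tensor_upd; congr (_ * _).
  by apply: eq_bigr => j ji; rewrite /upd (negbTE ji).
have ineq : \forall m \near \oo,
    (`|\int[mu]_(y in K) (f y * partial i (Phi m) y)%:E| <=
    \int[mu]_(y in K) (`|g y| * Psi m y)%:E)%E.
  (* The test function is supported in the box only once the protruding parts fit to the right of
     [A], simultaneously in the finitely many coordinates. *)
  have gap : \forall m \near \oo, forall j, M m <= c j - A j /\ M m <= lo - A i.
    have small (e : R) : 0 < e -> \forall m \near \oo, M m <= e.
      move=> e0; have := @cvg_harmonic R => /cvgr0_norm_lt/(_ _ e0).
      by apply: filterS => m /(le_lt_trans (ler_norm _))/ltW.
    apply: filter_forall => j; apply: filterS2 (small _ _) (small _ _).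
    - by move=> m; exact: conj.
    - by rewrite subr_gt0.
    - by rewrite subr_gt0.
  apply: filterS gap => m gap.
  rewrite W.
  - rewrite abseN.
    apply: (le_trans (le_abse_integral _ _ _)) => //.
      apply: measurable_funTS; apply/measurable_EFinP/measurable_funM => //.
      apply: measurable_tensor => j; rewrite /upd; case: ifP => _; exact: mcont.
    apply: ge0_le_integral_nonmeas => y _//=.
    rewrite lee_fin normrM; apply: ler_wpM2l => //; exact: PhiPsi.
  - by move=> j; rewrite /upd; case: ifP.
  - move=> j t; rewrite negb_and -!ltNge /upd; case: eqP => [->|_] H.
      apply/eqP; rewrite -normr_le0 (le_trans (u_le m t))//.
      rewrite (_ : (_ <= _ < _) = false) ?mulr0//; apply/negP => /andP[h1 h2].
      by have [_ h3] := gap i; case/orP: H; lra.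
    have [h3 _] := gap j; case/orP: H => H.
      by apply: cut_eq0_le; rewrite -/(M m); lra.
    by apply: cut_eq0_ge; have := cB j; lra.
(* The dominating constants: 2 because [v m] is a difference of two cutoffs, and [l + 1] below
   because [M m <= 1]. *)
have L1 := @cvg_integral_weights _ _ R mu K f (fun m => partial i (Phi m))
  (fun y => \1_(box c (fun j => c j + l)) y -
       \1_(box (upd c i (c i + d)) (fun j => upd c i (c i + d) j + l)) y) 2 mK.
have L2 := @cvg_integral_weights _ _ R mu K (fun y => `|g y|) Psi
  (fun y => l * \1_(box (upd c i lo) (upd (fun j => c j + l) i hi)) y) (l + 1) mK.
have X : (\int[mu]_(y in K)
    (`|g y| * (l * \1_(box (upd c i lo) (upd (fun j => c j + l) i hi)) y))%:E
   = l%:E * \int[mu]_(y in K)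
     (`|g y| * \1_(box (upd c i lo) (upd (fun j => c j + l) i hi)) y)%:E)%E.
  rewrite -ge0_integralZl//.
  - by apply: eq_integral => y _; rewrite -EFinM; congr EFin; ring.
  - apply: measurable_funTS; apply/measurable_EFinP; apply: measurable_funM.
      exact: measurableT_comp.
    by apply: measurable_indic; exact: measurable_box.
  - by rewrite lee_fin ltW.
rewrite -X; apply: (lee_cvg_to (cvg_abse (L1 _ _ _ _ _ _)) (L2 _ _ _ _ _ _) ineq) => //.
- move=> m; rewrite dPhi; apply: measurable_funTS; apply: measurable_tensor => j.
  by rewrite /upd; case: ifP => _; exact: mcont.
- apply: measurable_funTS; apply: measurable_funB;
    apply: measurable_indic; exact: measurable_box.
- move=> m y _; rewrite dPhi.
  apply: (le_trans (tensor_norm_le (C := upd (fun=> 1) i 2) _ _)).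
    move=> j t; rewrite /upd; case: ifP => // _.
    rewrite /v (le_trans (ler_normB _ _))// (_ : 2 = 1 + 1 :> R)// lerD//.
  by rewrite prod_upd1.
- move=> y _; under eq_fun do rewrite dPhi; rewrite !indic_box.
  rewrite (_ : _ - _ = tensor (upd (fun j t => ((c j <= t < c j + l)%R)%:R) i (fun t =>
      ((c i <= t < c i + l)%R)%:R - ((c i <= 1 * t + - d < c i + l)%R)%:R)) y).
    apply: cvg_tensor => j t; rewrite /upd; case: ifP => [_|_]; last exact: cvg_cut.
    by apply: cvgB; exact: cvg_cut.
  rewrite tensor_upd mulrBl; congr (_ - _).
    by rewrite /tensor (bigD1 i).
  rewrite /tensor (bigD1 i)//= /upd eqxx; congr (_ * _).
    by congr ((_ : bool)%:R); apply/idP/idP => /andP[h1 h2]; apply/andP; split; lra.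
  by apply: eq_bigr => j ji; rewrite (negbTE ji).
- by rewrite addr_ge0// ltW.
- apply: (eq_integrable _ (EFin \o (fun y => `|g y|))) => //.
  exact: integrable_norm intg.
- move=> m; apply: measurable_funTS; apply: measurable_funM => //.
  by apply: measurable_tensor => j; rewrite /upd; case: ifP => _ //; exact: mcont.
- apply: measurable_funTS; apply: measurable_funM => //.
  by apply: measurable_indic; exact: measurable_box.
- move=> m y _; rewrite /Psi normrM ger0_norm; last by rewrite addr_ge0// ltW.
  rewrite -[leRHS]mulr1; apply: ler_pM => //; first by rewrite addr_ge0// ltW.
    by rewrite lerD2l.
  apply: (le_trans (tensor_norm_le (C := fun=> 1) _ _)); last by rewrite big1.
  move=> j t; rewrite /upd; case: ifP => // _.
  by case: (_ <= _ < _); rewrite ?normr1 ?normr0.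
- move=> y _; rewrite indic_box; apply: cvgM.
    rewrite -[X in _ --> X]addr0; apply: cvgD; first exact: cvg_cst.
    exact: cvg_harmonic.
  have -> : (fun j t => ((upd c i lo j <= t < upd (fun j => c j + l) i hi j)%R)%:R) =
     upd (fun j t => ((c j <= t < c j + l)%R)%:R) i (fun t => ((lo <= t < hi)%R)%:R : R).
    by apply/funext => j; rewrite /upd; case: eqP.
  apply: cvg_tensor => j t; rewrite /upd; case: ifP => [_|_]; last exact: cvg_cut.
  have [tlo|lot] := ltP t lo; last first.
    apply: cvg_near_cst; apply: nearW => m; rewrite (_ : lo - M m <= t)//.
    by have := M0 m; lra.
  have lt0 : 0 < lo - t by rewrite subr_gt0.
  apply: cvg_near_cst; have := @cvg_harmonic R => /cvgr0_norm_lt/(_ _ lt0).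
  apply: filterS => m /(le_lt_trans (ler_norm _)) Mm.
  rewrite (_ : (lo - M m <= t) = false)//; apply/negbTE; rewrite -ltNge.
  by have Mm' : M m < lo - t by []; lra.
Qed.

End strip_inequality.

(** * A discrete Poincare inequality on a finite grid *)

Section grid_poincare.
Context {R : realFieldType} {n N : nat}.
Local Notation X := {ffun 'I_n -> 'I_N}.
Implicit Types (m : X) (i : 'I_n) (b : 'I_N).

Definition fupd m i b : X := [ffun j => if j == i then b else m j].

(** Exchanging [b] with the coordinate [m i] is an involution of the pairs, after which the summand
    no longer depends on [b]. *)
Lemma sum_fupd (W : X -> R) i :
  \sum_(m : X) \sum_(b < N) W (fupd m i b) = N%:R * \sum_(m : X) W m.
Proof.
rewrite pair_big/=; pose s (p : X * 'I_N) := (fupd p.1 i p.2, p.1 i).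
have sK : involutive s.
  move=> [m b]; rewrite /s/=; congr pair; last by rewrite ffunE eqxx.
  by apply/ffunP => j; rewrite !ffunE; case: eqP => // ->.
rewrite (reindex_inj (inv_inj sK))/=.
transitivity (\sum_(p : X * 'I_N) W p.1).
  apply: eq_bigr => -[m b] _ /=; congr W.
  by apply/ffunP => j; rewrite !ffunE; case: eqP => // ->.
rewrite -(pair_big predT predT (fun m (_ : 'I_N) => W m))/=.
rewrite mulr_sumr; apply: eq_bigr => m _.
by rewrite sumr_const card_ord mulr_natl.
Qed.

Definition hybrid (t : nat) m m' : X := [ffun j : 'I_n => if (j < t)%N then m' j else m j].

(** Exchanging the first [t] coordinates of [m] and [m'] is an involution of the pairs, so the
    intermediate points of the paths are equidistributed over the grid. *)
Lemma sum_hybrid (P : X -> R) t :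
  \sum_(m : X) \sum_(m' : X) P (hybrid t m m') = #|{: X}|%:R * \sum_(m : X) P m.
Proof.
rewrite pair_big/=; pose s (p : X * X) := (hybrid t p.1 p.2, hybrid t p.2 p.1).
have sK : involutive s.
  by move=> [m b]; rewrite /s/=; congr pair; apply/ffunP => j; rewrite !ffunE; case: (j < t)%N.
rewrite (reindex_inj (inv_inj sK))/=.
transitivity (\sum_(p : X * X) P p.1).
  apply: eq_bigr => -[m b] _ /=; congr P.
  by apply/ffunP => j; rewrite !ffunE; case: (j < t)%N.
rewrite -(pair_big predT predT (fun m (_ : X) => P m))/=.
rewrite mulr_sumr; apply: eq_bigr => m _.
by rewrite sumr_const mulr_natl.
Qed.

Lemma hybridS (i : 'I_n) m m' : hybrid i.+1 m m' = fupd (hybrid i m m') i (m' i).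
Proof.
apply/ffunP => j; rewrite !ffunE ltnS leq_eqVlt val_eqE.
by case: eqP => [->|].
Qed.

(* Two grid points are joined by changing one coordinate at a time. *)
Lemma grid_poincare (F : X -> R) (W : 'I_n -> X -> R) (l : R) :
  (forall m i b, `|F m - F (fupd m i b)| <= l * \sum_(b < N) W i (fupd m i b)) ->
  \sum_(m : X) \sum_(m' : X) `|F m - F m'| <=
    l * N%:R * #|{: X}|%:R * \sum_(i < n) \sum_(m : X) W i m.
Proof.
move=> FW; pose Z i m := \sum_(b < N) W i (fupd m i b).
apply: (@le_trans _ _ (\sum_(m : X) \sum_(m' : X) \sum_(i < n) l * Z i (hybrid i m m'))).
  apply: ler_sum => m _; apply: ler_sum => m' _.
  have -> : F m - F m' = \sum_(i < n) (F (hybrid i m m') - F (hybrid i.+1 m m')).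
    rewrite -(big_mkord xpredT (fun i : nat => F (hybrid i m m') - F (hybrid i.+1 m m'))).
    rewrite (eq_bigr (fun t : nat => - F (hybrid t.+1 m m') - - F (hybrid t m m')));
      last by move=> t _; rewrite opprK addrC.
    rewrite (telescope_sumr (fun t : nat => - F (hybrid t m m')))// opprK [RHS]addrC.
    congr (F _ - F _).
      by apply/ffunP => j; rewrite ffunE.
    by apply/ffunP => j; rewrite ffunE ltn_ord.
  apply: (le_trans (ler_norm_sum _ _ _)); apply: ler_sum => i _.
  by rewrite hybridS FW.
under eq_bigr do rewrite exchange_big/=.
rewrite exchange_big/= mulr_sumr; apply: ler_sum => i _.
under eq_bigr do rewrite -mulr_sumr.
rewrite -mulr_sumr sum_hybrid sum_fupd le_eqVlt; apply/orP; left; apply/eqP.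
by ring.
Qed.

Lemma grid_poincare_mean (F : X -> R) (W : 'I_n -> X -> R) (l : R) : (0 < N)%N ->
  (forall m i b, `|F m - F (fupd m i b)| <= l * \sum_(b < N) W i (fupd m i b)) ->
  \sum_(m : X) `|F m - (\sum_(m' : X) F m') / #|{: X}|%:R| <=
    l * N%:R * \sum_(i < n) \sum_(m : X) W i m.
Proof.
move=> N0 /grid_poincare H; set c : R := #|_|%:R in H *.
have c0 : 0 < c by rewrite ltr0n card_ffun expn_gt0 card_ord N0.
rewrite -(ler_pM2l c0); apply: le_trans (le_trans H _); last first.
  by rewrite le_eqVlt; apply/orP; left; apply/eqP; ring.
rewrite mulr_sumr; apply: ler_sum => m _.
rewrite -{1}(gtr0_norm c0) -normrM mulrBr mulrCA divff ?gt_eqF// mulr1.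
have -> : c * F m - \sum_(m' : X) F m' = \sum_(m' : X) (F m - F m').
  by rewrite sumrB sumr_const mulr_natl.
exact: ler_norm_sum.
Qed.

End grid_poincare.

(** * Subdivision of a cell *)

Section subcells.
Context {R : realType} {n : nat} (j l : nat) (k : {ffun 'I_n -> int}).
Local Notation mu := (@lebesgue_rV R n).
Local Notation X := {ffun 'I_n -> 'I_(2 ^ l)}.
Implicit Types (m : X) (i : 'I_n) (y : 'rV[R]_n).

Definition subindex m : {ffun 'I_n -> int} :=
  [ffun i => k i * (2 ^ l)%N%:Z + (m i : nat)%:Z].

Definition subcell m : set 'rV[R]_n := cell (j + l) (subindex m).

Lemma measurable_subcell m : measurable (subcell m).
Proof. exact: measurable_cell. Qed.

Lemma subindex_inj : injective subindex.
Proof.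
move=> m m' /ffunP H; apply/ffunP => i; have := H i; rewrite !ffunE => /addrI.
by case => mm; exact: val_inj.
Qed.

Lemma floor_subindex (q : int) (t : R) :
  q%:~R / 2 ^+ j <= t < (q + 1)%:~R / 2 ^+ j ->
  exists b : 'I_(2 ^ l), Num.floor (2 ^+ (j + l) * t) = q * (2 ^ l)%N%:Z + (b : nat)%:Z.
Proof.
have p0 : (0 : R) < 2 ^+ j by rewrite exprn_gt0.
rewrite ler_pdivrMr// ltr_pdivlMr// => /andP[h1 h2].
have l0 : (0 : R) < 2 ^+ l by rewrite exprn_gt0.
set F := Num.floor _.
have /andP[f1 f2] : F%:~R <= 2 ^+ (j + l) * t < (F + 1)%:~R by exact: floor_itv.
have e : ((2 ^ l)%N%:Z)%:~R = 2 ^+ l :> R by rewrite -pmulrn natrX.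
have g1 : (q * (2 ^ l)%N%:Z < F + 1)%R.
  rewrite -(ltr_int R) rmorphM/= e; apply: le_lt_trans f2.
  by rewrite exprD mulrC -mulrA [X in _ <= X]mulrCA ler_pM2l// mulrC.
have g2 : (F < (q + 1) * (2 ^ l)%N%:Z)%R.
  rewrite -(ltr_int R) rmorphM/= e; apply: (le_lt_trans f1).
  by rewrite exprD mulrC mulrA ltr_pM2r.
have g3 : (0 <= F - q * (2 ^ l)%N%:Z)%R by lia.
have [b bE] : exists b : nat, F - q * (2 ^ l)%N%:Z = b%:Z.
  by exists (absz (F - q * (2 ^ l)%N%:Z)%R); rewrite gez0_abs.
have bl : (b < 2 ^ l)%N by lia.
by exists (Ordinal bl) => /=; rewrite -bE; ring.
Qed.

Lemma subindex_itv m i :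
  (k i)%:~R / 2 ^+ j <= (subindex m i)%:~R / 2 ^+ (j + l) :> R /\
  (subindex m i)%:~R / 2 ^+ (j + l) + 2 ^- (j + l) <= (k i + 1)%:~R / 2 ^+ j :> R.
Proof.
have p0 : (0 : R) < 2 ^+ j by rewrite exprn_gt0.
have l0 : (0 : R) < 2 ^+ l by rewrite exprn_gt0.
have e : ((2 ^ l)%N%:Z)%:~R = 2 ^+ l :> R by rewrite -pmulrn natrX.
rewrite ffunE !rmorphD/= rmorphM/= e exprD invfM.
set b : R := (m i : nat)%:~R; set K : R := (k i)%:~R.
have b0 : 0 <= b by rewrite ler0z.
have b1 : b + 1 <= 2 ^+ l.
  by rewrite -e -[1]/(1%:~R) -intrD ler_int; have := ltn_ord (m i); lia.
have -> : (K * 2 ^+ l + b) * ((2 ^+ j)^-1 * (2 ^+ l)^-1) = K / 2 ^+ j + b / 2 ^+ l / 2 ^+ j.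
  by field; rewrite !gt_eqF.
split; first by rewrite lerDl !divr_ge0// ltW.
rewrite [leRHS]mulrDl -addrA lerD2l mul1r.
have -> : b / 2 ^+ l / 2 ^+ j + (2 ^+ j)^-1 * (2 ^+ l)^-1 = (b + 1) / 2 ^+ l * (2 ^+ j)^-1.
  by field; rewrite !gt_eqF.
by rewrite ler_piMl ?invr_ge0 ?(ltW p0)// ler_pdivrMr// mul1r.
Qed.

Lemma subcell_sub m : subcell m `<=` cell j k.
Proof.
move=> y /cellP H; apply/cellP => i; have /andP[h1 h2] := H i.
have [g1 g2] := subindex_itv m i; rewrite (le_trans g1)//=; apply: lt_le_trans g2.
by move: h2; rewrite rmorphD/= mulrDl mul1r.
Qed.

Lemma cell_subcells : cell j k = \big[setU/set0]_(m <- enum X) subcell m.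
Proof.
apply/seteqP; split => y; last by rewrite -bigcup_seq => -[m _]; exact: subcell_sub.
move=> /cellP H; rewrite -bigcup_seq.
have /choice[m mE] : forall i, exists b : 'I_(2 ^ l),
    Num.floor (2 ^+ (j + l) * y ord0 i) = k i * (2 ^ l)%N%:Z + (b : nat)%:Z.
  by move=> i; exact: floor_subindex.
exists [ffun i => m i]; first by rewrite /= mem_enum.
by apply/ffunP => i; rewrite !ffunE mE.
Qed.

Lemma trivIset_subcell : trivIset setT subcell.
Proof.
by move=> m m' _ _ [y [ym ym']]; apply: subindex_inj; exact: cell_disjoint ym ym'.
Qed.

Lemma Rintegral_subcells (h : 'rV[R]_n -> R) :
  mu.-integrable (cell j k) (EFin \o h) ->
  (\int[mu]_(y in cell j k) h y = \sum_(m : X) \int[mu]_(y in subcell m) h y)%R.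
Proof.
move=> ih; rewrite /Rintegral cell_subcells.
rewrite integral_bigsetU_EFin//=; last 4 first.
- by move=> m; exact: measurable_subcell.
- exact: enum_uniq.
- by apply: sub_trivIset trivIset_subcell.
- by rewrite -cell_subcells; exact: measurable_int ih.
rewrite -sum_fine; first by rewrite big_enum.
move=> m _; apply: integrable_fin_num => //; first exact: measurable_subcell.
apply: integrableS ih; [exact: measurable_cell|exact: measurable_subcell|].
exact: subcell_sub.
Qed.

Lemma subcell_box m : subcell m =
  box (fun i => (subindex m i)%:~R / 2 ^+ (j + l))
      (fun i => (subindex m i)%:~R / 2 ^+ (j + l) + 2 ^- (j + l)).
Proof.
rewrite /subcell cell_box; congr box; apply/funext => i.
by rewrite rmorphD/= mulrDl mul1r.
Qed.

(** The strip of [strip_inequality] is a row of subcells: [m] fixes all coordinates but the [i]-th,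
    which runs through the whole side of the cell. *)
Lemma strip_subcells m i :
  box (upd (fun i => (subindex m i)%:~R / 2 ^+ (j + l)) i ((k i)%:~R / 2 ^+ j))
      (upd (fun i => (subindex m i)%:~R / 2 ^+ (j + l) + 2 ^- (j + l)) i
         ((k i + 1)%:~R / 2 ^+ j)) `<=`
  \bigcup_(b in [set: 'I_(2 ^ l)]) subcell (fupd m i b).
Proof.
move=> y H; have := H i; rewrite /upd eqxx => /floor_subindex[b bE].
exists b => //; apply/ffunP => i'; rewrite !ffunE; case: eqP => [->//|/eqP ii'].
have := H i'; rewrite /upd (negbTE ii').
have -> : (subindex m i')%:~R / 2 ^+ (j + l) + 2 ^- (j + l) =
   (subindex m i' + 1)%:~R / 2 ^+ (j + l) :> R by rewrite rmorphD/= mulrDl mul1r.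
have p0 : (0 : R) < 2 ^+ (j + l) by rewrite exprn_gt0.
rewrite ler_pdivrMr// ltr_pdivlMr// => h; rewrite -[RHS]/(k i' * _ + _).
by apply/floor_def; rewrite mulrC ffunE in h *.
Qed.

End subcells.

(** * Approximation by unions of dyadic cells *)

Section dyadic_approximation.
Context {R : realType} {n : nat}.
Implicit Types (A G : set 'rV[R]_n) (l : nat).

Lemma measurable_setY A G : measurable A -> measurable G -> measurable (A `+` G).
Proof. by move=> mA mG; apply: measurableU; exact: measurableD. Qed.

Definition grid_set G := exists l (T : set {ffun 'I_n -> int}),
  G = dyadic_index l @^-1` T.

Lemma grid_set_refine l (T : set {ffun 'I_n -> int}) l' : (l <= l')%N ->
  exists T', (@dyadic_index R n l @^-1` T) = (@dyadic_index R n l' @^-1` T').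
Proof.
move=> ll'; exists [set k | exists2 y, @dyadic_index R n l' y = k & T (dyadic_index l y)].
apply/seteqP; split => [y Ty|y [z zy Tz]]; first by exists y.
by rewrite /preimage/= -(dyadic_index_le ll' zy).
Qed.

Lemma measurable_grid_set G : grid_set G -> measurable G.
Proof.
move=> [l [T ->]].
rewrite (_ : _ @^-1` _ = \bigcup_(k in T) cell l k).
  rewrite bigcup_mkcond; apply: countable_bigcupT_measurable => // k.
  by case: ifP => // _; exact: measurable_cell.
by apply/seteqP; split => [y Ty|y [k Tk ky]]; [exists (dyadic_index l y)|rewrite /preimage/= ky].
Qed.

Lemma grid_setC G : grid_set G -> grid_set (~` G).
Proof. by move=> [l [T ->]]; exists l, (~` T). Qed.

Lemma grid_setU G G' : grid_set G -> grid_set G' -> grid_set (G `|` G').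
Proof.
move=> [l [T ->]] [l' [T' ->]].
have [S ->] := grid_set_refine T (leq_maxl l l').
have [S' ->] := grid_set_refine T' (leq_maxr l l').
by exists (maxn l l'), (S `|` S').
Qed.

Section approximable.
Context (m : {measure set 'rV[R]_n -> \bar R}) (m_fin : (m setT < +oo)%E).

(** Meant for a good-sets argument: these sets form a sigma-algebra that contains the coordinate
    half-spaces, hence all Borel sets. *)
Definition approximable A := measurable A /\
  forall e : R, 0 < e -> exists2 G, grid_set G & (m (A `+` G) < e%:E)%E.

Lemma approximable_grid_set G : grid_set G -> approximable G.
Proof.
move=> gG; split; first exact: measurable_grid_set.
by move=> e e0; exists G => //; rewrite /setY setDv setU0 measure0 lte_fin.
Qed.

Lemma approximableC A : approximable A -> approximable (~` A).
Proof.
move=> [mA H]; split; first exact: measurableC.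
move=> e e0; have [G gG AG] := H e e0; exists (~` G); first exact: grid_setC.
by rewrite /setY !setDE !setCK setUC ![~` _ `&` _]setIC -!setDE.
Qed.

Lemma approximableU A B : approximable A -> approximable B -> approximable (A `|` B).
Proof.
move=> [mA HA] [mB HB]; split; first exact: measurableU.
move=> e e0; have e2 : 0 < e / 2 by rewrite divr_gt0.
have [G gG AG] := HA _ e2; have [H gH BH] := HB _ e2.
exists (G `|` H); first exact: grid_setU.
have mG := measurable_grid_set gG; have mH := measurable_grid_set gH.
apply: (@le_lt_trans _ _ (m ((A `+` G) `|` (B `+` H)))).
  apply: le_measure; rewrite ?inE.
  - by apply: measurable_setY; exact: measurableU.
  - by apply: measurableU; exact: measurable_setY.
  - by move=> x; rewrite /setY/=; tauto.
apply: (@le_lt_trans _ _ (m (A `+` G) + m (B `+` H))%E).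
  by apply: measureU2; exact: measurable_setY.
by rewrite [e in (_ < e%:E)%E]splitr EFinD lteD.
Qed.

(** Finite subunions exhaust the union up to small measure, by continuity from above; this is where
    [m_fin] enters. *)
Lemma approximable_bigcup (F : (set 'rV[R]_n)^nat) :
  (forall k, approximable (F k)) -> approximable (\bigcup_k F k).
Proof.
move=> HF; have mF k : measurable (F k) by have [] := HF k.
have mU : measurable (\bigcup_k F k) by exact: bigcupT_measurable.
pose B K := \big[setU/set0]_(k < K) F k.
have HB K : approximable (B K).
  elim: K => [|K IH]; last by rewrite /B big_ord_recr; exact: approximableU.
  rewrite /B big_ord0; apply: approximable_grid_set; exists 0%N, set0.
  by rewrite preimage_set0.
have mB K : measurable (B K) by have [] := HB K.
split=> // e e0; have e2 : 0 < e / 2 by rewrite divr_gt0.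
have [K UK] : exists K, (m (\bigcup_k F k `\` B K) < (e / 2)%:E)%E.
  have cv : (m \o (fun K => \bigcup_k F k `\` B K)) @ \oo --> m set0.
    have E : \bigcap_K (\bigcup_k F k `\` B K) = set0.
      apply/seteqP; split => // x H; have [[k _ Fk] _] := H 0%N I.
      have [_ nB] := H k.+1 I; apply: nB.
      by rewrite /B big_ord_recr/=; right.
    rewrite -E; apply: nonincreasing_cvg_mu.
    - apply: le_lt_trans m_fin; apply: le_measure; rewrite ?inE//.
      exact: measurableD.
    - by move=> K; exact: measurableD.
    - by rewrite E.
    - move=> K K' KK'; apply/subsetPset; apply: setDS.
      by apply: subset_bigsetU.
  rewrite measure0 in cv.
  have [K _ HK] : \forall K \near \oo, (m (\bigcup_k F k `\` B K) < (e / 2)%:E)%E.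
    by apply: (cv [set y | (y < (e / 2)%:E)%E]); exact: (@nbhs_open_ereal_lt _ 0 (fun=> e / 2)).
  by exists K; apply: HK => /=.
have [_ /(_ _ e2)[G gG BG]] := HB K; exists G => //.
have mG := measurable_grid_set gG.
apply: (@le_lt_trans _ _ (m ((\bigcup_k F k `\` B K) `|` (B K `+` G)))).
  apply: le_measure; rewrite ?inE.
  - exact: measurable_setY.
  - by apply: measurableU; [exact: measurableD|exact: measurable_setY].
  - have sB : B K `<=` \bigcup_k F k.
      by rewrite /B -bigcup_mkord; exact: bigcup_subset.
    move=> x; rewrite /setY/=; have := sB x.
    by case: (pselect (B K x)); tauto.
apply: (@le_lt_trans _ _ (m (\bigcup_k F k `\` B K) + m (B K `+` G))%E).
  by apply: measureU2; [exact: measurableD|exact: measurable_setY].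
by rewrite [e in (_ < e%:E)%E]splitr EFinD lteD.
Qed.

Lemma approximable_coord i (Y : set R) : measurable (Y : set (measurableTypeR R)) ->
  approximable (rV_coord i @^-1` Y).
Proof.
rewrite [X in X Y -> _](RGenInftyO.measurableE R); move: Y.
apply: smallest_sub.
  split=> [|B aB|F aF] /=.
  - by rewrite preimage_set0; apply: approximable_grid_set; exists 0%N, set0.
  - by rewrite setTD preimage_setC; exact: approximableC.
  - by rewrite preimage_bigcup; exact: approximable_bigcup.
move=> _ [x ->] /=.
(* A point whose [i]-th coordinate is below [x] lies, at a fine enough level, in a cell whose upper
   face is still at most [x]. *)
rewrite (_ : _ @^-1` _ = \bigcup_l (dyadic_index l @^-1`
    [set k : {ffun 'I_n -> int} | (k i + 1)%:~R / 2 ^+ l <= x])).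
  apply: approximable_bigcup => l; apply: approximable_grid_set.
  by exists l; eexists.
have p0 l : (0 : R) < 2 ^+ l by rewrite exprn_gt0.
apply/seteqP; split => y /=; rewrite in_itv/=; last first.
  move=> [l _ /=]; rewrite ffunE; apply: lt_le_trans.
  by rewrite ltr_pdivlMr// mulrC floorD1_gt.
rewrite -subr_gt0 => xy.
have [N /(_ N (leqnn N)) HN] := geometric_eventually_lt 1 (half_lt1 (R := R)) xy.
exists N => //=; rewrite ffunE ler_pdivrMr//.
move: HN; rewrite mul1r exprVn => HN.
have h : 1 < (x - y ord0 i) * 2 ^+ N by rewrite -ltr_pdivrMr// mul1r.
rewrite rmorphD/=; have := floor_le (2 ^+ N * y ord0 i).
by rewrite /rV_coord in h *; lra.
Qed.

Lemma measurable_approximable A : measurable A -> approximable A.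
Proof.
move: A; suff H : g_sigma_preimage (@rV_coord R n) `<=` approximable by exact: H.
apply: smallest_sub.
  split=> [|B aB|F aF] /=.
  - by apply: approximable_grid_set; exists 0%N, set0; rewrite preimage_set0.
  - by rewrite setTD; exact: approximableC.
  - exact: approximable_bigcup.
rewrite -bigcup_seq => B [i _ [Y mY <-]] /=; rewrite setTI.
exact: approximable_coord.
Qed.

End approximable.
End dyadic_approximation.

(** * Poincare inequality on a cell *)

Section cell_poincare.
Context {R : realType} {n : nat}.
Local Notation mu := (@lebesgue_rV R n).

(** Let [s] be 1 on a grid set [G] close to the set [P] where [h >= 0], and -1 off [G]. On the cell,
    the modulus of [h] is at most [h * s] plus twice that modulus on the symmetric difference [D].
    Summation over subcells bounds the first integral by [S], and absolute continuity makes the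
    second small. *)
Lemma integral_norm_le_of_subcells j k (h : 'rV[R]_n -> R) (S : R) :
  measurable_fun setT h -> mu.-integrable (cell j k) (EFin \o h) ->
  (forall l, \sum_(m : {ffun 'I_n -> 'I_(2 ^ l)})
     `|\int[mu]_(y in subcell j k m) h y| <= S) ->
  \int[mu]_(y in cell j k) `|h y| <= S.
Proof.
move=> mh ih HS; set Q := cell j k in ih *.
have mQ : measurable Q by exact: measurable_cell.
have iha : mu.-integrable Q (EFin \o (fun y => `|h y|)).
  exact: integrable_norm ih.
apply/ler_addgt0Pr => e e0.
have e2 : 0 < e / 2 by rewrite divr_gt0.
pose w := (EFin \o (fun y => `|h y|)) \_ Q.
have iw : mu.-integrable setT w by exact/(integrable_mkcond _ mQ).1.
have w0 y : (0 <= w y)%E by apply: erestrict_ge0 => z _; rewrite lee_fin.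
have [d d0 Hd] := integral_abs_continuous iw w0 e2.
pose P := [set y | 0 <= h y].
have mP : measurable P.
  rewrite (_ : P = h @^-1` `[0, +oo[); last first.
    by apply/seteqP; split => y; rewrite /P/= in_itv/= andbT.
  by rewrite -[X in measurable X]setTI; exact: mh.
(* The approximation needs a finite measure, so [mu] is restricted to [Q]. *)
have mT : (mrestr mu mQ setT < +oo)%E.
  by rewrite /mrestr setTI [X in (X < _)%E]lebesgue_cell ltry.
have [_ /(_ d d0)[G gG PG]] := measurable_approximable mT mP.
have mG := measurable_grid_set gG.
have {}PG : (\int[mu]_(y in (P `+` G) `&` Q) w y < (e / 2)%:E)%E.
  by apply: Hd => //; apply: measurableI => //; exact: measurable_setY.
set D := (P `+` G) `&` Q in PG.
have mD : measurable D by apply: measurableI => //; exact: measurable_setY.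
have [l0 [T0 GE]] := gG.
(* The grid is refined to level [j + l0], so that its cells inside [Q] are subcells of [Q]. *)
have [T GT] := grid_set_refine (R := R) T0 (leq_addl j l0).
rewrite GT in GE => {T0 GT}.
pose s y : R := if y \in G then 1 else -1.
have ms : measurable_fun setT s.
  rewrite (_ : s = fun y => \1_G y + (\1_G y - 1)).
    have mG1 : measurable_fun setT (\1_G : _ -> R) by exact: measurable_indic.
    by apply: measurable_funD => //; exact: measurable_funB.
  apply/funext => y; rewrite /s indicE; case: (y \in G) => /=; lra.
have s1 y : `|s y| = 1 by rewrite /s; case: ifP; rewrite ?normrN normr1.
have ihs : mu.-integrable Q (EFin \o (fun y => h y * s y)).
  apply: (le_integrable mQ _ _ ih).
    by apply: measurable_funTS; apply/measurable_EFinP; exact: measurable_funM.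
  by move=> y _; rewrite /= lee_fin normrM s1 mulr1.
have ihD : mu.-integrable Q (EFin \o (fun y => `|h y| * \1_D y)).
  apply: (le_integrable mQ _ _ ih).
    apply: measurable_funTS; apply/measurable_EFinP; apply: measurable_funM.
      exact: measurableT_comp.
    exact: measurable_indic.
  move=> y _; rewrite /= lee_fin normrM normr_id indicE.
  by case: (_ \in _); rewrite ?normr1 ?mulr1// normr0 mulr0.
have i2 : mu.-integrable Q (EFin \o (fun y => 2 * (`|h y| * \1_D y))).
  exact: (integrableZl mQ 2 ihD).
apply: (@le_trans _ _ (\int[mu]_(y in Q) (h y * s y + 2 * (`|h y| * \1_D y)))).
  apply: le_Rintegral => //.
    exact: (integrableD mQ ihs i2).
  move=> y Qy; rewrite indicE.
  case: (boolP (y \in D)) => yD.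
    by have := ler_norm (- (h y * s y)); rewrite normrN normrM s1 !mulr1; lra.
  rewrite mulr0 mulr0 addr0 /s.
  have nD : ~ ((P y /\ ~ G y) \/ (G y /\ ~ P y)).
    by move: yD; rewrite notin_setE /D /setY/= => H ?; apply: H.
  case: ifPn => [|]; rewrite ?inE ?notin_setE => Gy.
    have Py : P y by apply: contrapT => nP; apply: nD; right.
    by rewrite mulr1 ger0_norm.
  have nP : ~ P y by move=> Py; apply: nD; left.
  by rewrite mulrN1 ler0_norm// leNgt; apply/negP => /ltW.
rewrite RintegralD//.
rewrite RintegralZl//; apply: lerD.
  have -> : \int[mu]_(y in Q) (h y * s y) =
      \sum_(m : {ffun 'I_n -> 'I_(2 ^ l0)}) \int[mu]_(y in subcell j k m) (h y * s y).
    exact: (Rintegral_subcells l0 ihs).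
  apply: le_trans (HS l0); apply: ler_sum => m _.
  pose sm : R := if `[< T (subindex k m) >] then 1 else -1.
  rewrite (eq_Rintegral mu (g := fun y => h y * sm)); last first.
    move=> y; rewrite inE => ym; congr (_ * _); rewrite /s /sm.
    have E : (y \in G) = `[< T (subindex k m) >].
      by rewrite GE; apply/idP/asboolP; rewrite inE /preimage/= ym.
    by rewrite E.
  rewrite RintegralZr//; last 2 first.
  - exact: measurable_subcell.
  - apply: integrableS ih => //; [exact: measurable_subcell|exact: subcell_sub].
  apply: (le_trans (ler_norm _)); rewrite normrM.
  by rewrite /sm; case: ifP; rewrite ?normrN normr1 mulr1.
rewrite [leRHS](_ : e = 2 * (e / 2)); last by rewrite mulrCA divff// mulr1.
rewrite ler_pM2l// -lee_fin; apply: le_trans (ltW PG).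
rewrite /Rintegral fineK; last exact: integrable_fin_num.
rewrite integral_mkcond [leRHS]integral_mkcond le_eqVlt; apply/orP; left; apply/eqP.
apply: eq_integral => y _; rewrite !patchE /w patchE indicE.
case: (boolP (y \in Q)) => yQ; case: (boolP (y \in D)) => yD /=.
- by rewrite mulr1.
- by rewrite mulr0.
- by [].
- by [].
Qed.

Lemma integral_mul_indic (K A : set 'rV[R]_n) (h : 'rV[R]_n -> R) : A `<=` K ->
  (\int[mu]_(y in K) (h y * \1_A y)%:E = \int[mu]_(y in A) (h y)%:E)%E.
Proof.
move=> AK; rewrite integral_mkcond [RHS]integral_mkcond; apply: eq_integral => y _.
rewrite !patchE indicE; case: (boolP (y \in A)) => yA.
  by rewrite mem_set ?mulr1//; apply: AK; rewrite inE in yA.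
by case: ifP => // _; rewrite mulr0.
Qed.

(** At subdivision [l] each comparison costs a factor 2^(-j-l), and the grid inequality multiplies
    by 2^l. The product 2^(-j) is the same for every [l], as [integral_norm_le_of_subcells]
    demands. *)
Lemma cell_poincare j (k : {ffun 'I_n -> int}) (A B : 'I_n -> R) (f : 'rV[R]_n -> R)
    (g : 'I_n -> 'rV[R]_n -> R) :
  (forall i, A i < (k i)%:~R / 2 ^+ j) -> (forall i, (k i + 1)%:~R / 2 ^+ j <= B i) ->
  measurable_fun setT f -> (forall i, measurable_fun setT (g i)) ->
  mu.-integrable (cbox A B) (EFin \o f) ->
  (forall i, mu.-integrable (cbox A B) (EFin \o g i)) ->
  (forall i phi, (forall i, smooth (phi i)) ->
    (forall i t, ~~ (A i <= t <= B i) -> phi i t = 0) ->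
    (\int[mu]_(y in cbox A B) (f y * partial i (tensor phi) y)%:E =
    - \int[mu]_(y in cbox A B) (g i y * tensor phi y)%:E)%E) ->
  exists c : R, \int[mu]_(y in cell j k) `|f y - c| <=
    2 ^- j * \sum_(i < n) \int[mu]_(y in cell j k) `|g i y|.
Proof.
move=> Ak kB mf mg intf intg W; set K := cbox A B in intf intg W.
have mK : measurable K by exact: measurable_cbox.
set Q := cell j k; have mQ : measurable Q by exact: measurable_cell.
have QK : Q `<=` K.
  move=> y /cellP yQ i; have /andP[h1 h2] := yQ i; have := Ak i; have := kB i.
  by move=> h3 h4; apply/andP; split; lra.
have iQ h : mu.-integrable K h -> mu.-integrable Q h by exact: integrableS.
have ifQ := iQ _ intf.
(* The mean of [f] over the cell, so that the integral of [c] over a subcell is the average of the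
   numbers [F m']. *)
pose c := 2 ^+ (j * n) * \int[mu]_(y in Q) f y.
exists c.
have Qfin : (mu Q < +oo)%E by rewrite [X in (X < _)%E]lebesgue_cell ltry.
have icst (D : set 'rV[R]_n) :
    measurable D -> D `<=` Q -> mu.-integrable D (EFin \o (fun=> c)).
  move=> mD DQ; apply: (integrableS mQ mD DQ).
  apply/integrableP; split; first exact: measurable_cst.
  rewrite (_ : (fun y => _) = cst `|c|%:E)// integral_cst//.
  by rewrite lte_mul_pinfty.
apply: integral_norm_le_of_subcells => [||l].
- exact: measurable_funB.
- exact: (integrableB mQ ifQ (icst _ mQ (fun x Qx => Qx))).
set L := (j + l)%N; pose X := {ffun 'I_n -> 'I_(2 ^ l)}.
pose F (m : X) := \int[mu]_(y in subcell j k m) f y.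
pose G i (m : X) := \int[mu]_(y in subcell j k m) `|g i y|.
have msub (m : X) : measurable (subcell j k m : set 'rV[R]_n) by exact: measurable_subcell.
have subQ (m : X) : subcell j k m `<=` Q by exact: subcell_sub.
have isub (m : X) (h : 'rV[R]_n -> \bar R) :
    mu.-integrable K h -> mu.-integrable (subcell j k m) h.
  by move=> ih; apply: (integrableS mK (msub m)) ih; exact: subset_trans QK.
have cardX : #|{: X}| = (2 ^ (l * n))%N by rewrite card_ffun !card_ord expnM.
have FE m : \int[mu]_(y in subcell j k m) (f y - c) = F m - (\sum_(m' : X) F m') / #|{: X}|%:R.
  rewrite RintegralB//; last 2 first.
  - exact: isub.
  - exact: icst.
  congr (_ - _); rewrite Rintegral_cst//= [X in fine X]lebesgue_cell /=.
  rewrite /c (Rintegral_subcells l ifQ) cardX natrX mulrAC mulrC; congr (_ * _).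
  by rewrite mulnDl exprD invfM mulrA divff ?mul1r// expf_neq0.
under eq_bigr do rewrite FE.
have strip m i b : `|F m - F (fupd m i b)| <= 2 ^- L * \sum_(b' < 2 ^ l) G i (fupd m i b').
  pose c' i : R := (subindex k m i)%:~R / 2 ^+ L.
  (* The translation in direction [i] that takes subcell [m] to subcell [fupd m i b]. *)
  pose d : R := ((b : nat)%:R - (m i : nat)%:R) / 2 ^+ L.
  have c'd : c' i + d = (subindex k (fupd m i b) i)%:~R / 2 ^+ L.
    by rewrite /c' /d !ffunE eqxx !rmorphD/= -!pmulrn; ring.
  have itv (m' : X) i' := @subindex_itv R n j l k m' i'.
  have := @strip_inequality R n A B c' i (2 ^- L) d ((k i)%:~R / 2 ^+ j)
    ((k i + 1)%:~R / 2 ^+ j) f (g i) (half_gt0 _) mf (mg i) intf (intg i) (W i).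
  have [h1 h2] := itv m i; have [h3 h4] := itv (fupd m i b) i.
  rewrite -/L -c'd in h3 h4; rewrite -/L -/(c' i) in h1 h2.
  move=> /(_ _ _ (Ak i) (kB i) h1 h3 h2 h4).
  have Ac' i' : A i' < c' i' by apply: lt_le_trans (Ak i') _; have [] := itv m i'.
  have c'B i' : c' i' + 2 ^- L <= B i'.
    by apply: le_trans (kB i'); have [] := itv m i'.
  move=> /(_ Ac' c'B).
  have -> : box c' (fun i => c' i + 2 ^- L) = subcell j k m by rewrite subcell_box.
  have -> : box (upd c' i (c' i + d)) (fun i' => upd c' i (c' i + d) i' + 2 ^- L) =
      subcell j k (fupd m i b).
    have E : upd c' i (c' i + d) = fun i' => (subindex k (fupd m i b) i')%:~R / 2 ^+ L.
      apply/funext => i'; rewrite /upd; case: eqP => [->//|/eqP ii'].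
      by rewrite /c' !ffunE (negbTE ii').
    by rewrite E subcell_box.
  have -> : (\int[mu]_(y in K) (f y * (\1_(subcell j k m) y -
      \1_(subcell j k (fupd m i b)) y))%:E = (F m - F (fupd m i b))%:E)%E.
    have si (m' : X) : (\int[mu]_(y in K) (f y * \1_(subcell j k m') y)%:E = (F m')%:E)%E.
      rewrite integral_mul_indic; last by apply: subset_trans QK; exact: subQ.
      by rewrite /F /Rintegral fineK//; apply: integrable_fin_num => //; exact: isub.
    have ii (m' : X) : mu.-integrable K (EFin \o (fun y => f y * \1_(subcell j k m') y)).
      apply: (le_integrable mK _ _ intf).
        by apply: measurable_funTS; apply/measurable_EFinP; apply: measurable_funM.
      move=> y _; rewrite /= lee_fin normrM indicE.
      by case: (_ \in _); rewrite ?normr1 ?mulr1// normr0 mulr0.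
    under eq_integral do rewrite mulrBr.
    by rewrite integralB_EFin// !si.
  rewrite /= => H; rewrite -lee_fin; apply: (le_trans H); rewrite EFinM.
  apply: lee_wpmul2l; first by rewrite lee_fin ltW// half_gt0.
  apply: (@le_trans _ _ (\int[mu]_(y in K) \sum_(b' < 2 ^ l)
      (`|g i y| * \1_(subcell j k (fupd m i b')) y)%:E)%E).
    apply: ge0_le_integral_nonmeas => y _; first by rewrite lee_fin mulr_ge0.
    rewrite indicE; case: (boolP (y \in _)) => [|_]; last first.
      by rewrite mulr0; apply: sume_ge0 => b' _; rewrite lee_fin mulr_ge0.
    rewrite inE => /strip_subcells[b' _ yb']; rewrite (bigD1 b')//= indicE mem_set//.
    by rewrite leeDl//; apply: sume_ge0 => b'' _; rewrite lee_fin mulr_ge0.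
  rewrite ge0_integral_sum//; last first.
    move=> b'; apply: measurable_funTS; apply/measurable_EFinP; apply: measurable_funM.
      exact: measurableT_comp.
    by apply: measurable_indic; exact: msub.
  rewrite -sumEFin le_eqVlt; apply/orP; left; apply/eqP; apply: eq_bigr => b' _.
  rewrite integral_mul_indic; last by apply: subset_trans QK; exact: subQ.
  rewrite /G /Rintegral fineK//; apply: integrable_fin_num => //; apply: isub.
  exact: integrable_norm (intg i).
apply: (le_trans (grid_poincare_mean _ strip)); first by rewrite expn_gt0.
rewrite le_eqVlt; apply/orP; left; apply/eqP; congr (_ * _).
  by rewrite /L exprD invfM natrX -mulrA mulVf ?mulr1// expf_neq0.
apply: eq_bigr => i _; rewrite /G -Rintegral_subcells//.
apply: iQ; exact: integrable_norm (intg i).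
Qed.

End cell_poincare.

(** * Weak gradients *)

Section weak_gradient_oscillation.
Context {R : realType} {n : nat}.
Local Notation mu := (@lebesgue_rV R n).
Implicit Types (f : 'rV[R]_n -> R) (G : 'rV[R]_n -> 'rV[R]_n) (x : 'rV[R]_n)
  (Omega N : set 'rV[R]_n).

Lemma integrable_Borel_core Omega N (K : set 'rV[R]_n) f : measurable N -> mu N = 0%E ->
  measurable_fun setT (f \_ (Omega `\` N)) -> locally_integrable_on Omega f ->
  measurable K -> compact K -> K `<=` Omega ->
  mu.-integrable K (EFin \o (f \_ (Omega `\` N))).
Proof.
move=> mN N0 mf [_ lf] mK cK KO; apply/integrableP; split.
  by apply: measurable_funTS; exact/measurable_EFinP.
apply: le_lt_trans (lf K cK KO); rewrite le_eqVlt; apply/orP; left; apply/eqP.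
apply: (integral_off_null mN N0) => y Ny.
rewrite [LHS]patchE [RHS]patchE; case: ifPn => //; rewrite inE => /KO Oy.
by rewrite /= patchE mem_set.
Qed.

Lemma weak_gradient_oscillation Omega N f G x : open Omega ->
  measurable N -> mu N = 0%E -> weak_gradient Omega f G ->
  measurable_fun setT (f \_ (Omega `\` N)) ->
  (forall i, measurable_fun setT ((fun y => G y ord0 i) \_ (Omega `\` N))) ->
  Omega x -> \forall j \near \oo, exists c : R,
    (\int[mu]_(y in cell j (dyadic_index j x)) `|(f \_ (Omega `\` N)) y - c|%:E <=
     (2 ^- j)%:E * \sum_(i < n) \int[mu]_(y in cell j (dyadic_index j x))
        `|((fun y => G y ord0 i) \_ (Omega `\` N)) y|%:E)%E.
Proof.
move=> oO mN N0 [lf lG W] mfB mGB Ox.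
apply: filterS (near_small_cube 2 oO Ox) => j jO.
set k := dyadic_index j x; set Q := cell j k.
have mQ : measurable Q by exact: measurable_cell.
(* The box exceeds the cell by one side length on the left, the strict room asked for by
   [cell_poincare]; hence the factor 2 in [near_small_cube]. *)
pose A i : R := (k i)%:~R / 2 ^+ j - 2 ^- j.
pose B i : R := (k i + 1)%:~R / 2 ^+ j.
have h0 : 0 < 2 ^- j :> R by exact: half_gt0.
have BE i : B i = (k i)%:~R / 2 ^+ j + 2 ^- j by rewrite /B rmorphD/= mulrDl mul1r.
have KO : cbox A B `<=` Omega.
  apply: subset_trans jO => y Ky i; have /andP[y1 y2] := Ky i.
  have /cellP/(_ i)/andP[x1 x2] := cell_dyadic_index j x.
  move: y1 y2 x1 x2; rewrite -/k -/(B i) BE /A ler_norml => y1 y2 x1 x2.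
  by apply/andP; split; lra.
have mK : measurable (cbox A B) by exact: measurable_cbox.
have cK := @compact_cbox R n A B.
have ifB := integrable_Borel_core mN N0 mfB lf mK cK KO.
have iGB i := integrable_Borel_core mN N0 (mGB i) (lG i) mK cK KO.
have QK : Q `<=` cbox A B.
  move=> y /cellP yQ i; have /andP[h1 h2] := yQ i; apply/andP; split.
    by apply: le_trans h1; rewrite /A; lra.
  exact: ltW h2.
have [|||c Hc] := @cell_poincare R n j k A B _
    (fun i => (fun y => G y ord0 i) \_ (Omega `\` N)) _ _ mfB mGB ifB iGB.
- by move=> i; rewrite /A; lra.
- by [].
- move=> i phi sphi phi0.
  have := W i _ (test_function_tensor sphi phi0 KO).
  (* Since [v] vanishes off the box, the identity passes from [u] on [Omega] to the Borel version of
     [u] on the box. *)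
  have E (u v : 'rV[R]_n -> R) : (forall y, ~ cbox A B y -> v y = 0) ->
      (\int[mu]_(y in Omega) (u y * v y)%:E =
       \int[mu]_(y in cbox A B) ((u \_ (Omega `\` N)) y * v y)%:E)%E.
    move=> v0; apply: (integral_off_null mN N0) => y Ny.
    rewrite [LHS]patchE [RHS]patchE; case: (boolP (y \in cbox A B)) => yK.
      have Oy : Omega y by apply: KO; rewrite inE in yK.
      by rewrite mem_set//= patchE mem_set.
    rewrite notin_setE in yK; case: ifP => // _.
    by rewrite v0// mulr0.
  rewrite (E f) ?(E (fun y => G y ord0 i))//.
    by move=> y; exact: tensor_eq0 phi0.
  by move=> y; exact: partial_tensor_eq0 phi0.
exists c; move: Hc; rewrite -lee_fin EFinM -sumEFin.
have icst : mu.-integrable Q (EFin \o (fun=> c)).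
  apply/integrableP; split; first exact: measurable_cst.
  rewrite (_ : (fun y => _) = cst `|c|%:E)// integral_cst//.
  by rewrite lte_mul_pinfty// [X in (X < _)%E]lebesgue_cell ltry.
have iQ h : mu.-integrable (cbox A B) h -> mu.-integrable Q h by exact: integrableS.
have fE (h : 'rV[R]_n -> R) : mu.-integrable Q (EFin \o h) ->
    (\int[mu]_(y in Q) `|h y|)%:E = (\int[mu]_(y in Q) `|h y|%:E)%E.
  move=> ih; rewrite /Rintegral fineK//; apply: integrable_fin_num => //.
  exact: integrable_norm ih.
rewrite (fE (fun y => (f \_ (Omega `\` N)) y - c)); last first.
  exact: (integrableB mQ (iQ _ ifB) icst).
rewrite (eq_bigr (fun i => \int[mu]_(y in Q)
  `|((fun y => G y ord0 i) \_ (Omega `\` N)) y|%:E)%E) => [//|i _].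
exact: fE (iQ _ (iGB i)).
Qed.

Definition Borel_gradient Omega N G (y : 'rV[R]_n) : 'rV[R]_n :=
  \row_i ((fun z => G z ord0 i) \_ (Omega `\` N)) y.

Lemma Borel_gradientE Omega N G y :
  Borel_gradient Omega N G y = if y \in Omega `\` N then G y else 0.
Proof.
by apply/rowP => i; rewrite mxE patchE; case: ifP => _ //; rewrite mxE.
Qed.

Lemma measurable_Borel_gradient Omega N G :
  (forall i, measurable_fun setT ((fun y => G y ord0 i) \_ (Omega `\` N))) ->
  measurable_fun setT (Borel_gradient Omega N G).
Proof.
move=> mG; apply: measurable_to_rV => i.
suff -> : rV_coord i \o Borel_gradient Omega N G =
  (fun y => G y ord0 i) \_ (Omega `\` N) by exact: mG.
by apply: funext => y; rewrite /rV_coord/= mxE.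
Qed.

(** The level in [integral_le_of_integral_powR] is (M / a)^(1/q), with [a] the volume of the cell;
    this is where the factor 2 arises. The factor [n] comes from bounding each component of the
    gradient by its norm. *)
Lemma sobolev1_oscillation Omega N f G (q : R) x : open Omega -> 1 <= q ->
  measurable N -> mu N = 0%E -> weak_gradient Omega f G ->
  measurable_fun setT (f \_ (Omega `\` N)) ->
  (forall i, measurable_fun setT ((fun y => G y ord0 i) \_ (Omega `\` N))) ->
  Omega x -> \forall j \near \oo, forall M : R, 0 < M ->
    (\int[mu]_(y in cell j (dyadic_index j x))
       (enorm (Borel_gradient Omega N G y) `^ q)%:E < M%:E)%E ->
    (exists c : R,
      \int[mu]_(y in cell j (dyadic_index j x)) `|(f \_ (Omega `\` N)) y - c|%:E <=
      (2 ^- (j * n) * (2 * n%:R * (2 ^- j) `^ (1 - n%:R * q^-1) * M `^ q^-1))%:E)%E.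
Proof.
move=> oO q1 mN N0 wG mfB mGB Ox.
apply: filterS (weak_gradient_oscillation oO mN N0 wG mfB mGB Ox) => j [c Hc] M M0.
set Q := cell j _ in Hc * => HM; exists c; apply: (le_trans Hc).
have mQ : measurable Q by exact: measurable_cell.
have q0 : 0 < q by exact: lt_le_trans q1.
set a : R := 2 ^- (j * n).
have a0 : 0 < a by exact: half_gt0.
have muQ : mu Q = a%:E by rewrite lebesgue_cell.
have Ma : 0 < M / a by rewrite divr_gt0.
have lam0 : 0 < (M / a) `^ q^-1 by rewrite powR_gt0.
have He : (\int[mu]_(y in Q) (enorm (Borel_gradient Omega N G y))%:E <=
    (2 * a * (M / a) `^ q^-1)%:E)%E.
  apply: (integral_le_of_integral_powR mQ _ _ q1 lam0 muQ).
  - by apply: measurable_funTS; apply: measurable_enorm; exact: measurable_Borel_gradient.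
  - by move=> y; exact: enorm_ge0.
  - apply: (le_trans (ltW HM)); rewrite lee_fin -powRrM mulVf ?gt_eqF//.
    by rewrite powRr1 ?(ltW Ma)// mulrC divfK// gt_eqF.
apply: (@le_trans _ _ ((2 ^- j)%:E * \sum_(i < n) (2 * a * (M / a) `^ q^-1)%:E)%E).
  apply: lee_wpmul2l; first by rewrite lee_fin ltW// half_gt0.
  apply: lee_sum => i _; apply: le_trans He; apply: ge0_le_integral_nonmeas => y _.
    by rewrite lee_fin.
  by rewrite lee_fin; have := le_coord_enorm (Borel_gradient Omega N G y) i; rewrite mxE.
rewrite sumEFin -EFinM lee_fin sumr_const card_ord le_eqVlt; apply/orP; left; apply/eqP.
have h0 := ltW (half_gt0 (R := R) j).
have aE : a = (2 ^- j) `^ n%:R by rewrite powR_mulrn// exprVn -exprM.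
have -> : (M / a) `^ q^-1 = M `^ q^-1 * (2 ^- j) `^ (- (n%:R * q^-1)).
  rewrite powRM ?(ltW M0)//; last by rewrite invr_ge0 ltW.
  by rewrite {1}aE -powRN -powRrM mulNr.
rewrite powRD; last by apply/implyP => _; rewrite gt_eqF// half_gt0.
by rewrite powRr1// -mulr_natl; ring.
Qed.

Lemma sobolev1_oscillation_bounded Omega N f G (L : R) x : open Omega -> 0 <= L ->
  measurable N -> mu N = 0%E -> weak_gradient Omega f G ->
  measurable_fun setT (f \_ (Omega `\` N)) ->
  (forall i, measurable_fun setT ((fun y => G y ord0 i) \_ (Omega `\` N))) ->
  (forall y, enorm (Borel_gradient Omega N G y) <= L) ->
  Omega x -> \forall j \near \oo, forall M : R, 0 < M ->
    (exists c : R,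
      \int[mu]_(y in cell j (dyadic_index j x)) `|(f \_ (Omega `\` N)) y - c|%:E <=
      (2 ^- (j * n) * (n%:R * L * (2 ^- j) `^ (1 - n%:R * 0) * M `^ 0))%:E)%E.
Proof.
move=> oO L0 mN N0 wG mfB mGB GL Ox.
apply: filterS (weak_gradient_oscillation oO mN N0 wG mfB mGB Ox) => j [c Hc] M M0.
set Q := cell j _ in Hc *; exists c; apply: (le_trans Hc).
have mQ : measurable Q by exact: measurable_cell.
set a : R := 2 ^- (j * n).
have muQ : mu Q = a%:E by rewrite lebesgue_cell.
have h0 := ltW (half_gt0 (R := R) j).
apply: (@le_trans _ _ ((2 ^- j)%:E * \sum_(i < n) (L * a)%:E)%E).
  apply: lee_wpmul2l; first by rewrite lee_fin ltW// half_gt0.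
  apply: lee_sum => i _; rewrite EFinM -muQ -integral_cst//.
  apply: ge0_le_integral_nonmeas => y _; first by rewrite lee_fin.
  rewrite lee_fin (le_trans _ (GL y))//.
  by have := le_coord_enorm (Borel_gradient Omega N G y) i; rewrite mxE.
rewrite sumEFin -EFinM lee_fin sumr_const card_ord le_eqVlt; apply/orP; left; apply/eqP.
by rewrite powRr0 mulr0 subr0 powRr1// -mulr_natl; ring.
Qed.

End weak_gradient_oscillation.

(** * Common null sets and consequences of finite norms *)

Section sobolev_cores.
Context {R : realType} {n : nat}.
Local Notation mu := (@lebesgue_rV R n).
Implicit Types (f : 'rV[R]_n -> R) (G : 'rV[R]_n -> 'rV[R]_n) (Omega N : set 'rV[R]_n).

(** One null set serves [f] and all components of [G]. It absorbs a prescribed [N'] so that, for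
    [p = +oo], the essential bound of the gradient holds at every point of [Omega] off [N]. *)
Lemma weak_gradient_core Omega f G (N' : set 'rV[R]_n) :
  lebesgue_measurable_fun Omega f -> weak_gradient Omega f G ->
  measurable N' -> mu N' = 0%E ->
  exists N, [/\ N' `<=` N, measurable N /\ mu N = 0%E, measurable (Omega `\` N),
    measurable_fun setT (f \_ (Omega `\` N)) &
    forall i, measurable_fun setT ((fun y => G y ord0 i) \_ (Omega `\` N))].
Proof.
move=> mf [_ lG _] mN' N'0; have [N0 [mN0 N00] H0] := completed_Borel_core mf.
have /choice[NG HG] : forall i : 'I_n, exists M, (measurable M /\ mu M = 0%E) /\
    forall N, M `<=` N -> measurable N -> measurable (Omega `\` N) /\
      measurable_fun setT ((fun y => G y ord0 i) \_ (Omega `\` N)).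
  by move=> i; have [M M0 HM] := completed_Borel_core (lG i).1; exists M.
(* The finite family is extended to [nat] by empty sets in order to use countable unions. *)
pose F k : set 'rV[R]_n := if insub k is Some i then NG i else set0.
have mF k : measurable (F k) /\ mu (F k) = 0%E.
  rewrite /F; case: insubP => [i _ _|_]; first by have [] := HG i.
  by split => //; exact: measure0.
have mUF : measurable (\bigcup_k F k) by apply: bigcupT_measurable => k; have [] := mF k.
have FG i : NG i `<=` \bigcup_k F k.
  by move=> y yi; exists (val i) => //; rewrite /F valK.
exists (N' `|` (N0 `|` \bigcup_k F k)).
have mN : measurable (N' `|` (N0 `|` \bigcup_k F k)).
  by apply: measurableU => //; exact: measurableU.
split=> [y|||| i].
- by left.
- split=> //; apply/negligibleP => //; apply: negligibleU; first exact/negligibleP.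
  apply: negligibleU; first exact/negligibleP.
  by apply: negligible_bigcup => k; have [? ?] := mF k; exact/negligibleP.
- by apply: (H0 _ _ mN).1 => y yN; right; left.
- by apply: (H0 _ _ mN).2 => y yN; right; left.
- by apply: ((HG i).2 _ _ mN).2 => y /FG yN; right; right.
Qed.

Lemma Lnorm_on_lty Omega (q : R) (h : 'rV[R]_n -> R) : 1 <= q ->
  (Lnorm_on Omega q%:E h < +oo)%E ->
  (\int[mu]_(y in Omega) (`|h y| `^ q)%:E < +oo)%E.
Proof.
move=> q1; have q0 : 0 < q by exact: lt_le_trans q1.
rewrite /Lnorm_on unlock /Lnorm => /lty_poweRy; rewrite invr_eq0 gt_eqF// => /(_ isT).
apply: le_lt_trans; rewrite le_eqVlt; apply/orP; left; apply/eqP.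
rewrite [LHS]integral_mkcond.
apply: eq_integral => y _; rewrite /= !patchE; case: ifP => // _.
by rewrite /= normr0 powR0// gt_eqF.
Qed.

(** The norm at [p = +oo] is defined by cases on this inequality. *)
Lemma lebesgue_rV_setT_gt0 : (0 < mu setT)%E.
Proof.
apply: (@lt_le_trans _ _ (mu (cell 0 [ffun=> 0%R]))).
  by rewrite lebesgue_cell lte_fin half_gt0.
by apply: le_measure; rewrite ?inE//; exact: measurable_cell.
Qed.

Lemma Lnorm_on_y_bound Omega (h : 'rV[R]_n -> R) :
  (Lnorm_on Omega +oo h < +oo)%E ->
  exists2 L : R, 0 <= L & exists N, [/\ measurable N, mu N = 0%E &
    forall y, Omega y -> ~ N y -> `|h y| <= L].
Proof.
rewrite /Lnorm_on unlock /Lnorm lebesgue_rV_setT_gt0; set e := ess_sup _ _ => eoo.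
have [N [mN N0 HN]] : \forall y \ae mu, ((abse \o (EFin \o h \_ Omega)) y <= e)%E.
  exact: ess_sup_ge.
(* The maximum with 0 gives a finite bound without a discussion of the value [-oo]. *)
have m0 : (0 <= maxe 0 e)%E by rewrite le_max lexx.
have mfin : maxe 0%E e \is a fin_num by rewrite ge0_fin_numE// gt_max ltry.
exists (fine (maxe 0%E e)); first exact: fine_ge0.
exists N; split=> // y Oy Ny; rewrite -lee_fin fineK// le_max; apply/orP; right.
apply: contrapT => H; apply: Ny; apply: HN => /=.
by rewrite patchE mem_set.
Qed.

Lemma enorm0 : enorm (0 : 'rV[R]_n) = 0.
Proof. by rewrite /enorm big1 ?sqrtr0// => i _; rewrite mxE expr0n. Qed.

End sobolev_cores.

Theorem theorem1p1 (R : realType) (n : nat) (Omega : set 'rV[R]_n)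
    (sigma alpha : R) (p : \bar R) (f : 'rV[R]_n -> R)
    (n_ge1 : (1 <= n)%N) (Omega_open : open Omega)
    (sigma_gt0 : 0 < sigma) (sigma_le1 : sigma <= 1)
    (p_ge1 : (1 <= p)%E) (alpha_gt0 : 0 < alpha)
    (f_sobolev : sobolev_space Omega sigma p f)
    (f_int : (\int[@lebesgue_rV R n]_(x in Omega) neg_pow alpha f x < +oo)%E) :
  hausdorff (maxr 0 (n%:R - sigma * harmonic_exponent p alpha))
    (lebesgue_zero_set Omega f) = 0%E.
Proof.
have [mf fnorm] := f_sobolev.
have fsemi : (sobolev_seminorm Omega sigma p f < +oo)%E.
  by apply: le_lt_trans fnorm; rewrite leeDr// Lnorm_ge0.
(* With [theta] equal to [q^-1], or to 0, the exponent takes the uniform shape used in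
   [hausdorff_lebesgue_zero_set]. *)
have harm_fin (q : R) : 1 <= q ->
    harmonic_exponent q%:E alpha = alpha / (1 + alpha * q^-1).
  move=> q1; have q0 : 0 < q by exact: lt_le_trans q1.
  by rewrite /=; field; rewrite !gt_eqF// ?addr_gt0.
have harm_oo : harmonic_exponent +oo%E alpha = alpha / (1 + alpha * 0).
  by rewrite mulr0 addr0 divr1.
have m0 : measurable_fun [set: 'rV[R]_n] (fun=> 0%E : \bar R) by exact: measurable_cst.
have i0 : (\int[@lebesgue_rV R n]_x (fun=> 0%E : \bar R) x < +oo)%E.
  by rewrite integral0_eq.
move: fsemi; rewrite /sobolev_seminorm; have [s1|s1] := eqVneq sigma 1.
  (* A finite infimum yields a weak gradient [G] of finite norm. *)
  move=> /ereal_inf_lt[_ [G wG <-]] GL.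
  case: p p_ge1 {f_sobolev fnorm} GL => [q q1 GL|_ GL|//].
    rewrite lee_fin in q1; have q0 : 0 < q by exact: lt_le_trans q1.
    have [N [_ [mN N0] mON mfB mGB]] := weak_gradient_core mf wG measurable0 (measure0 _).
    pose g y := (enorm (Borel_gradient Omega N G y) `^ q)%:E.
    apply: (@hausdorff_lebesgue_zero_set _ _ Omega N f g sigma alpha q^-1 (2 * n%:R)) => //.
    - by rewrite invr_ge0 ltW.
    - by rewrite harm_fin.
    - apply/measurable_EFinP; apply: (measurableT_comp (measurable_powR _)).
      by apply: measurable_enorm; exact: measurable_Borel_gradient.
    - by move=> y; rewrite lee_fin powR_ge0.
    - apply: le_lt_trans (Lnorm_on_lty q1 GL); rewrite le_eqVlt; apply/orP; left; apply/eqP.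
      apply: (integral_off_null mN N0) => y Ny; rewrite [RHS]patchE patch_setT /g.
      rewrite Borel_gradientE; case: ifPn => [|yO].
        by rewrite inE => -[Oy _]; rewrite mem_set// ger0_norm// enorm_ge0.
      rewrite memNset => [|Oy]; last by move/negP: yO; apply; rewrite inE.
      by rewrite enorm0 powR0// gt_eqF.
    - by move=> x Ox; rewrite s1; exact: sobolev1_oscillation.
  have [L L0 [N' [mN' N'0 GN']]] := Lnorm_on_y_bound GL.
  have [N [N'N [mN N0] mON mfB mGB]] := weak_gradient_core mf wG mN' N'0.
  apply: (@hausdorff_lebesgue_zero_set _ _ Omega N f (fun=> 0%E) sigma alpha 0 (n%:R * L)) => //.
  - by rewrite mulr_ge0.
  - by rewrite harm_oo.
  - move=> x Ox; rewrite s1.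
    have GB y : enorm (Borel_gradient Omega N G y) <= L.
      rewrite Borel_gradientE; case: ifPn => [|_]; last by rewrite enorm0.
      rewrite inE => -[Oy /= Ny]; have := GN' y Oy; rewrite ger0_norm ?enorm_ge0//.
      by apply => /N'N.
    have := sobolev1_oscillation_bounded Omega_open L0 mN N0 wG mfB mGB GB Ox.
    by apply: filterS => j Hj M M0 _; exact: Hj.
have [N [mN N0] core] := completed_Borel_core mf.
have [mON mfB] := core N (fun _ h => h) mN.
case: p p_ge1 {f_sobolev fnorm} => [q q1|_|//].
  rewrite lee_fin in q1; have q0 : 0 < q by exact: lt_le_trans q1.
  rewrite /gagliardo_seminorm => /lty_poweRy; rewrite invr_eq0 gt_eqF// => /(_ isT) gag.
  pose g := gagliardo_density (Omega `\` N) sigma q (f \_ (Omega `\` N)).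
  apply: (@hausdorff_lebesgue_zero_set _ _ Omega N f g sigma alpha q^-1
    (2 * n%:R `^ (sigma + n%:R / q))) => //.
  - by rewrite invr_ge0 ltW.
  - by rewrite harm_fin.
  - exact: measurable_gagliardo_density.
  - by move=> y; exact: gagliardo_density_ge0.
  - by rewrite integral_gagliardo_density.
  - by move=> x Ox; exact: gagliardo_oscillation.
rewrite /holder_seminorm; set S := maxe _ _ => Soo.
have S0 : (0 <= S)%E by rewrite le_max lexx.
have Sfin : S \is a fin_num by rewrite ge0_fin_numE.
(* The supremum runs over distinct points, so the diagonal is treated apart. *)
have fL y z : Omega y -> Omega z -> `|f y - f z| <= fine S * enorm (y - z) `^ sigma.
  move=> Oy Oz; have [->|yz] := eqVneq y z.
    by rewrite subrr normr0 mulr_ge0 ?powR_ge0// fine_ge0.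
  have d0 : 0 < enorm (y - z) `^ sigma.
    rewrite powR_gt0// lt_def enorm_ge0 andbT; apply: contraNneq yz => /enorm_eq0/eqP.
    by rewrite subr_eq0.
  rewrite -ler_pdivrMr// -lee_fin fineK// le_max; apply/orP; right.
  by apply: ereal_sup_ubound; exists (y, z).
apply: (@hausdorff_lebesgue_zero_set _ _ Omega N f (fun=> 0%E) sigma alpha 0
  (fine S * n%:R `^ sigma)) => //.
- by rewrite mulr_ge0 ?powR_ge0// fine_ge0.
- by rewrite harm_oo.
- move=> x Ox.
  have := holder_oscillation Omega_open sigma_gt0 mN N0 (fine_ge0 S0) fL Ox.
  by apply: filterS => j Hj M M0 _; exact: Hj.
Qed.
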